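(* Let $n \geq 1$ and let $T \in \mathbb{C}^n \otimes \mathbb{C}^n \otimes \mathbb{C}^n$ be a concise tensor. Then $\dim G_T \leq n^2 + 1$. Moreover, equality $\dim G_T = n^2+1$ holds exactly when (1) $T \cong \mathsf{N}_n$ or $T$ is isomorphic to a tensor obtained from $\mathsf{N}_n$ by permuting the three tensor factors, or (2) $n = 3$ and $T \cong \mathsf{D}$.
   Context: The group $G = \mathrm{GL}_n(\mathbb{C}) \times \mathrm{GL}_n(\mathbb{C}) \times \mathrm{GL}_n(\mathbb{C})$ acts on $\mathbb{C}^n \otimes \mathbb{C}^n \otimes \mathbb{C}^n$ by $(A,B,C)\cdot(u\otimes v\otimes w) = Au\otimes Bv\otimes Cw$, extended linearly. The stabilizer of $T$ is $G_T = \{g \in G : g\cdot T = T\}$, and $\dim G_T$ is its dimension as an algebraic group. Write $S \cong T$ if $S \in G\cdot T$. For $T=(T_{ijk})$, the slices in direction 3 are the $n\times n$ matrices $M_k = (T_{ijk})_{i,j}$, $k=1,\dots,n$. The tensor $T$ is concise if: the $n \times n^2$ matrix obtained by concatenating $M_1,\dots,M_n$ horizontally has rank $n$; the $n^2\times n$ matrix obtained by concatenating $M_1,\dots,M_n$ vertically has rank $n$; and $\dim \operatorname{span}(M_1,\dots,M_n) = n$. (Equivalently, all three flattenings of $T$ have rank $n$.) With $e_1,\dots,e_n$ the standard basis of $\mathbb{C}^n$, the null algebra tensor is $\mathsf{N}_n = e_1 \otimes e_1 \otimes e_1 + \sum_{i=2}^n (e_i \otimes e_i \otimes e_1 + e_i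 \otimes e_1 \otimes e_i) \in \mathbb{C}^n\otimes\mathbb{C}^n\otimes\mathbb{C}^n$. The skew-symmetric tensor is $\mathsf{D} = e_1 \wedge e_2 \wedge e_3 = \sum_{\pi \in S_3} \operatorname{sign}(\pi)\, e_{\pi(1)} \otimes e_{\pi(2)} \otimes e_{\pi(3)} \in \mathbb{C}^3 \otimes \mathbb{C}^3 \otimes \mathbb{C}^3$. *)

(* Defs.v *)
From HB Require Import structures.
From mathcomp Require Import all_boot all_order all_algebra all_fingroup.
From mathcomp Require Import classical_sets reals complex.
From mathcomp Require Import mpoly.

Set Implicit Arguments.
Unset Strict Implicit.
Unset Printing Implicit Defensive.

Import GRing.Theory.
Local Open Scope classical_set_scope.
Local Open Scope ring_scope.

(* Zariski topology on the affine space K^N, whose points are row vectors. *)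
Section Zariski.
Variables (K : fieldType) (N : nat).
Implicit Types X Y Z : set 'rV[K]_N.

Definition zero_locus (S : set {mpoly K[N]}) : set 'rV[K]_N :=
  [set x | forall p, S p -> p.@[fun i => x 0 i] = 0].

Definition zariski_closed Z := exists S, Z = zero_locus S.

(* Closed for the topology induced on X. *)
Definition closed_in X Y := exists2 Z, zariski_closed Z & Y = X `&` Z.

Definition irreducible Y :=
  Y !=set0 /\
  forall Z1 Z2, zariski_closed Z1 -> zariski_closed Z2 ->
    Y `<=` Z1 `|` Z2 -> Y `<=` Z1 \/ Y `<=` Z2.

(* Strictly increasing chain F 0, ..., F d of irreducible closed subsets
   of X: it has d + 1 members and length d. *)
Definition irreducible_chain X (d : nat) (F : nat -> set 'rV[K]_N) :=
  (forall i, (i <= d)%N -> closed_in X (F i) /\ irreducible (F i)) /\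
  (forall i, (i < d)%N -> F i `<` F i.+1).

Definition is_krull_dim X (d : nat) :=
  (exists F, irreducible_chain X d F) /\
  (forall m F, irreducible_chain X m F -> (m <= d)%N).

End Zariski.

Section Tensors.
Variables (K : fieldType) (n : nat).

(* An element of K^n (x) K^n (x) K^n, given by its coordinates in the basis
   e_i (x) e_j (x) e_k. *)
Definition tensor := {ffun 'I_n * 'I_n * 'I_n -> K}.

Definition rank1 (u v w : 'cV[K]_n) : tensor :=
  [ffun x => u x.1.1 0 * v x.1.2 0 * w x.2 0].

(* Basis vectors are numbered from 0; evec k = 0 when n <= k. *)
Definition evec (k : nat) : 'cV[K]_n := \col_i ((i : nat) == k)%:R.

Definition triple := ('M[K]_n * 'M[K]_n * 'M[K]_n)%type.

Definition GL3 : set triple :=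
  [set g | [/\ g.1.1 \in unitmx, g.1.2 \in unitmx & g.2 \in unitmx]].

(* T is the sum of the T (a, b, c) e_a (x) e_b (x) e_c, and col a A = A e_a. *)
Definition act (g : triple) (T : tensor) : tensor :=
  [ffun x => \sum_a \sum_b \sum_c
     T (a, b, c) * rank1 (col a g.1.1) (col b g.1.2) (col c g.2) x].

Definition tensor_iso (S T : tensor) := exists2 g, GL3 g & S = act g T.

(* The group GL_n x GL_n x GL_n as a subset of affine space of dimension
   3 n^2, through the entries of the matrices. *)
Definition coords (g : triple) : 'rV[K]_(n * n + n * n + n * n) :=
  row_mx (row_mx (mxvec g.1.1) (mxvec g.1.2)) (mxvec g.2).

Definition stabilizer (T : tensor) : set triple :=
  [set g | GL3 g /\ act g T = T].

Definition is_stab_dim (T : tensor) (d : nat) :=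
  is_krull_dim (coords @` stabilizer T) d.

Definition slice (T : tensor) (k : 'I_n) : 'M[K]_n :=
  \matrix_(i, j) T (i, j, k).

Definition concise (T : tensor) :=
  [/\ \rank (\mxrow_(k < n) slice T k) = n,
      \rank (\mxcol_(k < n) slice T k) = n
    & \dim <<[seq slice T k | k : 'I_n]>>%VS = n].

Definition permute_factors (s : 'S_3) (T : tensor) : tensor :=
  [ffun x => let y := tnth [tuple x.1.1; x.1.2; x.2] in
     T (y (s (inord 0)), y (s (inord 1)), y (s (inord 2)))].

Definition null_algebra : tensor :=
  rank1 (evec 0) (evec 0) (evec 0) +
  \sum_(1 <= i < n) (rank1 (evec i) (evec i) (evec 0) +
                     rank1 (evec i) (evec 0) (evec i)).

(* e_0 /\ e_1 /\ e_2 for n = 3. Leaving n free allows comparing it, under the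
   hypothesis n = 3, with an n x n x n tensor without a cast. *)
Definition skew_tensor : tensor :=
  [ffun x => \sum_(s : 'S_3) (-1) ^+ s *
     rank1 (evec (s (inord 0))) (evec (s (inord 1))) (evec (s (inord 2))) x].

End Tensors.

(* Main.v *)
(** The stabilizer is bounded by its Lie algebra g_T: along a chain of length m of
    irreducible closed subsets, functions that separate consecutive members are
    algebraically independent, and in characteristic 0 point derivations extend
    through algebraic elements, so that at a general point the chain gives m
    independent tangent vectors, which left translation moves into g_T.

    Write T(c) for the combination of the slices with coefficients c and r for the
    maximal rank of the T(c); dim g_T is bounded by injective linear maps out of
    g_T. If r = n, normalise T(c0) = 1; evaluating (X, Y, Z) at suitable vectors is
    injective with a target of dimension n^2 + 1, and surjectivity forces each T(c)
    to be a scalar plus a matrix of rank at most one, with a common row or column: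
    this is the null algebra. If 3 <= r < n, normalise T(c0) to the idempotent of
    rank r; the Schur complement gives T(c) a zero block, and counting yields
    dim g_T <= n^2. If r = 2 < n, either the slices in another direction contain an
    invertible matrix, or n = 3 and T is the skew-symmetric tensor. The case
    r <= 1 < n contradicts conciseness.

    Conversely, chains of length n^2 + 1 for the two model tensors come from rational
    parametrizations with polynomial inverses: a flag of affine subspaces of the
    parameter space is mapped to irreducible sets. *)
From HB Require Import structures.
From mathcomp Require Import all_boot all_order all_algebra all_fingroup.
From mathcomp Require Import classical_sets boolp reals complex mpoly.
From mathcomp Require Import ring zify.
Require Import Defs.

Set Implicit Arguments.
Unset Strict Implicit.
Unset Printing Implicit Defensive.

Import GRing.Theory Num.Theory.
Local Open Scope classical_set_scope.
Local Open Scope ring_scope.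

(** * Extension of point derivations *)

(** Only one inequality, dim G_T <= dim g_T, links the group to its Lie algebra. It suffices: dim
    G_T = n^2 + 1 together with dim g_T <= n^2 + 1 makes g_T extremal, the classification then takes
    place in g_T by linear algebra, and the explicit chains return from the models to the group. The
    constant n^2 + 1 has two sources of economy when T(c0) = 1. Elements (X, Y, Z) with c0 Z = 0 act
    on the slices by commutators with X, and commutators have trace zero, which saves one coordinate
    of c1 Z. If moreover c1 Z = 0, then X commutes with the nonscalar M = T(c1), so that each vector
    tested against X also tests its image under M. The rank r = 2 stands apart because the count
    used for singular slices with a common column gives n^2 + 1 - s (r - 2), where s = n - r: for r
    >= 3 this is at most n^2, for r = 2 it is n^2 + 1 and cannot exclude equality. The structure of
    the slices has to be used there. All of this looks at slices in direction 3; the other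
    directions are reached by exchanging factors. *)

Section PointDerivations.
Variables (K : fieldType) (B : idomainType) (P : B -> Prop).
Implicit Types (S : B -> Prop) (ev : {rmorphism B -> K}) (d : B -> K).

Hypothesis P0 : P 0.
Hypothesis PD : forall a b, P a -> P b -> P (a + b).
Hypothesis PM : forall a b, P b -> P (a * b).
Hypothesis Pprime : forall a b, P (a * b) -> P a \/ P b.
Hypothesis Pproper : ~ P 1.
Hypothesis Pchar : forall k a, P (a *+ k.+1) -> P a.

Definition subring S :=
  [/\ S 1, forall a b, S a -> S b -> S (a - b) & forall a b, S a -> S b -> S (a * b)].

(* Derivations at a point, relative to evaluation ev there, that vanish on P. *)
Definition point_derivation ev S d :=
  [/\ forall a b, S a -> S b -> d (a + b) = d a + d b,
      forall a b, S a -> S b -> d (a * b) = ev a * d b + ev b * d a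
    & forall a, S a -> P a -> d a = 0].

Definition over S (p : {poly B}) := forall i, S p`_i.

Definition adjoin S x b := exists2 p, over S p & b = p.[x].

Lemma subring0 S : subring S -> S 0.
Proof. by case=> S1 SB _; rewrite -(subrr 1); exact: SB. Qed.

Lemma subringN S a : subring S -> S a -> S (- a).
Proof. by move=> Ss Sa; case: (Ss) => _ SB _; rewrite -sub0r; apply: SB => //; apply: subring0. Qed.

Lemma subringD S a b : subring S -> S a -> S b -> S (a + b).
Proof.
move=> Ss Sa Sb; case: (Ss) => _ SB _; rewrite -[b]opprK; apply: SB => //.
exact: subringN.
Qed.

Lemma subring_sum S I (r : seq I) (F : I -> B) :
  subring S -> (forall i, S (F i)) -> S (\sum_(i <- r) F i).
Proof.
move=> Ss SF; elim/big_rec: _ => [|i a _ Sa]; first exact: subring0.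
exact: (subringD Ss (SF i) Sa).
Qed.

Lemma subring_mulrn S a k : subring S -> S a -> S (a *+ k).
Proof.
move=> Ss Sa; elim: k => [|k IH]; first exact: subring0.
by rewrite mulrS; exact: (subringD Ss Sa IH).
Qed.

Lemma P_mulrn a k : P a -> P (a *+ k).
Proof. by move=> Pa; rewrite -mulr_natl; exact: PM. Qed.

Lemma overB S p q : subring S -> over S p -> over S q -> over S (p - q).
Proof. by move=> [_ SB _] Sp Sq i; rewrite coefB; exact: SB. Qed.

Lemma overD S p q : subring S -> over S p -> over S q -> over S (p + q).
Proof. by move=> Ss Sp Sq i; rewrite coefD; exact: subringD. Qed.

Lemma overM S p q : subring S -> over S p -> over S q -> over S (p * q).
Proof.
by move=> Ss Sp Sq i; rewrite coefM; apply: subring_sum => // j; case: Ss => _ _; apply.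
Qed.

Lemma overC S c : subring S -> S c -> over S c%:P.
Proof. by move=> Ss Sc i; rewrite coefC; case: eqP => // _; exact: subring0. Qed.

Lemma overXn S k : subring S -> over S 'X^k.
Proof.
move=> Ss i; rewrite coefXn; case: eqP => _; last exact: subring0.
by case: Ss.
Qed.

Lemma over_deriv S p : subring S -> over S p -> over S p^`().
Proof.
by move=> Ss Sp i; rewrite coef_deriv; exact: subring_mulrn.
Qed.

Lemma adjoin_subring S x : subring S -> subring (adjoin S x).
Proof.
move=> Ss; split.
- by exists 1%:P; [apply: overC => //; case: Ss | rewrite hornerC].
- by move=> _ _ [p Sp ->] [q Sq ->]; exists (p - q); [exact: overB | rewrite hornerD hornerN].
- by move=> _ _ [p Sp ->] [q Sq ->]; exists (p * q); [exact: overM | rewrite hornerM].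
Qed.

Lemma adjoin_base S x b : subring S -> S b -> adjoin S x b.
Proof. by move=> Ss Sb; exists b%:P; [exact: overC | rewrite hornerC]. Qed.

Lemma adjoin_gen S x : subring S -> adjoin S x x.
Proof. by move=> Ss; exists 'X; [have := overXn 1 Ss; rewrite expr1 | rewrite hornerX]. Qed.

Lemma P_horner (p : {poly B}) x : (forall i, P p`_i) -> P p.[x].
Proof.
move=> Pp; rewrite horner_coef; elim/big_rec: _ => [|i a _ Pa]; first exact: P0.
by apply: PD => //; rewrite mulrC; exact: PM.
Qed.

Section Extension.
Variables (S : B -> Prop) (ev : {rmorphism B -> K}) (d : B -> K) (x : B) (w : K).
Hypothesis Ss : subring S.
Hypothesis dS : point_derivation ev S d.
Hypothesis evP : forall a, P a -> ev a = 0.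

(** The only possible value at [p.[x]] of an extension of [d] with value [w] at [x]: differentiate
    the coefficients, then the variable. *)
Let D (p : {poly B}) := (map_poly d p).[ev x] + ev p^`().[x] * w.

Let d0 : d 0 = 0.
Proof.
by case: dS => dD _ _; have := dD 0 0 (subring0 Ss) (subring0 Ss); rewrite addr0 -{1}[d 0]addr0 => /addrI.
Qed.

Let d1 : d 1 = 0.
Proof.
case: dS => _ dM _; case: (Ss) => S1 _ _.
by have := dM 1 1 S1 S1; rewrite mulr1 rmorph1 mul1r -{1}[d 1]addr0 => /addrI.
Qed.

Let d_sum I (r : seq I) (F : I -> B) :
  (forall i, S (F i)) -> d (\sum_(i <- r) F i) = \sum_(i <- r) d (F i).
Proof.
move=> SF; elim: r => [|i r IH]; first by rewrite !big_nil.
rewrite !big_cons; case: dS => dD _ _; rewrite dD ?IH //.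
exact: subring_sum.
Qed.

Let DD p q : over S p -> over S q -> D (p + q) = D p + D q.
Proof.
move=> Sp Sq; rewrite /D.
have -> : map_poly d (p + q) = map_poly d p + map_poly d q.
  apply/polyP=> i; rewrite coefD !coef_map_id0 // coefD.
  by case: dS => -> //.
by rewrite derivD !hornerD rmorphD /= mulrDl addrACA.
Qed.

Let DM p q : over S p -> over S q -> D (p * q) = ev p.[x] * D q + ev q.[x] * D p.
Proof.
move=> Sp Sq; rewrite /D.
have -> : map_poly d (p * q) = map_poly ev p * map_poly d q + map_poly ev q * map_poly d p.
  apply/polyP=> i; rewrite coefD coefM coefMr -big_split /= coef_map_id0 // coefM.
  rewrite d_sum => [|j]; last by case: Ss => _ _; apply.
  apply: eq_bigr => j _; rewrite !coef_map_id0 ?rmorph0 //.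
  by case: dS => _ -> //.
by rewrite derivM !hornerD !hornerM !horner_map !rmorphD !rmorphM /=; ring.
Qed.

(** [D] satisfies the sum and Leibniz rules on polynomials. It descends to the ring of the values
    [p.[x]] because it kills all relations modulo [P], among them those with [p.[x] = 0], so that
    the choice of p is immaterial. *)
Let D_lift : (forall p, over S p -> P p.[x] -> D p = 0) ->
  exists d', [/\ point_derivation ev (adjoin S x) d', (forall b, S b -> d' b = d b) & d' x = w].
Proof.
move=> D0.
pose d' b := if pselect (adjoin S x b) is left e then D (s2val (cid2 e)) else 0.
have d'E p : over S p -> d' p.[x] = D p.
  move=> Sp; rewrite /d'; case: pselect => [e|[]]; last by exists p.
  case: (cid2 e) => q Sq /= eq_pq; apply/eqP; rewrite -subr_eq0.
  have SN : over S (- p) by rewrite -sub0r; apply: overB => //; apply: (overC Ss); exact: subring0.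
  have D00 : D (p - p) = 0 by rewrite D0 ?subrr ?horner0 // => i; rewrite coef0; exact: subring0.
  have -> : - D p = D (- p) by apply/eqP; rewrite eq_sym -addr_eq0 addrC -DD // D00.
  rewrite -DD // D0 //; first exact: overB.
  by rewrite hornerD hornerN -eq_pq subrr.
exists d'; split; [split| |].
- by move=> _ _ [p Sp ->] [q Sq ->]; rewrite -hornerD !d'E ?DD //; exact: overD.
- by move=> _ _ [p Sp ->] [q Sq ->]; rewrite -hornerM !d'E ?DM //; exact: overM.
- by move=> _ [p Sp ->] Pp; rewrite d'E // D0.
- move=> b Sb; rewrite -[b in d' b](hornerC b x) d'E; last exact: overC.
  rewrite /D derivC horner0 rmorph0 mul0r addr0 (_ : map_poly d b%:P = (d b)%:P) ?hornerC //.
  by apply/polyP=> i; rewrite coef_map_id0 // !coefC; case: eqP.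
- rewrite -[x in d' x]hornerX d'E; last by have := overXn 1 Ss; rewrite expr1.
  rewrite /D derivX hornerC rmorph1 mul1r -['X]expr1.
  rewrite (_ : map_poly d 'X^1 = 0) ?horner0 ?add0r //.
  apply/polyP=> i; rewrite coef_map_id0 // coefXn coef0.
  by case: eqP.
Qed.

Lemma extend_transcendental :
  (forall p, over S p -> P p.[x] -> forall i, P p`_i) ->
  exists d', [/\ point_derivation ev (adjoin S x) d', (forall b, S b -> d' b = d b) & d' x = w].
Proof.
move=> tr; apply: D_lift => p Sp Pp.
have Pc := tr _ Sp Pp.
rewrite /D (_ : map_poly d p = 0) ?horner0 ?add0r; last first.
  apply/polyP=> i; rewrite coef0 coef_map_id0 //.
  by case: dS => _ _ ->.
rewrite evP ?mul0r //; apply: P_horner => i; rewrite coef_deriv.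
exact: P_mulrn.
Qed.

(** Pseudo-division by the relation [q] of minimal degree: as [ev (lead_coef q)] is nonzero, killing
    all relations reduces to degrees below that of [q], where the coefficients lie in [P], and to
    [D q = 0], which is the equation that fixes [w]. *)
Lemma extend_algebraic q :
  over S q -> ~ (forall i, P q`_i) -> P q.[x] ->
  (forall p, over S p -> P p.[x] -> (size p < size q)%N -> forall i, P p`_i) ->
  ev (lead_coef q) != 0 -> ev q^`().[x] != 0 -> w = - (map_poly d q).[ev x] / ev q^`().[x] ->
  exists d', [/\ point_derivation ev (adjoin S x) d', (forall b, S b -> d' b = d b) & d' x = w].
Proof.
move=> Sq nPq Pq qmin evl evq' wE; apply: D_lift.
have Dq : D q = 0 by rewrite /D wE mulrC divfK // subrr.
move=> p; have [m] := ubnP (size p); elim: m p => // m IH p ltm Sp Pp.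
have [ltpq|leqp] := ltnP (size p) (size q).
  have Pc := qmin _ Sp Pp ltpq.
  rewrite /D (_ : map_poly d p = 0) ?horner0 ?add0r; last first.
    apply/polyP=> i; rewrite coef0 coef_map_id0 //.
    by case: dS => _ _ ->.
  rewrite evP ?mul0r //; apply: P_horner => i; rewrite coef_deriv.
  exact: P_mulrn.
have q0 : q != 0 by apply/eqP=> q0; apply: nPq => i; rewrite q0 coef0.
have sq : (0 < size q)%N by rewrite lt0n size_poly_eq0.
pose k := (size p - size q)%N.
have Sl (r : {poly B}) : over S r -> over S (lead_coef r)%:P.
  by move=> Sr; apply: overC => //; exact: Sr.
have Sq1 : over S ((lead_coef p)%:P * 'X^k * q).
  by apply: overM => //; apply: overM => //; [exact: Sl | exact: overXn].
have Sp1 : over S ((lead_coef q)%:P * p) by apply: overM => //; exact: Sl.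
have SN : over S (- ((lead_coef p)%:P * 'X^k * q)).
  by move=> i; rewrite coefN; apply: subringN.
have D1 : D ((lead_coef q)%:P * p) = ev (lead_coef q) * D p.
  by rewrite DM //; [rewrite hornerC (evP Pp) mul0r addr0 | exact: Sl].
have D2 : D ((lead_coef p)%:P * 'X^k * q) = 0.
  rewrite DM // ?Dq ?mulr0 ?add0r ?(evP Pq) ?mul0r //.
  by apply: overM => //; [exact: Sl | exact: overXn].
have D00 : D 0 = 0.
  have m0 : map_poly d 0 = 0 by apply/polyP=> i; rewrite coef_map_id0 // !coef0.
  by rewrite /D m0 deriv0 !horner0 rmorph0 mul0r addr0.
have DN : D (- ((lead_coef p)%:P * 'X^k * q)) = 0.
  by have := DD Sq1 SN; rewrite subrr D00 D2 add0r.
have : D ((lead_coef q)%:P * p - (lead_coef p)%:P * 'X^k * q) = 0.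
  apply: IH; last 2 first.
  - exact: overB.
  - rewrite hornerD hornerN !hornerM; apply: PD; first exact: PM.
    by rewrite -mulNr; exact: PM.
  have sp : (0 < size p)%N by exact: leq_trans leqp.
  suff : (size ((lead_coef q)%:P * p - (lead_coef p)%:P * 'X^k * q)%R <= (size p).-1)%N by lia.
  apply/leq_sizeP => j lej; rewrite coefB coefCM -mulrA coefCM coefXnM.
  have [ltj|] := ltnP j k; first by lia.
  move=> lekj; have [ej|nej] := eqVneq j (size p).-1.
    rewrite ej (_ : ((size p).-1 - k)%N = (size q).-1); last by rewrite /k; lia.
    by rewrite /lead_coef mulrC subrr.
  have ltpj : (size p <= j)%N by rewrite -(prednK sp) ltn_neqAle eq_sym nej lej.
  have -> : p`_j = 0 by apply: nth_default.
  have -> : q`_(j - k) = 0 by apply: nth_default; rewrite leq_subRL // subnK.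
  by rewrite !mulr0 subrr.
rewrite DD // DN addr0 D1 => /eqP; rewrite mulf_eq0 (negbTE evl) /=.
by move/eqP.
Qed.

End Extension.

Fixpoint gen S (s : seq B) := if s is x :: s' then adjoin (gen S s') x else S.

Lemma gen_subring S s : subring S -> subring (gen S s).
Proof. by move=> Ss; elim: s => //= x s IH; exact: adjoin_subring. Qed.

Lemma gen_base S s b : subring S -> S b -> gen S s b.
Proof.
by move=> Ss Sb; elim: s => //= x s IH; apply: adjoin_base => //; exact: gen_subring.
Qed.

Lemma gen_mem S s b : subring S -> b \in s -> gen S s b.
Proof.
move=> Ss; elim: s => //= x s IH; rewrite inE => /predU1P[->|/IH gb].
  by apply: adjoin_gen; exact: gen_subring.
by apply: adjoin_base => //; exact: gen_subring.
Qed.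

(** [delta] is the leading coefficient of a relation of minimal degree times its derivative at [x],
    or 1 if there is no relation: its zeros are the points where the value at [x] might not be
    solvable. *)
Lemma extend_one S x : subring S -> exists2 delta, ~ P delta &
  forall ev : {rmorphism B -> K}, (forall a, P a -> ev a = 0) -> ev delta != 0 ->
  forall d, point_derivation ev S d ->
  exists2 d', point_derivation ev (adjoin S x) d' & forall b, S b -> d' b = d b.
Proof.
move=> Ss.
pose alg q := [/\ over S q, ~ (forall i, P q`_i) & P q.[x]].
have [[q0 Aq0]|tr] := pselect (exists q, alg q); last first.
  exists 1 => // ev evP _ d dS.
  have [p Sp Pp i|d' [? ? _]] := @extend_transcendental S ev d x 0 Ss dS evP; last by exists d'.
  by apply: contrapT => nP; apply: tr; exists p; split=> // Pc; apply: nP.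
have [n [q [Aq sq]] nmin] :
    exists2 n, exists q, alg q /\ size q = n & forall k, (exists q, alg q /\ size q = k) -> (n <= k)%N.
  have ex : exists n, `[< exists q, alg q /\ size q = n >].
    by exists (size q0); apply/asboolP; exists q0.
  by case: (ex_minnP ex) => n /asboolP ? nmin; exists n => // k ?; apply: nmin; apply/asboolP.
have [Sq nPq Pq] := Aq.
have qmin p : over S p -> P p.[x] -> (size p < size q)%N -> forall i, P p`_i.
  move=> Sp Pp ltpq; apply: contrapT => nP.
  by have := nmin (size p) (ex_intro _ p (conj (And3 Sp nP Pp) erefl)); rewrite -sq leqNgt ltpq.
have q_neq0 : q != 0 by apply/eqP=> q00; apply: nPq => i; rewrite q00 coef0.
have sq_gt0 : (0 < size q)%N by rewrite lt0n size_poly_eq0.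
(* Otherwise dropping the leading term leaves a shorter relation, whose coefficients lie in [P] by
   minimality; then all those of [q] would. *)
have nPl : ~ P (lead_coef q).
  move=> Pl; apply: nPq; pose q1 := q - (lead_coef q)%:P * 'X^((size q).-1).
  have S1 : over S q1.
    by apply: overB => //; apply: overM => //; [apply: overC => //; exact: Sq | exact: overXn].
  have P1 : forall i, P q1`_i.
    apply: qmin => //.
      rewrite hornerD hornerN hornerM hornerC mulrC -mulrN; apply: PD => //.
      by apply: PM; rewrite -mulN1r; exact: PM.
    suff : (size q1 <= (size q).-1)%N by rewrite -{2}(prednK sq_gt0) ltnS.
    apply/leq_sizeP => j lej; rewrite coefB coefCM coefXn.
    have [->|nej] := eqVneq j (size q).-1; first by rewrite mulr1 subrr.
    rewrite mulr0 subr0; apply: nth_default.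
    by rewrite -(prednK sq_gt0) ltn_neqAle eq_sym nej lej.
  move=> i; have -> : q`_i = q1`_i + (lead_coef q)*('X^((size q).-1))`_i.
    by rewrite coefB coefCM subrK.
  by apply: PD => //; rewrite mulrC; apply: PM.
have sq_gt1 : (1 < size q)%N.
  rewrite ltn_neqAle sq_gt0 andbT; apply/negP => /eqP s1; apply: nPl.
  have q_c : q = (q`_0)%:P by apply: size1_polyC; rewrite -s1.
  by move: Pq; rewrite q_c hornerC lead_coefC.
(* The derivative is shorter than [q], so as a relation it would have its coefficients in [P], among
   them a positive multiple of the leading coefficient of [q]; here characteristic zero enters. *)
have nPq' : ~ P q^`().[x].
  move=> Pq'; apply: nPl.
  have := qmin _ (over_deriv Ss Sq) Pq' (lt_size_deriv q_neq0) (size q).-2.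
  rewrite coef_deriv => /Pchar; rewrite /lead_coef.
  by rewrite (_ : (size q).-2.+1 = (size q).-1) // prednK // -ltnS prednK.
exists (lead_coef q * q^`().[x]); first by case/Pprime.
move=> ev evP; rewrite rmorphM mulf_eq0 negb_or => /andP[evl evq'] d dS.
by have [d' [? ? _]] := extend_algebraic Ss dS evP Sq nPq Pq qmin evl evq' erefl; exists d'.
Qed.

Lemma extend_many S s : subring S -> exists2 delta, ~ P delta &
  forall ev : {rmorphism B -> K}, (forall a, P a -> ev a = 0) -> ev delta != 0 ->
  forall d, point_derivation ev S d ->
  exists2 d', point_derivation ev (gen S s) d' & forall b, S b -> d' b = d b.
Proof.
move=> Ss; elim: s => [|x s [delta1 nP1 ext1]] /=.
  by exists 1 => // ev evP _ d dS; exists d.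
have [delta2 nP2 ext2] := extend_one x (gen_subring s Ss).
exists (delta1 * delta2); first by case/Pprime.
move=> ev evP; rewrite rmorphM mulf_eq0 negb_or => /andP[ev1 ev2] d dS.
have [d1 d1S d1E] := ext1 ev evP ev1 d dS.
have [d2 d2S d2E] := ext2 ev evP ev2 d1 d1S.
by exists d2 => // b Sb; rewrite d2E ?d1E //; exact: gen_base.
Qed.

Fixpoint transcendental S s := if s is x :: s' then
  transcendental S s' /\ forall p, over (gen S s') p -> P p.[x] -> p = 0 else True.

Lemma extend_free S s (ev : {rmorphism B -> K}) d (v : nat -> K) :
  subring S -> (forall a, P a -> ev a = 0) -> point_derivation ev S d -> transcendental S s ->
  exists d', [/\ point_derivation ev (gen S s) d', forall b, S b -> d' b = d b &
    forall i, (i < size s)%N -> d' s`_i = v i].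
Proof.
move=> Ss evP dS; elim: s v => [|x s IH] v /= => [_|[ts tx]]; first by exists d.
have [d1 [d1S d1b d1E]] := IH (v \o succn) ts.
have [||||d2 [d2S d2E d2x]] := @extend_transcendental (gen S s) ev d1 x (v 0%N) => //.
- exact: gen_subring.
- by move=> p Sp /(tx _ Sp) -> i; rewrite coef0.
exists d2; split=> // [b Sb|[|i] //= lti]; first by rewrite d2E ?d1b //; exact: gen_base.
by rewrite d2E ?d1E //; apply: gen_mem => //; exact: mem_nth.
Qed.

End PointDerivations.

(* If x lies in P but not in the smaller prime ideal Q, then x is transcendental
   modulo Q over a subring meeting P trivially: a relation of minimal degree has
   its constant term in P. *)
Lemma transcendental_drop (B : idomainType) (P Q S : B -> Prop) (x : B) :
  (forall a b, P a -> P b -> P (a - b)) -> (forall a b, P b -> P (a * b)) ->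
  (forall a b, Q (a * b) -> Q a \/ Q b) -> (forall a, Q a -> P a) ->
  (forall a, S a -> P a -> a = 0) -> P x -> ~ Q x ->
  forall p, over S p -> Q p.[x] -> p = 0.
Proof.
move=> PB PM Qprime QP SP Px nQx; elim/poly_ind => // p c IH Sp.
rewrite hornerD hornerM hornerX hornerC => Qp.
have Sc : S c by have := Sp 0%N; rewrite coefD coefMX coefC add0r.
have c0 : c = 0.
  apply: SP => //; have := PB _ _ (QP _ Qp) (PM p.[x] x Px).
  by rewrite addrAC subrr add0r.
have p0 : p = 0.
  apply: IH => [i|]; first by have := Sp i.+1; rewrite coefD coefMX coefC /= addr0.
  by move: Qp; rewrite c0 addr0 => /Qprime[].
by rewrite p0 c0 mul0r add0r.
Qed.

(** * Tangent vectors along a chain of irreducible sets *)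

Section ChainTangent.
Variables (K : numFieldType) (N : nat).
Implicit Types (X Y Z : set 'rV[K]_N) (y : 'rV[K]_N) (p q : {mpoly K[N]}).

Definition pt y : 'I_N -> K := fun i => y 0 i.

Definition vanishing Y p := forall y, Y y -> p.@[pt y] = 0.

Lemma closed_zeros p : zariski_closed [set x : 'rV[K]_N | p.@[pt x] = 0].
Proof.
exists [set q | q = p]; apply/seteqP; split=> [x /= px _ ->|x /= H]; first exact: px.
exact: H.
Qed.

Lemma vanishing_prime Y p q : irreducible Y -> vanishing Y (p * q) ->
  vanishing Y p \/ vanishing Y q.
Proof.
move=> [_ irr] pq; have [|//|//] := irr _ _ (closed_zeros p) (closed_zeros q).
  by move=> y /pq /eqP; rewrite mevalM mulf_eq0 => /orP[]/eqP; [left|right].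
- by left.
- by right.
Qed.

Lemma mpoly_generated (S : {mpoly K[N]} -> Prop) :
  (forall c, S c%:MP) -> (forall i, S 'X_i) -> (forall p q, S p -> S q -> S (p + q)) ->
  (forall p q, S p -> S q -> S (p * q)) -> forall p, S p.
Proof.
move=> SC SX SD SM; elim/mpolyind => [|c m p _ _ Sp]; first by rewrite -mpolyC0.
apply: (SD) => //; rewrite -mul_mpolyC; apply: (SM) => //.
rewrite mpolyXE_id; elim/big_rec: _ => [|i q _ Sq]; first by rewrite -mpolyC1.
apply: (SM) => //; elim: (m i) => [|k IH]; first by rewrite expr0 -mpolyC1.
by rewrite exprS; apply: (SM).
Qed.

Lemma chain_tangent X m F : irreducible_chain X m F ->
  exists y, X y /\ exists d : 'I_m -> {mpoly K[N]} -> K,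
    [/\ forall i, [/\ forall p q, d i (p + q) = d i p + d i q,
                   forall p q, d i (p * q) = p.@[pt y] * d i q + q.@[pt y] * d i p,
                   forall c, d i c%:MP = 0
                 & forall p, vanishing X p -> d i p = 0]
      & row_free (\matrix_(i, j) d i 'X_j)].
Proof.
move=> [Firr Flt].
pose P l := vanishing (F l).
have sub l : (l < m)%N -> F l `<=` F l.+1 by move=> /Flt/properW.
have PB l p q : P l p -> P l q -> P l (p - q).
  by move=> Pp Pq y Fy; rewrite mevalB Pp ?Pq ?subrr.
have PD l p q : P l p -> P l q -> P l (p + q).
  by move=> Pp Pq y Fy; rewrite mevalD Pp ?Pq ?addr0.
have PM l p q : P l q -> P l (p * q).
  by move=> Pq y Fy; rewrite mevalM Pq ?mulr0.
have PS l p : (l < m)%N -> P l.+1 p -> P l p.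
  by move=> ltl Pp y Fy; apply: Pp; exact: sub ltl _ Fy.
have Pprime l : (l <= m)%N -> forall p q, P l (p * q) -> P l p \/ P l q.
  by move=> /Firr[_ irr] p q; exact: vanishing_prime.
have Pproper l : (l <= m)%N -> ~ P l 1.
  by move=> /Firr[_ [[y Fy] _]] /(_ _ Fy)/eqP; rewrite meval1 oner_eq0.
have P0 l : P l 0 by move=> y _; rewrite meval0.
pose S0 : {mpoly K[N]} -> Prop := fun b => exists c, b = c%:MP.
have SS0 : subring S0.
  split; first by exists 1; rewrite mpolyC1.
  - by move=> _ _ [a ->] [b ->]; exists (a - b); rewrite mpolyCB.
  - by move=> _ _ [a ->] [b ->]; exists (a * b); rewrite mpolyCM.
(* Each strict inclusion adds one function, zero on [F l] but not on [F l.+1]. That the subring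
   generated so far meets [P l] only in zero is what [transcendental_drop] requires to make the new
   function transcendental modulo [P l.+1]. *)
have tower l : (l <= m)%N -> exists s, [/\ size s = l, 
     forall p, gen S0 s p -> P l p -> p = 0 & transcendental (P l) S0 s].
  elim: l => [|l IH] lel.
    exists [::]; split=> // _ [c ->] Pc; suff -> : c = 0 by rewrite mpolyC0.
    by case: (Firr 0%N lel) => _ [[y /Pc]]; rewrite mevalC.
  have [s [sz s0 ts]] := IH (ltnW lel).
  have [x Px nPx] : exists2 x, P l x & ~ P l.+1 x.
    have [_ nsub] := Flt l lel.
    have [[Z [E ZE] FE] _] := Firr l (ltnW lel).
    apply: contrapT => nx; apply: nsub => y Fy.
    have Xy : X y by case: (Firr _ lel) => [[Z' _ FE'] _]; move: Fy; rewrite FE' => -[].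
    rewrite FE; split=> //; rewrite ZE => p Ep; apply: contrapT => npy; apply: nx; exists p.
      by move=> z; rewrite FE ZE => -[_]; apply.
    by move=> /(_ _ Fy).
  exists (x :: s) => /=; split; first by rewrite sz.
    move=> _ [p Sp ->] Pp.
    have -> : p = 0 by apply: (transcendental_drop (@PB l) (@PM l) (Pprime _ lel) _ s0 Px nPx Sp Pp) => a /PS; apply.
    by rewrite horner0.
  have mono s' : transcendental (P l) S0 s' -> transcendental (P l.+1) S0 s'.
    elim: s' => //= z s' IHs [/IHs t1 t2]; split=> // p Sp Pp; apply: t2 => //.
    exact: PS Pp.
  split; first exact: mono.
  by move=> p Sp Pp; apply: (transcendental_drop (@PB l) (@PM l) (Pprime _ lel) _ s0 Px nPx Sp Pp) => a /PS; apply.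
have [s [sz _ ts]] := tower m (leqnn m).
pose xs : seq {mpoly K[N]} := [seq 'X_i | i <- enum 'I_N].
have Pchar k a : P m (a *+ k.+1) -> P m a.
  by move=> Pa y /Pa/eqP; rewrite mevalMn mulrn_eq0 => /eqP.
have SS := gen_subring s SS0.
have [delta nPd ext] := @extend_many K _ (P m) (P0 m) (@PD m) (@PM m) (Pprime _ (leqnn m))
   (Pproper _ (leqnn m)) Pchar _ xs SS.
have [y [Fy dy]] : exists y, F m y /\ delta.@[pt y] != 0.
  apply: contrapT => ny; apply: nPd => y Fy; apply: contrapT => /eqP dy; apply: ny; by exists y.
have Xy : X y by case: (Firr _ (leqnn m)) => [[Z' _ FE'] _]; move: Fy; rewrite FE' => -[].
exists y; split=> //.
pose ev : {rmorphism {mpoly K[N]} -> K} := meval (pt y).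
have evP a : P m a -> ev a = 0 by apply.
have d0 : point_derivation (P m) ev S0 (fun=> 0).
  by split=> // a b _ _; rewrite ?addr0 // !mulr0 addr0.
have all_gen p : gen (gen S0 s) xs p.
  have G := gen_subring xs SS; apply: mpoly_generated p.
  - by move=> c; do 2 apply: gen_base => //; exists c.
  - by move=> i; apply: gen_mem => //; apply: map_f; rewrite mem_enum.
  - by move=> a b; exact: subringD.
  - by case: G.
have dex (i : 'I_m) : exists d : {mpoly K[N]} -> K,
   [/\ [/\ forall p q, d (p + q) = d p + d q,
       forall p q, d (p * q) = p.@[pt y] * d q + q.@[pt y] * d p,
       forall c, d c%:MP = 0 & forall p, vanishing X p -> d p = 0] &
       forall l : 'I_m, d s`_l = (i == l)%:R].
  have [d1 [d1S d1b d1E]] := @extend_free K _ (P m) (P0 m) (@PD m) (@PM m) S0 s ev (fun=> 0)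
     (fun l => ((i : nat) == l)%:R) SS0 evP d0 ts.
  have [d2 [dD dM dP] d2E] := ext ev evP dy d1 d1S.
  exists d2; split; first split.
  - by move=> p q; apply: dD.
  - by move=> p q; apply: dM.
  - by move=> c; rewrite d2E ?d1b //; [exists c | apply: gen_base => //; exists c].
  - by move=> p Xp; apply: dP => // z Fz; apply: Xp; case: (Firr _ (leqnn m)) => [[Z' _ FE'] _]; move: Fz; rewrite FE' => -[].
  - move=> l; rewrite d2E ?d1E ?sz //.
    by apply: gen_mem => //; apply: mem_nth; rewrite sz.
have [d dE] := choice dex; exists d; split; first by move=> i; case: (dE i).
apply: inj_row_free => u /rowP uM.
(* A combination of the derivations that kills the coordinates kills every polynomial, by the
   Leibniz rule; its values at the separating functions [s] are its coefficients. *)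
pose D p := \sum_i u 0 i * d i p.
have D0 : forall p, D p = 0.
  have dd i := let: And4 a b c _ := (let: conj h _ := dE i in h) in (a, b, c).
  apply: mpoly_generated.
  - by move=> c; rewrite /D big1 // => i _; rewrite (dd i).2 mulr0.
  - move=> j; have := uM j; rewrite !mxE => H; rewrite -[RHS]H; apply: eq_bigr => i _; by rewrite mxE.
  - move=> p q Dp Dq; have -> : D (p + q) = D p + D q; last by rewrite Dp Dq addr0.
    by rewrite /D -big_split; apply: eq_bigr => i _; rewrite (dd i).1.1 mulrDr.
  - move=> p q Dp Dq.
    have -> : D (p * q) = p.@[pt y] * D q + q.@[pt y] * D p; last by rewrite Dp Dq !mulr0 addr0.
    rewrite /D !mulr_sumr -big_split; apply: eq_bigr => i _ /=.
    by rewrite (dd i).1.2 mulrDr; ring.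
apply/rowP => l; rewrite mxE -[RHS](D0 s`_l) /D (bigD1 l) //= big1 ?addr0 => [|i nil].
  by case: (dE l) => _ ->; rewrite eqxx mulr1.
by case: (dE i) => _ ->; rewrite (negbTE nil) mulr0.
Qed.

End ChainTangent.

HB.lock Definition sl (K : fieldType) n (T : tensor K n) (c : 'rV[K]_n) : 'M[K]_n :=
  \sum_k c 0 k *: slice T k.

(** * Slices and the Lie algebra of the stabilizer *)

Section Slices.
Variables (K : fieldType) (n : nat).
Implicit Types (T : tensor K n) (g : triple K n) (c : 'rV[K]_n).

Lemma slE T c i j : sl T c i j = \sum_k c 0 k * T (i, j, k).
Proof. by rewrite sl.unlock summxE; apply: eq_bigr => k _; rewrite !mxE. Qed.

Lemma sl_linear T : linear (sl T).
Proof.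
move=> a c d; rewrite sl.unlock scaler_sumr -big_split /=; apply: eq_bigr => k _.
by rewrite !mxE scalerDl scalerA.
Qed.
HB.instance Definition _ T :=
  GRing.isLinear.Build K 'rV[K]_n 'M[K]_n _ (sl T) (sl_linear T).

Lemma sl_delta T k : sl T (delta_mx 0 k) = slice T k.
Proof.
apply/matrixP=> i j; rewrite slE (bigD1 k) //= big1 ?addr0 => [|l nlk]; rewrite !mxE.
  by rewrite !eqxx mul1r.
by rewrite eqxx (negbTE nlk) mul0r.
Qed.

Lemma tensor_sl T i j k : T (i, j, k) = sl T (delta_mx 0 k) i j.
Proof. by rewrite sl_delta mxE. Qed.

Lemma eq_sl T T' : (forall c, sl T c = sl T' c) -> T = T'.
Proof. by move=> e; apply/ffunP => -[[i j] k]; rewrite !tensor_sl e. Qed.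

Lemma actE g T i j k : act g T (i, j, k) =
  \sum_a \sum_b \sum_c T (a, b, c) * (g.1.1 i a * g.1.2 j b * g.2 k c).
Proof.
rewrite ffunE; apply: eq_bigr => a _; apply: eq_bigr => b _; apply: eq_bigr => c _.
by rewrite ffunE !mxE.
Qed.

Lemma sl_triple T (A B C : 'M[K]_n) c i j :
  (A *m sl T (c *m C) *m B^T) i j =
  \sum_k c 0 k * \sum_a \sum_b \sum_d T (a, b, d) * (A i a * B j b * C k d).
Proof.
rewrite mxE; under eq_bigr => b _ do rewrite mxE mulr_suml.
rewrite exchange_big /=.
under eq_bigr => a _ do under eq_bigr => b _ do
  rewrite slE mulr_sumr mulr_suml.
under eq_bigr => a _ do under eq_bigr => b _ do
  under eq_bigr => d _ do rewrite mxE mulr_suml mulr_sumr mulr_suml.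
under [RHS]eq_bigr => k _ do rewrite mulr_sumr.
rewrite [RHS]exchange_big /=; apply: eq_bigr => a _.
under [RHS]eq_bigr => k _ do rewrite mulr_sumr.
rewrite [RHS]exchange_big /=; apply: eq_bigr => b _.
under [RHS]eq_bigr => k _ do rewrite mulr_sumr.
rewrite [RHS]exchange_big /=; apply: eq_bigr => d _.
by apply: eq_bigr => k _; rewrite mxE; ring.
Qed.

Lemma sl_act g T c : sl (act g T) c = g.1.1 *m sl T (c *m g.2) *m g.1.2^T.
Proof.
apply/matrixP=> i j; rewrite sl_triple slE.
by apply: eq_bigr => k _; rewrite actE.
Qed.

(* Row k is the derivative at g = 1 of the slice k of act g T, so that the kernel
   of lie_op T is the Lie algebra of the stabilizer of T. *)
Definition lie_op T g : 'M[K]_(n, n * n) :=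
  \matrix_(k < n) mxvec (g.1.1 *m sl T (delta_mx 0 k) + sl T (delta_mx 0 k) *m g.1.2^T
      + sl T (delta_mx 0 k *m g.2)).

Lemma lie_op_linear T : linear (lie_op T).
Proof.
move=> a [[A1 B1] C1] [[A2 B2] C2]; apply/row_matrixP => k.
rewrite linearP /= !rowK -linearP /=; congr mxvec.
rewrite mulmxDl mulmxDr !linearD /= !linearZ /= -!scalemxAl.
by rewrite (addrACA (a *: _)) (addrACA (_ + a *: _)).
Qed.
HB.instance Definition _ T :=
  GRing.isLinear.Build K (triple K n) 'M[K]_(n, n * n) _ (lie_op T) (lie_op_linear T).

Definition lie T : {vspace triple K n} := lker (linfun (lie_op T)).

Lemma lieP T g : reflect
  (forall c, g.1.1 *m sl T c + sl T c *m g.1.2^T + sl T (c *m g.2) = 0) (g \in lie T).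
Proof.
rewrite memv_ker lfunE /=; apply: (iffP eqP) => [g0 c|H].
  have H k : g.1.1 *m sl T (delta_mx 0 k) + sl T (delta_mx 0 k) *m g.1.2^T
      + sl T (delta_mx 0 k *m g.2) = 0.
    by apply: (can_inj mxvecK); have := congr1 (row k) g0; rewrite rowK row0 linear0.
  rewrite [c]row_sum_delta mulmx_suml !linear_sum /= mulmx_suml -!big_split /=.
  rewrite big1 // => k _; rewrite -scalemxAl !linearZ /= -scalemxAl -!scalerDr H.
  by rewrite scaler0.
by apply/row_matrixP => k; rewrite rowK H linear0 row0.
Qed.

End Slices.

(** * From chains in the stabilizer to its Lie algebra *)

Section UpperBound.
Variables (K : numFieldType) (n : nat).
Implicit Types (T : tensor K n) (g : triple K n).

Definition posA (i j : 'I_n) : 'I_(n * n + n * n + n * n) :=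
  lshift _ (lshift _ (mxvec_index i j)).
Definition posB (i j : 'I_n) : 'I_(n * n + n * n + n * n) :=
  lshift _ (rshift _ (mxvec_index i j)).
Definition posC (i j : 'I_n) : 'I_(n * n + n * n + n * n) :=
  rshift _ (mxvec_index i j).

Lemma coordsA g i j : coords g 0 (posA i j) = g.1.1 i j.
Proof. by rewrite /coords !row_mxEl mxvecE. Qed.
Lemma coordsB g i j : coords g 0 (posB i j) = g.1.2 i j.
Proof. by rewrite /coords row_mxEl row_mxEr mxvecE. Qed.
Lemma coordsC g i j : coords g 0 (posC i j) = g.2 i j.
Proof. by rewrite /coords row_mxEr mxvecE. Qed.

Lemma pos_cases (P : 'I_(n * n + n * n + n * n) -> Prop) :
  (forall i j, P (posA i j)) -> (forall i j, P (posB i j)) -> (forall i j, P (posC i j)) ->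
  forall l, P l.
Proof.
move=> PA PB PC l; case: (split_ordP l) => [l1|l1] ->.
  by case: (split_ordP l1) => [l2|l2] ->; case/mxvec_indexP: l2.
by case/mxvec_indexP: l1.
Qed.

Lemma stab_dim_le T m F : irreducible_chain (@coords K n @` stabilizer T) m F ->
  (m <= \dim (lie T))%N.
Proof.
move=> /chain_tangent[y [[g [[gA gB gC] gT] gy]] [d [dE dfree]]].
set N := (n * n + n * n + n * n)%N in d dE dfree *.
pose dA (l : 'I_m) := \matrix_(i, j) d l 'X_(posA i j) : 'M[K]_n.
pose dB (l : 'I_m) := \matrix_(i, j) d l 'X_(posB i j) : 'M[K]_n.
pose dC (l : 'I_m) := \matrix_(i, j) d l 'X_(posC i j) : 'M[K]_n.
(* The entries of [act g T - T] as polynomials in the coordinates of g; applying the derivations to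
   them yields the tangent equations [tan]. *)
pose e (i j k : 'I_n) : {mpoly K[N]} :=
  \sum_a \sum_b \sum_c (T (a, b, c))%:MP * ('X_(posA i a) * 'X_(posB j b) * 'X_(posC k c))
   - (T (i, j, k))%:MP.
have e0 i j k : vanishing (@coords K n @` stabilizer T) (e i j k).
  move=> _ [h [_ hT] <-]; rewrite mevalB mevalC !raddf_sum /=.
  rewrite -[in X in _ - X]hT actE; apply/eqP; rewrite subr_eq0; apply/eqP.
  apply: eq_bigr => a _; rewrite raddf_sum /=; apply: eq_bigr => b _.
  rewrite raddf_sum /=; apply: eq_bigr => c _.
  by rewrite !mevalM mevalC !mevalXU /pt coordsA coordsB coordsC.
have dsum l I (r : seq I) (f : I -> {mpoly K[N]}) :
    d l (\sum_(i <- r) f i) = \sum_(i <- r) d l (f i).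
  have [dD _ dc _] := dE l.
  elim: r => [|i r IH]; first by rewrite !big_nil -mpolyC0 dc.
  by rewrite !big_cons dD IH.
have tan l c : dA l *m sl T (c *m g.2) *m g.1.2^T + g.1.1 *m sl T (c *m g.2) *m (dB l)^T
    + g.1.1 *m sl T (c *m dC l) *m g.1.2^T = 0.
  have [dD dM dc dX] := dE l.
  apply/matrixP=> i j; rewrite mxE [X in X + _]mxE !sl_triple mxE -!big_split big1 // => k _ /=.
  rewrite -!mulrDr -!big_split /=.
  have := dX _ (e0 i j k); rewrite /e -mpolyCN dD dc addr0 dsum => H.
  apply/eqP; rewrite mulf_eq0; apply/orP; right; apply/eqP; rewrite -[RHS]H.
  apply: eq_bigr => a _; rewrite dsum -!big_split; apply: eq_bigr => b _ /=.
  rewrite dsum -!big_split; apply: eq_bigr => p _ /=.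
  rewrite !dM dc !mevalM mevalC !mevalXU -gy /pt !coordsA !coordsB !coordsC !mxE; ring.
have slT c : sl T c = g.1.1 *m sl T (c *m g.2) *m g.1.2^T by rewrite -sl_act gT.
have gBT : g.1.2^T \in unitmx by rewrite unitmx_tr.
(* Multiplied on the right by the inverse of [g], a tangent vector at [g] satisfies the equations of
   [lie T], because [g] fixes [T]. *)
pose v (l : 'I_m) : triple K n :=
  (dA l *m invmx g.1.1, dB l *m invmx g.1.2, dC l *m invmx g.2).
have vlie l : v l \in lie T.
  apply/lieP => c /=; rewrite -[RHS](tan l c); congr (_ + _ + _).
  - by rewrite slT -!mulmxA mulKmx.
  - by rewrite {1}slT trmx_mul trmx_inv -!mulmxA mulKVmx.
  - by rewrite slT -!mulmxA mulVmx // mulmx1.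
pose s := [tuple v l | l < m].
have sfree : free s.
  apply/freeP => k; rewrite (eq_bigr (fun l => k l *: v l)) => [k0|l _]; last first.
    by rewrite -tnth_nth tnth_mktuple.
  have kA : \sum_l k l *: dA l = 0.
    have := congr1 (fun h : triple K n => h.1.1 *m g.1.1) k0.
    rewrite mul0mx (big_morph (fun h : triple K n => h.1.1) (id1 := 0) (op1 := +%R)) //.
    by rewrite mulmx_suml => H; rewrite -[RHS]H; apply: eq_bigr => l _ /=; rewrite -scalemxAl mulmxKV.
  have kB : \sum_l k l *: dB l = 0.
    have := congr1 (fun h : triple K n => h.1.2 *m g.1.2) k0.
    rewrite mul0mx (big_morph (fun h : triple K n => h.1.2) (id1 := 0) (op1 := +%R)) //.
    by rewrite mulmx_suml => H; rewrite -[RHS]H; apply: eq_bigr => l _ /=; rewrite -scalemxAl mulmxKV.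
  have kC : \sum_l k l *: dC l = 0.
    have := congr1 (fun h : triple K n => h.2 *m g.2) k0.
    rewrite mul0mx (big_morph (fun h : triple K n => h.2) (id1 := 0) (op1 := +%R)) //.
    by rewrite mulmx_suml => H; rewrite -[RHS]H; apply: eq_bigr => l _ /=; rewrite -scalemxAl mulmxKV.
  have : \row_l k l = 0.
    apply: (row_free_inj dfree); rewrite mul0mx; apply/rowP => p; rewrite !mxE.
    elim/pos_cases: p => i j; [have := congr1 (fun h : 'M_n => h i j) kA |
      have := congr1 (fun h : 'M_n => h i j) kB | have := congr1 (fun h : 'M_n => h i j) kC];
    by rewrite summxE mxE => H; rewrite -[RHS]H; apply: eq_bigr => l _; rewrite !mxE.
  by move=> /rowP k00 l; have := k00 l; rewrite !mxE.
rewrite -[m in (m <= _)%N](size_tuple s) -(eqP sfree); apply: dimvS.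
by apply/span_subvP => _ /mapP[l _ ->].
Qed.

End UpperBound.

Section LinearInjection.
Variables (K : fieldType) (V W : vectType K) (U : {vspace V}) (U' : {vspace W}).
Variable f : V -> W.
Hypotheses (f_lin : linear f) (f_mem : forall u, u \in U -> f u \in U').
Hypothesis f_inj : forall u, u \in U -> f u = 0 -> u = 0.

Let fL : {linear V -> W} := HB.pack f (GRing.isLinear.Build K V W _ f f_lin).

Let img_dim : \dim (linfun fL @: U) = \dim U.
Proof.
apply: limg_dim_eq; apply/eqP; rewrite -subv0; apply/subvP => u.
by rewrite memv_cap memv_ker lfunE memv0 => /andP[Uu /eqP/f_inj->].
Qed.

Let img_sub : (linfun fL @: U <= U')%VS.
Proof. by apply/subvP => _ /memv_imgP[u Uu ->]; rewrite lfunE; exact: f_mem. Qed.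

Lemma injection_dim : (\dim U <= \dim U')%N.
Proof. by rewrite -img_dim; exact: dimvS. Qed.

Lemma injection_surj : (\dim U' <= \dim U)%N -> forall w, w \in U' -> exists2 u, u \in U & f u = w.
Proof.
move=> le w Uw; have /eqP e : (linfun fL @: U)%VS == U'.
  by rewrite eqEdim img_sub img_dim.
by move: Uw; rewrite -e => /memv_imgP[u Uu ->]; exists u; rewrite ?lfunE.
Qed.

End LinearInjection.

(** * Isomorphism, exchange of factors and conciseness *)

Section Invariance.
Variables (K : fieldType) (n : nat).
Implicit Types (T : tensor K n) (g h : triple K n) (c : 'rV[K]_n).

Definition gmul g h : triple K n := (g.1.1 *m h.1.1, g.1.2 *m h.1.2, g.2 *m h.2).
Definition ginv g : triple K n := (invmx g.1.1, invmx g.1.2, invmx g.2).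

Lemma act_mul g h T : act g (act h T) = act (gmul g h) T.
Proof. by apply: eq_sl => c; rewrite !sl_act trmx_mul !mulmxA. Qed.

Lemma act1 T : act (1%:M, 1%:M, 1%:M) T = T.
Proof. by apply: eq_sl => c; rewrite sl_act trmx1 mul1mx !mulmx1. Qed.

Lemma GL3_1 : @GL3 K n (1%:M, 1%:M, 1%:M).
Proof. by split; rewrite unitmx1. Qed.

Lemma GL3_mul g h : GL3 g -> GL3 h -> GL3 (gmul g h).
Proof. by move=> [gA gB gC] [hA hB hC]; split; rewrite unitmx_mul ?gA ?gB ?gC. Qed.

Lemma GL3_inv g : GL3 g -> GL3 (ginv g).
Proof. by move=> [gA gB gC]; split; rewrite unitmx_inv. Qed.

Lemma act_inv g T : GL3 g -> act (ginv g) (act g T) = T.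
Proof. by move=> [gA gB gC]; rewrite act_mul /gmul /= !mulVmx // act1. Qed.

Lemma iso_sym T T' : tensor_iso T T' -> tensor_iso T' T.
Proof. by move=> [g Gg ->]; exists (ginv g); [exact: GL3_inv | rewrite act_inv]. Qed.

Lemma iso_trans T1 T2 T3 : tensor_iso T1 T2 -> tensor_iso T2 T3 -> tensor_iso T1 T3.
Proof.
by move=> [g Gg ->] [h Gh ->]; exists (gmul g h); [exact: GL3_mul | rewrite act_mul].
Qed.

Lemma iso_act g T : GL3 g -> tensor_iso (act g T) T.
Proof. by exists g. Qed.

(** Entrywise, the equation treats the three factors alike, so that exchanging factors merely
    permutes its terms. *)
Lemma lieE T g : g \in lie T <-> forall i j k,
  \sum_a g.1.1 i a * T (a, j, k) + \sum_b g.1.2 j b * T (i, b, k) + \sum_c g.2 k c * T (i, j, c) = 0.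
Proof.
split=> [/lieP H i j k|H].
  have := congr1 (fun M : 'M_n => M i j) (H (delta_mx 0 k)); rewrite !mxE => E; rewrite -[RHS]E.
  congr (_ + _ + _).
  - by apply: eq_bigr => a _; rewrite tensor_sl.
  - by apply: eq_bigr => b _; rewrite mxE mulrC tensor_sl.
  - rewrite slE; apply: eq_bigr => l _; rewrite -rowE mxE //.
apply/lieP => c; apply/matrixP => i j; rewrite [RHS]mxE.
transitivity (\sum_k c 0 k * (\sum_a g.1.1 i a * T (a, j, k) + \sum_b g.1.2 j b * T (i, b, k)
    + \sum_l g.2 k l * T (i, j, l))); last by apply: big1 => k _; rewrite H mulr0.
under [RHS]eq_bigr => k _ do rewrite !mulrDr.
rewrite !big_split /= !mxE; congr (_ + _ + _).
- under [RHS]eq_bigr => k _ do rewrite mulr_sumr.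
  rewrite exchange_big; apply: eq_bigr => a _; rewrite slE mulr_sumr.
  by apply: eq_bigr => k _ /=; ring.
- under [RHS]eq_bigr => k _ do rewrite mulr_sumr.
  rewrite exchange_big; apply: eq_bigr => a _; rewrite slE mulr_suml.
  by apply: eq_bigr => k _ /=; rewrite !mxE; ring.
- under [RHS]eq_bigr => k _ do rewrite mulr_sumr.
  rewrite exchange_big slE; apply: eq_bigr => a _; rewrite mxE mulr_suml.
  by apply: eq_bigr => k _ /=; ring.
Qed.

Lemma dim_lie_act g T : GL3 g -> \dim (lie (act g T)) = \dim (lie T).
Proof.
have le h S : GL3 h -> (\dim (lie S) <= \dim (lie (act h S)))%N.
  move=> [hA hB hC].
  have hB' : h.1.2^T \in unitmx by rewrite unitmx_tr.
  apply: (@injection_dim _ _ _ _ _ (fun u : triple K n => (h.1.1 *m u.1.1 *m invmx h.1.1,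
     h.1.2 *m u.1.2 *m invmx h.1.2, h.2 *m u.2 *m invmx h.2) : triple K n)).
  - move=> a u v /=; rewrite !mulmxDr !mulmxDl -!scalemxAr -!scalemxAl.
    by congr (_, _, _).
  - move=> u /lieP Hu; apply/lieP => c; rewrite !sl_act /=.
    have := congr1 (fun M => h.1.1 *m M *m h.1.2^T) (Hu (c *m h.2)).
    rewrite mulmx0 mul0mx !mulmxDr !mulmxDl => H; rewrite -[RHS]H; congr (_ + _ + _).
    + by rewrite !mulmxA mulmxKV.
    + by rewrite !trmx_mul trmx_inv !mulmxA mulmxK.
    + by rewrite !mulmxA mulmxKV.
  - move=> [[X Y] Z] _ /= [eX eY eZ].
    have conj0 (P M : 'M[K]_n) : P \in unitmx -> P *m M *m invmx P = 0 -> M = 0.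
      by move=> uP /(congr1 (mulmx^~ P)); rewrite mulmxKV // mul0mx => /(congr1 (mulmx (invmx P)));
         rewrite mulKmx // mulmx0.
    have X0 : X = 0 := conj0 _ _ hA eX.
    have Y0 : Y = 0 := conj0 _ _ hB eY.
    have Z0 : Z = 0 := conj0 _ _ hC eZ.
    by rewrite X0 Y0 Z0.
move=> Gg; apply/eqP; rewrite eqn_leq le // andbT.
by rewrite -[in X in (_ <= X)%N](act_inv T Gg); apply: le; exact: GL3_inv.
Qed.

Lemma dim_lie_iso T T' : tensor_iso T T' -> \dim (lie T) = \dim (lie T').
Proof. by move=> [g Gg ->]; exact: dim_lie_act. Qed.

Definition swap12 T : tensor K n := [ffun x => T (x.1.2, x.1.1, x.2)].
Definition swap23 T : tensor K n := [ffun x => T (x.1.1, x.2, x.1.2)].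

Lemma swap12K T : swap12 (swap12 T) = T.
Proof. by apply/ffunP => -[[i j] k]; rewrite !ffunE. Qed.
Lemma swap23K T : swap23 (swap23 T) = T.
Proof. by apply/ffunP => -[[i j] k]; rewrite !ffunE. Qed.

Lemma sl_swap12 T c : sl (swap12 T) c = (sl T c)^T.
Proof. by apply/matrixP => i j; rewrite mxE !slE; apply: eq_bigr => k _; rewrite ffunE. Qed.

Lemma sl_swap23 T c k : col k (sl (swap23 T) c) = sl T (delta_mx 0 k) *m c^T.
Proof.
apply/colP => i; rewrite !mxE slE; apply: eq_bigr => j _.
by rewrite !mxE ffunE tensor_sl mulrC.
Qed.

Lemma act_swap12 g T : act (g.1.2, g.1.1, g.2) (swap12 T) = swap12 (act g T).
Proof. by apply: eq_sl => c; rewrite sl_act !sl_swap12 sl_act !trmx_mul trmxK mulmxA. Qed.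

Lemma act_swap23 g T : act (g.1.1, g.2, g.1.2) (swap23 T) = swap23 (act g T).
Proof.
apply/ffunP => -[[i j] k]; rewrite [RHS]ffunE !actE; apply: eq_bigr => a _.
rewrite exchange_big; apply: eq_bigr => b _; apply: eq_bigr => c _ /=; rewrite ffunE /=; ring.
Qed.

Lemma dim_lie_swap12 T : \dim (lie (swap12 T)) = \dim (lie T).
Proof.
have le S : (\dim (lie S) <= \dim (lie (swap12 S)))%N.
  apply: (@injection_dim _ _ _ _ _ (fun u : triple K n => (u.1.2, u.1.1, u.2) : triple K n)) => //.
    move=> u /lieE Hu; apply/lieE => i j k; rewrite -[RHS](Hu j i k) /= [X in X + _ = _]addrC.
    by congr (_ + _ + _); apply: eq_bigr => a _; rewrite ffunE.
  by move=> [[X Y] Z] _ /= [-> -> ->].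
by apply/eqP; rewrite eqn_leq le andbT -[in X in (_ <= X)%N](swap12K T) le.
Qed.

Lemma dim_lie_swap23 T : \dim (lie (swap23 T)) = \dim (lie T).
Proof.
have le S : (\dim (lie S) <= \dim (lie (swap23 S)))%N.
  apply: (@injection_dim _ _ _ _ _ (fun u : triple K n => (u.1.1, u.2, u.1.2) : triple K n)) => //.
    move=> u /lieE Hu; apply/lieE => i j k; rewrite -[RHS](Hu i k j) /= -addrA [X in _ + X = _]addrC addrA.
    by congr (_ + _ + _); apply: eq_bigr => a _; rewrite ffunE.
  by move=> [[X Y] Z] _ /= [-> -> ->].
by apply/eqP; rewrite eqn_leq le andbT -[in X in (_ <= X)%N](swap23K T) le.
Qed.

Lemma iso_swap12 T T' : tensor_iso T T' -> tensor_iso (swap12 T) (swap12 T').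
Proof.
by move=> [g [gA gB gC] ->]; exists (g.1.2, g.1.1, g.2); [split | rewrite act_swap12].
Qed.

Lemma iso_swap23 T T' : tensor_iso T T' -> tensor_iso (swap23 T) (swap23 T').
Proof.
by move=> [g [gA gB gC] ->]; exists (g.1.1, g.2, g.1.2); [split | rewrite act_swap23].
Qed.

(** [inj1], [inj2] and [inj3] are the three rank conditions of conciseness, read as the absence of a
    nonzero vector whose contraction with [T] in the given factor is zero. *)
Definition inj1 T := forall u : 'rV[K]_n, (forall c, u *m sl T c = 0) -> u = 0.
Definition inj2 T := forall v : 'cV[K]_n, (forall c, sl T c *m v = 0) -> v = 0.
Definition inj3 T := forall c, sl T c = 0 -> c = 0.

Lemma inj1_act g T : GL3 g -> inj1 T -> inj1 (act g T).
Proof.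
move=> [gA gB gC] iT u Hu; rewrite -[u](mulmxK gA) (iT (u *m g.1.1)) ?mul0mx // => c.
have gB' : g.1.2^T \in unitmx by rewrite unitmx_tr.
have := Hu (c *m invmx g.2); rewrite sl_act mulmxKV // !mulmxA => /(congr1 (mulmx^~ (invmx g.1.2^T))).
by rewrite mulmxK // mul0mx.
Qed.

Lemma inj1_swap12 T : inj2 T -> inj1 (swap12 T).
Proof.
move=> iT u Hu; apply: trmx_inj; rewrite trmx0; apply: iT => c.
by apply: trmx_inj; rewrite trmx_mul trmxK -sl_swap12 Hu trmx0.
Qed.

Lemma inj2_swap12 T : inj1 T -> inj2 (swap12 T).
Proof.
move=> iT u Hu; apply: trmx_inj; rewrite trmx0; apply: iT => c.
by apply: trmx_inj; rewrite trmx_mul trmxK -sl_swap12 Hu trmx0.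
Qed.

Lemma inj3_swap12 T : inj3 T -> inj3 (swap12 T).
Proof. by move=> iT c; rewrite sl_swap12 => /(congr1 trmx); rewrite trmxK trmx0 => /iT. Qed.

Lemma inj2_act g T : GL3 g -> inj2 T -> inj2 (act g T).
Proof.
move=> [gA gB gC] /inj1_swap12 iT; rewrite -[act g T]swap12K -act_swap12.
by apply: inj2_swap12; apply: inj1_act.
Qed.

Lemma inj3_act g T : GL3 g -> inj3 T -> inj3 (act g T).
Proof.
move=> [gA gB gC] iT c; rewrite sl_act.
have gB' : g.1.2^T \in unitmx by rewrite unitmx_tr.
move=> /(congr1 (mulmx^~ (invmx g.1.2^T))); rewrite mulmxK // mul0mx.
move=> /(congr1 (mulmx (invmx g.1.1))); rewrite mulKmx // mulmx0 => /iT.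
by move=> /(congr1 (mulmx^~ (invmx g.2))); rewrite mulmxK // mul0mx.
Qed.

Lemma inj3_swap23 T : inj2 T -> inj3 (swap23 T).
Proof.
move=> iT c Hc; apply: trmx_inj; rewrite trmx0; apply: iT => d.
rewrite [d]row_sum_delta linear_sum /= mulmx_suml big1 // => k _.
by rewrite linearZ /= -scalemxAl -sl_swap23 Hc col0 scaler0.
Qed.

(** It is enough to carry slices to slices as a set: linearity gives a coordinate change [C] on the
    third factor, and [inj3 T] makes it invertible. *)
Lemma iso_slices (T S : tensor K n) (P Q : 'M[K]_n) : P \in unitmx -> Q \in unitmx ->
  inj3 T -> (forall c, exists c', sl T c = P *m sl S c' *m Q) -> tensor_iso T S.
Proof.
move=> uP uQ iT H.
have [h hE] := choice (fun k : 'I_n => H (delta_mx 0 k)).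
pose C := \matrix_k h k.
have E c : sl T c = P *m sl S (c *m C) *m Q.
  rewrite {1}[c]row_sum_delta linear_sum /= mulmx_sum_row linear_sum /= mulmx_sumr mulmx_suml.
  by apply: eq_bigr => k _; rewrite !linearZ /= -scalemxAl hE rowK.
exists (P, Q^T, C); last by apply: eq_sl => c; rewrite sl_act /= trmxK -E.
split; rewrite /= ?unitmx_tr // -row_free_unit; apply: inj_row_free => c cC; apply: iT.
by rewrite E cC linear0 mulmx0 mul0mx.
Qed.

End Invariance.

(** * Tensors with an invertible slice *)

Section RankOne.
Variable K : fieldType.

Lemma row_free2P n (u w : 'rV[K]_n) : u != 0 ->
  ~ (exists a, w = a *: u) -> row_free (col_mx u w).
Proof.
move=> u0 nw; apply: inj_row_free => v; rewrite -[v]hsubmxK mul_row_col.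
rewrite [lsubmx v]mx11_scalar [rsubmx v]mx11_scalar !mul_scalar_mx.
move: (lsubmx v 0 0) (rsubmx v 0 0) => a b e.
have b0 : b = 0.
  apply/eqP; apply: contrapT => /negP b0; apply: nw; exists (- (b^-1 * a)).
  have := congr1 (GRing.scale b^-1) e; rewrite scaler0 scalerDr !scalerA mulVf // scale1r.
  by rewrite addrC => /eqP; rewrite addr_eq0 scaleNr => /eqP.
move: e; rewrite b0 scale0r addr0 => /eqP; rewrite scaler_eq0 (negbTE u0) orbF => /eqP->.
by rewrite !raddf0 row_mx0.
Qed.

Lemma outer2 p q (x1 x2 : 'cV[K]_p) (y1 y2 : 'rV[K]_q) : x1 != 0 -> y1 != 0 ->
  (\rank (x1 *m y1 + x2 *m y2)%R <= 1)%N ->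
  (exists a, x2 = a *: x1) \/ (exists a, y2 = a *: y1).
Proof.
move=> x10 y10 rk; apply: contrapT => /not_orP[nx ny].
have fy := row_free2P y10 ny.
have fx : row_free (row_mx x1 x2)^T.
  rewrite tr_row_mx; apply: row_free2P; first by rewrite trmx_eq0.
  by move=> [a e]; apply: nx; exists a; apply: trmx_inj; rewrite e linearZ.
move: rk; rewrite -mul_row_col mxrankMfree // -mxrank_tr.
by rewrite (eqP fx).
Qed.

Lemma rank1_outer p q (A : 'M[K]_(p, q)) : (\rank A <= 1)%N ->
  exists x : 'cV[K]_p, exists y : 'rV[K]_q, A = x *m y.
Proof.
case: (posnP (\rank A)) => [/eqP|r0 r1].
  by rewrite mxrank_eq0 => /eqP-> _; exists 0, 0; rewrite mul0mx.
have r : \rank A = 1%N by apply/eqP; rewrite eqn_leq r1 r0.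
move: (col_base A) (row_base A) (mulmx_base A); rewrite r => x y <-.
by exists x, y.
Qed.

(** Otherwise take [F c1] = x1 y1, a value [F c2] without the column x1 and a value [F c3] without
    the row y1. Adding [F c1] to each forces y2 parallel to y1 and x3 parallel to x1, and then
    [F c2 + F c3] has rank two. *)
Lemma rank1_space m p q (F : {linear 'rV[K]_m -> 'M[K]_(p, q)}) :
  (forall c, (\rank (F c) <= 1)%N) ->
  (exists x : 'cV[K]_p, forall c, exists w, F c = x *m w) \/
  (exists y : 'rV[K]_q, forall c, exists w, F c = w *m y).
Proof.
move=> rk.
have [F0|/existsNP[c1 F1]] := pselect (forall c, F c = 0).
  by left; exists 0 => c; exists 0; rewrite F0 mul0mx.
have [x1 [y1 E1]] := rank1_outer (rk c1).
have x10 : x1 != 0 by apply/eqP=> x0; apply: F1; rewrite E1 x0 mul0mx.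
have y10 : y1 != 0 by apply/eqP=> y0; apply: F1; rewrite E1 y0 mulmx0.
apply: contrapT => /not_orP[nx ny].
have [c2 F2] : exists c2, ~ exists w, F c2 = x1 *m w.
  by apply/existsNP => h; apply: nx; exists x1.
have [c3 F3] : exists c3, ~ exists w, F c3 = w *m y1.
  by apply/existsNP => h; apply: ny; exists y1.
have [x2 [y2 E2]] := rank1_outer (rk c2).
have [x3 [y3 E3]] := rank1_outer (rk c3).
have nx2 : ~ exists a, x2 = a *: x1.
  by move=> [a e]; apply: F2; exists (a *: y2); rewrite E2 e -scalemxAl scalemxAr.
have ny3 : ~ exists a, y3 = a *: y1.
  by move=> [a e]; apply: F3; exists (a *: x3); rewrite E3 e -scalemxAr scalemxAl.
have [||[b y2E]] := outer2 (x2 := x2) (y2 := y2) x10 y10 _.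
- by rewrite -E1 -E2 -linearD.
- by move/nx2.
have [|[b' x3E]|] := outer2 (x2 := x3) (y2 := y3) x10 y10 _; last by move/ny3.
  by rewrite -E1 -E3 -linearD.
have b0 : b != 0 by apply/eqP=> b0; apply: F2; exists 0; rewrite E2 y2E b0 scale0r !mulmx0.
have b'0 : b' != 0 by apply/eqP=> b0'; apply: F3; exists 0; rewrite E3 x3E b0' scale0r !mul0mx.
have y30 : b' *: y3 != 0.
  rewrite scaler_eq0 negb_or b'0; apply/eqP=> y30; apply: ny3; exists 0.
  by rewrite y30 scale0r.
have [|[a e]|[a e]] := outer2 (x2 := x2) (y2 := b *: y1) x10 y30 _.
- have := rk (c3 + c2); rewrite linearD E2 E3 x3E y2E.
  by rewrite -scalemxAl scalemxAr.
- by apply: nx2; exists a.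
- have a0 : a != 0.
    apply/eqP => a0; move/eqP: e; rewrite a0 scale0r scaler_eq0 (negbTE b0) /=.
    by rewrite (negbTE y10).
  apply: ny3; exists ((a * b')^-1 * b); rewrite -scalerA e [a *: _]scalerA scalerA mulVf ?scale1r //.
  by rewrite mulf_neq0.
Qed.

Lemma nonscalar_row n (M : 'M[K]_n) : ~ (exists a, M = a%:M) ->
  exists u : 'rV[K]_n, u != 0 /\ ~ exists a, u *m M = a *: u.
Proof.
move=> nM; apply: contrapT => H; apply: nM.
have {}H (u : 'rV[K]_n) : exists a, u *m M = a *: u.
  have [->|u0] := eqVneq u 0; first by exists 0; rewrite mul0mx scaler0.
  by apply: contrapT => nu; apply: H; exists u.
have [mu muE] := choice (fun i : 'I_n => H (delta_mx 0 i)).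
(* The eigenvalue at the all-ones row has to agree with the eigenvalue at each basis row. *)
have [a aE] := H (\sum_i delta_mx 0 i); exists a.
have muA i : mu i = a.
  have := congr1 (fun v : 'rV_n => v 0 i) aE; rewrite mulmx_suml.
  under eq_bigr => j _ do rewrite muE.
  rewrite !mxE !summxE (bigD1 i) //= big1 => [|j nji]; last first.
    by rewrite !mxE eqxx eq_sym (negbTE nji) mulr0.
  rewrite addr0 !mxE !eqxx mulr1 => ->.
  rewrite (bigD1 i) //= big1 => [|j nji]; last by rewrite !mxE eqxx eq_sym (negbTE nji).
  by rewrite !mxE !eqxx addr0 mulr1.
by apply/row_matrixP => i; rewrite rowE muE muA rowE mul_mx_scalar.
Qed.

End RankOne.

Lemma compl_zero (K : fieldType) m n p (A : 'M[K]_(m, n)) (Y : 'M[K]_(n, p)) :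
  A *m Y = 0 -> row_base (A^C)%MS *m Y = 0 -> Y = 0.
Proof.
move=> /sub_kermxP AY /sub_kermxP; rewrite eq_row_base => CY.
have : (1%:M <= kermx Y)%MS.
  apply: submx_trans (_ : (A + A^C)%MS <= _)%MS; first exact/submx_full/addsmx_compl_full.
  by rewrite addsmx_sub AY.
by move/sub_kermxP; rewrite mul1mx.
Qed.

Lemma trace_commutator (K : fieldType) n (X M : 'M[K]_n) : \tr (X *m M - M *m X) = 0.
Proof. by rewrite linearB /= mxtrace_mulC subrr. Qed.

(** * The Lie algebra when one slice is the identity *)

Section InvertibleSlice.
Variables (K : numClosedFieldType) (n : nat) (T : tensor K n) (c0 : 'rV[K]_n).
Hypotheses (T3 : inj3 T) (T0 : sl T c0 = 1%:M).

Lemma lie_unit (g : triple K n) : g \in lie T -> c0 *m g.2 = 0 ->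
  g.1.2^T = - g.1.1 /\ forall c, g.1.1 *m sl T c - sl T c *m g.1.1 = - sl T (c *m g.2).
Proof.
move=> /lieP Hg Z0.
have Y : g.1.2^T = - g.1.1.
  have := Hg c0; rewrite Z0 linear0 addr0 T0 mulmx1 mul1mx => /eqP.
  by rewrite addrC addr_eq0 => /eqP.
by split=> // c; have := Hg c; rewrite Y mulmxN => /eqP; rewrite addr_eq0 => /eqP.
Qed.

Lemma lie_unit_eq0 (g : triple K n) : g \in lie T -> c0 *m g.2 = 0 -> g.1.1 = 0 -> g = 0.
Proof.
case: g => [[X Y] Z] /= gl Z0 X0; have [/= Y0 Zc] := lie_unit gl Z0; rewrite X0 oppr0 in Y0.
have -> : X = 0 by [].
have -> : Y = 0 by apply: trmx_inj; rewrite Y0 trmx0.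
suff -> : Z = 0 by [].
apply/row_matrixP => i; rewrite row0 rowE; apply: T3; apply/eqP; rewrite -oppr_eq0 -Zc.
by rewrite /= X0 mul0mx mulmx0 subrr.
Qed.

Section Nonscalar.
Variables (c1 : 'rV[K]_n) (u : 'rV[K]_n) (v : 'cV[K]_n).
Let M := sl T c1.
Hypothesis u_free : row_free (col_mx u (u *m M)).
Hypothesis v_free : row_free (col_mx v^T (v^T *m M^T)).

Let L := row_base ((col_mx u (u *m M))^C)%MS.
Let R := (row_base ((col_mx v^T (v^T *m M^T))^C)%MS)^T.
Let J := col_base (cokermx c0).

Let n_ge2 : (2 <= n)%N.
Proof. by have := rank_leq_col (col_mx u (u *m M)); rewrite (eqP u_free). Qed.

(* The target has dimension n + (n - 1) + n + (n - 1)(n - 2) = n^2 + 1. *)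
Let f (g : triple K n) := (c0 *m g.2, c1 *m g.2 *m J, g.1.1 *m v, col_mx u L *m g.1.1 *m R).

Let f_lin : linear f.
Proof.
by move=> a g h; rewrite /f /= !mulmxDr !mulmxDl -!scalemxAr -!scalemxAl.
Qed.

Let trT0 : \tr (sl T c0) = n%:R. Proof. by rewrite T0 mxtrace1. Qed.

Let J_eq0 c : c *m J = 0 -> exists a, c = a *: c0.
Proof.
move=> cJ; have : (c <= c0)%MS.
  by rewrite submxE -(mulmx_base (cokermx c0)) mulmxA cJ mul0mx.
by move/sub_rVP.
Qed.

(** Right multiplication by [J] is reduction modulo the line of [c0]. The multiple of [c0] that it
    forgets is recovered from the trace, since [sl T c0] has trace n; applied to commutators, this
    replaces n coordinates by n - 1. *)
Let trace_J c : \tr (sl T c) = 0 -> c *m J = 0 -> c = 0.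
Proof.
move=> trc /J_eq0[a ca]; move: trc; rewrite ca linearZ /= mxtraceZ trT0 => /eqP.
rewrite mulf_eq0 pnatr_eq0 => /orP[/eqP->|]; first by rewrite scale0r.
by lia.
Qed.

Let right0 p (Y : 'M[K]_(p, n)) : Y *m v = 0 -> Y *m M *m v = 0 -> Y *m R = 0 -> Y = 0.
Proof.
move=> Yv YMv YR; apply: trmx_inj; rewrite trmx0.
apply: (@compl_zero _ _ _ _ (col_mx v^T (v^T *m M^T))).
  by rewrite mul_col_mx -!trmx_mul mulmxA Yv YMv !trmx0 col_mx0.
by apply: trmx_inj; rewrite trmx_mul trmxK YR trmx0.
Qed.

(** Commutation doubles the conditions: X v = 0 gives X M v = 0, so that on the right only [R]
    remains to be tested, and u X = 0 gives u M X = 0, so that [u] and [L] suffice on the left.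
    Hence the n - 1 rows and n - 2 columns in the last component of [f]. *)
Let commuting_zero (X : 'M[K]_n) : X *m M = M *m X -> X *m v = 0 -> u *m X *m R = 0 ->
  L *m X *m R = 0 -> X = 0.
Proof.
move=> XM Xv uXR LXR.
have uX : u *m X = 0.
  apply: right0 => //; first by rewrite -mulmxA Xv mulmx0.
  by rewrite -(mulmxA u) XM -!mulmxA Xv !mulmx0.
apply: (@compl_zero _ _ _ _ (col_mx u (u *m M))).
  by rewrite mul_col_mx uX -mulmxA -XM mulmxA uX mul0mx col_mx0.
apply: right0 => //; first by rewrite -mulmxA Xv mulmx0.
by rewrite -(mulmxA L) XM -!mulmxA Xv !mulmx0.
Qed.

Let f_inj g : g \in lie T -> f g = 0 -> g = 0.
Proof.
move=> gl [Z0 ZJ Xv]; rewrite mul_col_mx mul_col_mx => /eqP; rewrite col_mx_eq0.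
move=> /andP[/eqP uXR /eqP LXR].
have [_ Zc] := lie_unit gl Z0.
have Z1 : c1 *m g.2 = 0.
  apply: trace_J => //; apply/eqP; rewrite -oppr_eq0 -linearN /= -Zc.
  by rewrite trace_commutator.
apply: lie_unit_eq0 => //; apply: commuting_zero => //.
by apply/eqP; rewrite -subr_eq0 Zc Z1 linear0 oppr0.
Qed.

Let W : vectType K := ('rV[K]_n * 'rV[K]_(\rank (cokermx c0)) * 'cV[K]_n *
   'M[K]_(1 + \rank ((col_mx u (u *m M))^C)%MS, \rank ((col_mx v^T (v^T *m M^T))^C)%MS))%type.

Let dim_target : \dim (@fullv K W) = (n ^ 2 + 1)%N.
Proof.
rewrite dimvf.
have -> : vector.dim W = (vector.dim 'rV[K]_n + vector.dim 'rV[K]_(\rank (cokermx c0)) +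
   vector.dim 'cV[K]_n + vector.dim 'M[K]_(1 + \rank ((col_mx u (u *m M))^C)%MS,
  \rank ((col_mx v^T (v^T *m M^T))^C)%MS))%N by [].
rewrite !dim_matrix !mxrank_compl (eqP u_free) (eqP v_free) mxrank_coker.
have -> : \rank c0 = 1%N.
  rewrite rank_rV; case: eqP => // c00.
  have := trT0; rewrite c00 linear0 mxtrace0 => /eqP; rewrite eq_sym pnatr_eq0; lia.
rewrite !natrME; nia.
Qed.

Lemma nonscalar_dim : (\dim (lie T) <= n ^ 2 + 1)%N.
Proof. by rewrite -dim_target; apply: (@injection_dim _ _ W _ fullv f f_lin) => // ? _; exact: memvf. Qed.

Hypothesis dimT : \dim (lie T) = (n ^ 2 + 1)%N.

Let f_surj w : exists2 g, g \in lie T & f g = w.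
Proof.
apply: (@injection_surj _ _ W (lie T) fullv f f_lin) => //.
- by move=> *; exact: memvf.
- by rewrite dimT dim_target.
- exact: memvf.
Qed.

(** Surjectivity of [f] provides an X that commutes with [M] and has the values of [a *m h] on all
    test vectors. These values determine it, so X is [a *m h], and this outer product commutes with
    [M]. *)
Lemma max_dim_centralizer (a : 'cV[K]_n) (h : 'rV[K]_n) : u *m a = 0 -> u *m M *m a = 0 ->
  h *m v = 0 -> h *m M *m v = 0 -> (M *m a) *m h = a *m (h *m M).
Proof.
move=> ua uMa hv hMv.
have [g gl [Z0 ZJ Xv]] := f_surj (0, 0, 0, col_mx 0 (L *m a *m h *m R)).
rewrite !mul_col_mx => /eq_col_mx[uXR LXR].
have [_ Zc] := lie_unit gl Z0.
have Z1 : c1 *m g.2 = 0.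
  apply: trace_J => //; apply/eqP; rewrite -oppr_eq0 -linearN /= -Zc.
  by rewrite trace_commutator.
have XM : g.1.1 *m M = M *m g.1.1.
  by apply/eqP; rewrite -subr_eq0 Zc Z1 linear0 oppr0.
have uX : u *m g.1.1 = 0.
  apply: right0 => //; first by rewrite -mulmxA Xv mulmx0.
  by rewrite -(mulmxA u) XM -!mulmxA Xv !mulmx0.
suff e : a *m h = g.1.1 by rewrite -[LHS]mulmxA [RHS]mulmxA !e XM.
apply/eqP; rewrite -subr_eq0; apply/eqP.
apply: (@compl_zero _ _ _ _ (col_mx u (u *m M))).
  have uMX : u *m M *m g.1.1 = 0 by rewrite -mulmxA -XM mulmxA uX mul0mx.
  by rewrite mul_col_mx !mulmxBr uX uMX !mulmxA ua uMa !mul0mx !subrr col_mx0.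
apply: right0.
- have -> : L *m (a *m h - g.1.1) *m v = L *m (a *m (h *m v)) - L *m (g.1.1 *m v).
    by rewrite mulmxBr mulmxBl !mulmxA.
  by rewrite hv Xv !mulmx0 subrr.
- have -> : L *m (a *m h - g.1.1) *m M *m v = L *m (a *m (h *m M *m v)) - L *m (M *m (g.1.1 *m v)).
    by rewrite mulmxBr !mulmxBl !mulmxA -(mulmxA L g.1.1 M) XM mulmxA.
  by rewrite hMv Xv !mulmx0 subrr.
- by rewrite mulmxBr mulmxBl LXR !mulmxA subrr.
Qed.

(** Surjectivity in the second component: [c1 *m g.2] can be made equal to [- w], and the action by
    commutators turns this into a formula for [sl T w]. *)
Lemma max_dim_commutator w : \tr (sl T w) = 0 -> exists X, X *m M - M *m X = sl T w.
Proof.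
move=> trw; have [g gl [Z0 ZJ _ _]] := f_surj (0, - (w *m J), 0, 0).
have [_ Zc] := lie_unit gl Z0; exists g.1.1; rewrite Zc.
have Z1 : c1 *m g.2 + w = 0.
  apply: trace_J; last by rewrite mulmxDl ZJ addNr.
  rewrite linearD linearD /= trw addr0; apply/eqP; rewrite -oppr_eq0 -linearN /= -Zc.
  by rewrite trace_commutator.
by move/eqP: Z1; rewrite addrC addr_eq0 => /eqP->; rewrite linearN.
Qed.

End Nonscalar.
End InvertibleSlice.

Lemma col_mul (K : pzRingType) m p q (A : 'M[K]_(m, p)) (B : 'M[K]_(p, q)) j :
  col j (A *m B) = A *m col j B.
Proof. by rewrite !colE mulmxA. Qed.

Lemma outerE (K : pzRingType) p q (x : 'cV[K]_p) (y : 'rV[K]_q) i j :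
  (x *m y) i j = x i 0 * y 0 j.
Proof. by rewrite mxE big_ord1. Qed.

(** * Matrices commuting with many outer products *)

Section ScalarPlusRankOne.
Variables (K : closedFieldType) (n : nat) (M : 'M[K]_n).

Let noneigen (u : 'rV[K]_n) := ~ exists a, u *m M = a *: u.

Hypothesis eigen : forall (u : 'rV[K]_n) (v : 'cV[K]_n), noneigen u ->
  ~ (exists a, M *m v = a *: v) ->
  forall (a : 'cV[K]_n) (h : 'rV[K]_n), u *m a = 0 -> u *m M *m a = 0 ->
  h *m v = 0 -> h *m M *m v = 0 -> (M *m a) *m h = a *m (h *m M).

Lemma scalar_plus_rank1 : ~ (exists a, M = a%:M) ->
  exists l, (\rank (M - l%:M)%R <= 1)%N.
Proof.
move=> nM.
have [u0 [u00 nu0]] := nonscalar_row nM.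
have [v0 [v00 nv0]] : exists v : 'cV[K]_n, v != 0 /\ ~ exists a, M *m v = a *: v.
  have [|v [v0 nv]] := @nonscalar_row _ _ M^T.
    by move=> [a e]; apply: nM; exists a; apply: trmx_inj; rewrite e tr_scalar_mx.
  exists v^T; rewrite trmx_eq0; split=> // -[a e]; apply: nv; exists a.
  by apply: trmx_inj; rewrite trmx_mul trmxK e linearZ.
(* In size at most two any eigenvalue will do, since M - l is singular. In larger size a nonzero [h]
   orthogonal to [v0] and [M *m v0] exists, and it is an eigenvector whose eigenvalue is the l
   sought. *)
have [n_le2|n_gt2] := leqP n 2.
  have [l rl] : exists l, root (char_poly M) l.
    apply: closed_rootP; rewrite size_char_poly; apply/eqP => n0.
    by case: n0 => n0; move/eqP: u00; apply; apply/rowP=> -[i lti]; exfalso; rewrite n0 in lti.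
  exists l; have := rank_leq_row (M - l%:M).
  move: rl; rewrite -eigenvalue_root_char => /eigenvalueP[w wl w0].
  have : ~~ row_free (M - l%:M).
    apply/negP => fr; move/eqP: w0; apply; apply: (row_free_inj fr).
    by rewrite mul0mx mulmxBr wl mul_mx_scalar subrr.
  by rewrite /row_free => nf rk; rewrite -ltnS; apply: leq_trans n_le2; rewrite ltn_neqAle nf rk.
have ex_ann m (A : 'M[K]_(m, n)) : (\rank A < n)%N -> exists2 a : 'cV[K]_n, a != 0 & A *m a = 0.
  move=> rA; have : (cokermx A) != 0 by rewrite -mxrank_eq0 mxrank_coker -lt0n subn_gt0.
  move=> /eqP c0; have [j cj] : exists j, col j (cokermx A) != 0.
    apply: contrapT => nj; apply: c0; apply: trmx_inj; apply/row_matrixP => j.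
    rewrite -tr_col trmx0 row0; apply: trmx_inj; rewrite trmxK trmx0.
    by apply/eqP; apply: contrapT => /negP cj; apply: nj; exists j.
  by exists (col j (cokermx A)) => //; rewrite -col_mul mulmx_coker col0.
have rank_lt m (A : 'M[K]_(m, n)) : (m <= 2)%N -> (\rank A < n)%N.
  by move=> m2; apply: leq_ltn_trans (rank_leq_row A) _; apply: leq_ltn_trans n_gt2.
have [h h0 [hv hMv]] : exists2 h : 'rV[K]_n, h != 0 & h *m v0 = 0 /\ h *m M *m v0 = 0.
  have [a a0 aE] := ex_ann _ (col_mx v0^T (v0^T *m M^T)) (@rank_lt (1 + 1)%N _ isT).
  exists a^T; first by rewrite trmx_eq0.
  move/eqP: aE; rewrite mul_col_mx col_mx_eq0 => /andP[/eqP e1 /eqP e2].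
  by split; apply: trmx_inj; rewrite !trmx_mul ?trmxK trmx0 // mulmxA.
have proportional (a : 'cV[K]_n) : M *m a *m h = a *m (h *m M) -> a != 0 ->
    exists l, h *m M = l *: h.
  move=> e a0; have [i ai] : exists i, a i 0 != 0.
    by apply: contrapT => na; move/eqP: a0; apply; apply/colP => i; rewrite mxE; apply/eqP;
       apply: contrapT => /negP ai; apply: na; exists i.
  exists ((a i 0)^-1 * (M *m a) i 0); apply/rowP => j.
  have := congr1 (fun A : 'M_n => A i j) e; rewrite !outerE => e'.
  by rewrite [RHS]mxE -mulrA e' mulKf.
have [a0 a00 [ua0 uMa0]] : exists2 a : 'cV[K]_n, a != 0 & u0 *m a = 0 /\ u0 *m M *m a = 0.
  have [a a0 aE] := ex_ann _ (col_mx u0 (u0 *m M)) (@rank_lt (1 + 1)%N _ isT).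
  by exists a => //; move/eqP: aE; rewrite mul_col_mx col_mx_eq0 => /andP[/eqP e1 /eqP e2].
have [l hl] := proportional a0 (eigen nu0 nv0 ua0 uMa0 hv hMv) a00.
exists l; set M' := M - l%:M.
have uM' (u : 'rV[K]_n) : u *m M' = u *m M - l *: u by rewrite mulmxBr mul_mx_scalar.
(* A column orthogonal to u and u M' is an admissible [a] in [eigen]; as [h *m M = l *: h], the
   matrix M' kills it. *)
have row_sub (u : 'rV[K]_n) : noneigen u -> (M' <= col_mx u (u *m M'))%MS.
  move=> nu; rewrite submxE; apply/eqP; set C := cokermx _.
  have : col_mx u (u *m M') *m C = 0 by rewrite mulmx_coker.
  rewrite mul_col_mx => /eqP; rewrite col_mx_eq0 => /andP[/eqP uC /eqP uMC].
  apply: trmx_inj; apply/row_matrixP => j; rewrite trmx0 row0 -tr_col; apply: trmx_inj.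
  rewrite trmxK trmx0 col_mul.
  have uCj : u *m col j C = 0 by rewrite -col_mul uC col0.
  have uMCj : u *m M *m col j C = 0.
    by have := congr1 (col j) uMC; rewrite uM' mulmxBl -scalemxAl uC scaler0 subr0 col_mul col0.
  have := eigen nu nv0 uCj uMCj hv hMv; rewrite hl -scalemxAr scalemxAl => e.
  have : (M' *m col j C) *m h = 0 by rewrite mulmxBl mul_scalar_mx mulmxBl e subrr.
  move=> MCh; have [//|x0] := eqVneq (M' *m col j C) 0; exfalso.
  have [k hk] : exists k, h 0 k != 0.
    by apply: contrapT => nh; move/eqP: h0; apply; apply/rowP => i; rewrite mxE; apply/eqP;
       apply: contrapT => /negP ai; apply: nh; exists i.
  move/eqP: x0; apply; apply/colP => i; have := congr1 (fun A : 'M_n => A i k) MCh.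
  rewrite outerE [RHS]mxE => /eqP; rewrite mulf_eq0 (negbTE hk) orbF => /eqP->.
  by rewrite mxE.
(* If M' had rank two, its row space would be the plane of u and u M' for every noneigenvector u,
   and so contain u. Every vector outside is then an eigenvector, and M' kills it, a nonzero
   eigenvalue of M' placing it inside. Both [w] and [w + u0] lie outside, so M' kills [u0], which is
   not an eigenvector. *)
rewrite leqNgt; apply/negP => rk2.
have in_row (u : 'rV[K]_n) : noneigen u -> (u <= M')%MS.
  move=> nu; apply: submx_trans (_ : col_mx u (u *m M') <= _)%MS.
    by rewrite -addsmxE addsmxSl.
  have /mxrank_leqif_eq := row_sub u nu; case=> le /esym.
  have -> : \rank M' == \rank (col_mx u (u *m M')).
    by rewrite eqn_leq le; apply: leq_trans rk2; apply: rank_leq_row.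
  by move/andP => [].
have rkM' : (\rank M' < n)%N.
  by apply: leq_ltn_trans n_gt2; apply: leq_trans (mxrankS (row_sub _ nu0)) _; apply: rank_leq_row.
have [w nw] : exists w : 'rV[K]_n, ~ (w <= M')%MS.
  apply: contrapT => nw; have : (1%:M <= M')%MS.
    by apply/row_subP => i; apply: contrapT => ni; apply: nw; exists (row i 1%:M).
  by move=> /mxrankS; rewrite mxrank1 leqNgt rkM'.
have killed (x : 'rV[K]_n) : ~ (x <= M')%MS -> x *m M' = 0.
  move=> nx; have [[k xk]|/in_row//] := pselect (exists a, x *m M = a *: x).
  have xM' : x *m M' = (k - l) *: x by rewrite uM' xk scalerBl.
  have [kl|kl] := eqVneq (k - l) 0; first by rewrite xM' kl scale0r.
  case: nx; have -> : x = (k - l)^-1 *: (x *m M') by rewrite xM' scalerA mulVf // scale1r.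
  by rewrite scalemx_sub // submxMl.
have nwu : ~ ((w + u0)%R <= M')%MS.
  by move=> wu; apply: nw; rewrite -[w](addrK u0); apply: addmx_sub => //; rewrite -scaleN1r; apply: scalemx_sub; exact: in_row.
have := killed _ nwu; rewrite mulmxDl (killed w nw) add0r => u0M'.
by apply: nu0; exists l; apply/eqP; rewrite -subr_eq0 -uM' u0M'.
Qed.

End ScalarPlusRankOne.

(** * Recognition of the null algebra from its slices *)

Section NullAlgebra.
Variables (K : fieldType) (n : nat).

Lemma null_algebraE (i j k : 'I_n) : null_algebra K n (i, j, k) =
  ((i == j) && (k == 0 :> nat))%:R + [&& i == k, j == 0 :> nat & k != 0 :> nat]%:R.
Proof.
rewrite ffunE sum_ffunE big_geq_mkord /= !ffunE !mxE /=.
have [i0|i0] := eqVneq (i : nat) 0%N.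
  rewrite big1 ?addr0 => [|m m1]; last first.
    rewrite !ffunE !mxE /=; have -> : ((i : nat) == m) = false by apply/eqP; rewrite i0; lia.
    by rewrite !mul0r addr0.
  have [ij|ij] := eqVneq i j; last first.
    have -> : ((j : nat) == 0%N) = false.
      by apply/eqP => j0; move/eqP: ij; apply; apply: val_inj; rewrite /= i0 j0.
    by rewrite mulr0 mul0r andbF addr0.
  rewrite -ij i0 mul1r mul1r; have [k0|k0] := eqVneq (k : nat) 0%N; first by rewrite andbF addr0.
  have -> : (i == k) = false by apply/eqP => ik; move/eqP: k0; rewrite -ik i0.
  by rewrite addr0.
rewrite !mul0r add0r (bigD1 i) /=; last by rewrite lt0n.
rewrite big1 ?addr0 => [|m /andP[_ mi]]; last first.
  rewrite !ffunE !mxE /=; have -> : ((i : nat) == m) = false by apply/eqP => im; move/eqP: mi; apply; exact: val_inj.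
  by rewrite !mul0r addr0.
rewrite !ffunE !mxE eqxx !mul1r -!natrM !mulnb /= -(inj_eq val_inj) -(inj_eq val_inj i k) eq_sym.
congr (_ + _); congr (nat_of_bool _)%:R.
rewrite [in RHS](eq_sym (i : nat)); have [->|ki] := eqVneq (k : nat) i; last by rewrite andbF.
by rewrite i0.
Qed.

End NullAlgebra.

Lemma sl_null (K : fieldType) n (c : 'rV[K]_n.+1) : sl (null_algebra K n.+1) c =
  (c 0 0)%:M + (\col_i if i == 0 then 0 else c 0 i) *m delta_mx 0 0.
Proof.
apply/matrixP => i j; rewrite slE [RHS]mxE outerE !mxE eqxx.
under eq_bigr => k _ do rewrite null_algebraE mulrDr.
rewrite big_split /=; congr (_ + _).
  rewrite (bigD1 0) //= big1 ?addr0 => [|k /negbTE k0]; last first.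
    by have -> : ((k : nat) == 0%N) = false; [exact: k0 | rewrite andbF mulr0].
  by rewrite andbT mulr_natr.
rewrite (bigD1 i) //= big1 ?addr0 => [|k ki]; last by rewrite eq_sym (negbTE ki) mulr0.
rewrite eqxx /=; have [->|i0] := eqVneq i 0; first by rewrite eqxx andbF mulr0 mul0r.
by congr (_ * _); rewrite -(inj_eq val_inj) /= (negbTE (i0 : (i : nat) != 0%N)) andbT.
Qed.

Lemma null_iso (K : fieldType) n (T : tensor K n) (y : 'rV[K]_n) : inj3 T -> y != 0 ->
  (forall c, exists t (w : 'cV[K]_n), sl T c = t%:M + w *m y /\ y *m w = 0) ->
  tensor_iso T (null_algebra K n).
Proof.
case: n T y => [|n] T y T3 y0 Tc.
  by exfalso; move/eqP: y0; apply; apply/rowP => -[].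
pose P := row_ebase y; have uP : P \in unitmx := row_ebase_unit y.
have [a yE] : exists a, y = a *: (delta_mx 0 0 *m P).
  exists (col_ebase y 0 0); rewrite -{1}(mulmx_ebase y) rank_rV y0 [col_ebase y in LHS]mx11_scalar.
  rewrite mul_scalar_mx scalemxAl; congr (_ *: _ *m _); apply/matrixP => i j.
  by rewrite !ord1 !mxE /=; case: j => -[].
apply: (iso_slices (P := invmx P) (Q := P)) => //; first by rewrite unitmx_inv.
move=> c; have [t [w [-> yw]]] := Tc c.
(* In the basis given by [P] the row [y] is a multiple of the first basis row, and [y *m w = 0] says
   that [v 0 0 = 0]: this coordinate is free to hold [t]. *)
pose v := a *: (P *m w).
have v0 : v 0 0 = 0.
  have : delta_mx 0 0 *m v = 0 :> 'M_1 by rewrite /v -scalemxAr mulmxA scalemxAl -yE.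
  by move=> /(congr1 (fun A : 'M_1 => A 0 0)); rewrite -rowE !mxE.
exists (\row_i if i == 0 then t else v i 0).
rewrite sl_null mulmxDr mulmxDl !mxE eqxx; congr (_ + _).
  by rewrite mul_mx_scalar -scalemxAl mulVmx // scalemx1.
rewrite yE -scalemxAr scalemxAl !mulmxA; congr (_ *m _ *m _).
have -> : (\col_i (if i == 0 then 0 else (\row_j (if j == 0 then t else v j 0)) 0 i)) = v.
  by apply/colP => i; rewrite 2!mxE; case: eqP => [->|//]; rewrite v0.
by rewrite /v -scalemxAr mulKmx.
Qed.

Section InvertibleSlice.
Variables (K : numClosedFieldType) (n : nat).
Implicit Types T : tensor K n.

Lemma trace_sq_outer (x : 'cV[K]_n) (y : 'rV[K]_n) :
  \tr (x *m y *m (x *m y)) = \tr (x *m y) ^+ 2.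
Proof.
rewrite mulmxA -(mulmxA x) [y *m x]mx11_scalar mul_mx_scalar -scalemxAl mxtraceZ.
by rewrite [\tr (x *m y)]mxtrace_mulC trace_mx11 expr2.
Qed.

Lemma unit_slice_dim T c0 : inj3 T -> sl T c0 = 1%:M ->
  (\dim (lie T) <= n ^ 2 + 1)%N /\
  (\dim (lie T) = (n ^ 2 + 1)%N -> forall c, \tr (sl T c) = 0 -> (\rank (sl T c) <= 1)%N).
Proof.
move=> T3 T0.
have col_ex (M : 'M[K]_n) : ~ (exists a, M = a%:M) ->
    exists v : 'cV[K]_n, v != 0 /\ ~ exists a, M *m v = a *: v.
  move=> nM; have [|v [v0 nv]] := @nonscalar_row _ _ M^T.
    by move=> [a e]; apply: nM; exists a; apply: trmx_inj; rewrite e tr_scalar_mx.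
  exists v^T; rewrite trmx_eq0; split=> // -[a e]; apply: nv; exists a.
  by apply: trmx_inj; rewrite trmx_mul trmxK e linearZ.
have free_col (M : 'M[K]_n) (v : 'cV[K]_n) : v != 0 -> ~ (exists a, M *m v = a *: v) ->
    row_free (col_mx v^T (v^T *m M^T)).
  move=> v0 nv; apply: row_free2P; first by rewrite trmx_eq0.
  by move=> [a e]; apply: nv; exists a; apply: trmx_inj; rewrite trmx_mul e linearZ.
split.
  have [nsc|] := pselect (exists c1, ~ exists a, sl T c1 = a%:M).
    have [c1 n1] := nsc.
    have [u [u0 nu]] := nonscalar_row n1; have [v [v0 nv]] := col_ex _ n1.
    exact: (nonscalar_dim T3 T0 (row_free2P u0 nu) (free_col _ _ v0 nv)).
  (* If all slices are scalar, [T3] makes the coordinate space the line of [c0], and the crude bound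
     n + n^2 is small enough. *)
  move=> nsc; have n1 : (n <= 1)%N.
    have : (1%:M <= c0)%MS.
      apply/row_subP => i; move: (row i 1%:M) => c; apply/sub_rVP.
      have [a ca] : exists a, sl T c = a%:M by apply: contrapT => h; apply: nsc; exists c.
      exists a; apply/eqP; rewrite -subr_eq0; apply/eqP/T3.
      by rewrite linearB linearZ /= ca T0 scalemx1 subrr.
    by move=> /mxrankS; rewrite mxrank1 => le; apply: leq_trans le (rank_leq_row c0).
  pose f (g : triple K n) := (c0 *m g.2, g.1.1).
  have f_lin : linear f by move=> a g h; rewrite /f /= mulmxDr -scalemxAr.
  pose W : vectType K := ('rV[K]_n * 'M[K]_n)%type.
  have dW : \dim (@fullv K W) = (n + n ^ 2)%N.
    rewrite dimvf (_ : vector.dim W = (vector.dim 'rV[K]_n + vector.dim 'M[K]_n)%N) //.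
    by rewrite !dim_matrix !natrME mul1n mulnn.
  apply: (@leq_trans (n + n ^ 2)); last by rewrite addnC leq_add2l.
  rewrite -dW; apply: (@injection_dim _ _ W _ fullv f f_lin) => [? _|g gl [Z0 X0]].
    exact: memvf.
  exact: (lie_unit_eq0 T3 T0).
move=> dT c trc.
have [[a ca]|nsc] := pselect (exists a, sl T c = a%:M).
  move: trc; rewrite ca mxtrace_scalar => /eqP; rewrite mulrn_eq0 => /orP[/eqP n0|/eqP->].
    by apply: leq_trans (rank_leq_row _) _; rewrite n0.
  by rewrite raddf0 mxrank0.
have [l rl] : exists l, (\rank (sl T c - l%:M)%R <= 1)%N.
  apply: scalar_plus_rank1 => // u v nu nv a h.
  have u0 : u != 0 by apply/eqP => u0; apply: nu; exists 0; rewrite u0 mul0mx scaler0.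
  have v0 : v != 0 by apply/eqP => v0; apply: nv; exists 0; rewrite v0 mulmx0 scaler0.
  exact: (max_dim_centralizer T3 T0 (row_free2P u0 nu) (free_col _ _ v0 nv) dT).
have [u [u0 nu]] := nonscalar_row nsc; have [v [v0 nv]] := col_ex _ nsc.
have [X XM] := max_dim_commutator T3 T0 (row_free2P u0 nu) (free_col _ _ v0 nv) dT trc.
have n2 : (2 <= n)%N.
  by have := rank_leq_col (col_mx u (u *m sl T c)); rewrite (eqP (row_free2P u0 nu)).
have [x [y xy]] := rank1_outer rl.
have Mxy : sl T c = x *m y + l%:M by rewrite -xy subrK.
have trxy : \tr (x *m y) = - (l *+ n).
  by apply/eqP; rewrite -addr_eq0; move/eqP: trc; rewrite Mxy linearD /= mxtrace_scalar.
(* The slice is a commutator with itself, so its square has trace zero. Writing it as x y + l with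
   total trace zero, that trace equals n (n - 1) l^2, whence l = 0. *)
have tr2 : \tr (sl T c *m sl T c) = 0.
  move: XM; move: (sl T c) => M XM; rewrite -{2}XM mulmxBr linearB /=.
  by rewrite [X in X - _]mxtrace_mulC -mulmxA [X in _ - \tr X]mulmxA [X in _ - X]mxtrace_mulC subrr.
have l0 : l = 0.
  have : (l ^+ 2) *+ (n * n.-1) = 0.
    rewrite -tr2 Mxy mulmxDl !mulmxDr !mxtraceD trace_sq_outer trxy.
    rewrite mul_mx_scalar mul_scalar_mx mul_mx_scalar !mxtraceZ trxy mxtrace_scalar.
    have -> : l *+ n = n%:R * l by rewrite mulr_natl.
    have n1 : n.-1%:R = n%:R - 1 :> K by rewrite -subn1 natrB //; lia.
    by rewrite -[LHS]mulr_natl natrM n1; ring.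
  move/eqP; rewrite mulrn_eq0 expf_eq0 muln_eq0 /= => /orP[|/eqP//].
  by lia.
by rewrite Mxy l0 raddf0 addr0; apply: leq_trans (mxrankM_maxl _ _) (rank_leq_col _).
Qed.

(** Removing the scalar part of each slice leaves a linear space of traceless matrices of rank at
    most one, hence with a common row or column; tracelessness of w y is the condition y w = 0 of
    [null_iso]. A common column is a common row after exchange of the first two factors. *)
Lemma slices_outer T c0 : inj3 T -> sl T c0 = 1%:M -> \dim (lie T) = (n ^ 2 + 1)%N -> (0 < n)%N ->
  tensor_iso T (null_algebra K n) \/ tensor_iso T (swap12 (null_algebra K n)).
Proof.
move=> T3 T0 dT n_gt0.
have nz : n%:R != 0 :> K by rewrite pnatr_eq0 -lt0n.
have [_ /(_ dT) rk1] := unit_slice_dim T3 T0.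
pose p c := c - (\tr (sl T c) / n%:R) *: c0.
have p_lin : linear p.
  move=> a c d; rewrite /p linearP /= linearP /= mulrDl scalerDl opprD scalerBr scalerA -mulrA.
  by rewrite addrACA.
pose F0 c := sl T (p c).
have F_lin : linear F0 by move=> a c d; rewrite /F0 p_lin linearP.
pose F : {linear 'rV[K]_n -> 'M[K]_n} := HB.pack F0 (GRing.isLinear.Build K _ _ _ F0 F_lin).
have trF c : \tr (F0 c) = 0.
  by rewrite /F0 /p linearB linearZ /= T0 linearB /= mxtraceZ mxtrace1 divfK // subrr.
have TE c : sl T c = (\tr (sl T c) / n%:R)%:M + F0 c.
  by rewrite /F0 /p linearB linearZ /= T0 scalemx1 addrC subrK.
have trace_outer (x : 'cV[K]_n) (y : 'rV[K]_n) : \tr (x *m y) = 0 -> y *m x = 0.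
  by rewrite mxtrace_mulC [y *m x]mx11_scalar mxtrace_scalar mulr1n => ->; rewrite raddf0.
have e0 : exists y : 'rV[K]_n, y != 0.
  exists (delta_mx 0 (Ordinal n_gt0)); apply/eqP => /rowP/(_ (Ordinal n_gt0))/eqP.
  by rewrite !mxE !eqxx oner_eq0.
have [[x xF]|[y yF]] := @rank1_space _ _ _ _ F (fun c => rk1 _ (trF c)).
- right; rewrite -[T]swap12K; apply: iso_swap12.
  have [x0|x0] := eqVneq x 0.
    have [y y0] := e0; apply: (null_iso (y := y)) => // [|c]; first exact: (inj3_swap12 T3).
    have [w Fw] := xF c; exists (\tr (sl T c) / n%:R), 0; rewrite mulmx0 mul0mx; split=> //.
    by rewrite sl_swap12 {1}TE (_ : F0 c = x *m w) // x0 mul0mx addr0 tr_scalar_mx.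
  apply: (null_iso (y := x^T)) => [||c]; first exact: (inj3_swap12 T3).
    by rewrite trmx_eq0.
  have [w Fw] := xF c; exists (\tr (sl T c) / n%:R), w^T.
  rewrite sl_swap12 {1}TE linearD /= tr_scalar_mx -!trmx_mul (_ : F0 c = x *m w) //; split=> //.
  by rewrite trace_outer ?trmx0 // -Fw trF.
- left; have [y0|y0] := eqVneq y 0.
    have [z z0] := e0; apply: (null_iso (y := z)) => // c.
    have [w Fw] := yF c; exists (\tr (sl T c) / n%:R), 0; rewrite mulmx0 mul0mx; split=> //.
    by rewrite {1}TE (_ : F0 c = w *m y) // y0 mulmx0 addr0.
  apply: (null_iso (y := y)) => // c.
  have [w Fw] := yF c; exists (\tr (sl T c) / n%:R), w.
  by rewrite {1}TE (_ : F0 c = w *m y) // trace_outer // -Fw trF.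
Qed.

Lemma invertible_slice_case T c0 : inj3 T -> sl T c0 \in unitmx -> (0 < n)%N ->
  (\dim (lie T) <= n ^ 2 + 1)%N /\
  (\dim (lie T) = (n ^ 2 + 1)%N ->
     tensor_iso T (null_algebra K n) \/ tensor_iso T (swap12 (null_algebra K n))).
Proof.
move=> T3 uT n_gt0; pose g : triple K n := (invmx (sl T c0), 1%:M, 1%:M).
have Gg : GL3 g by split; rewrite /= ?unitmx_inv ?unitmx1.
have S3 := inj3_act Gg T3.
have S0 : sl (act g T) c0 = 1%:M by rewrite sl_act /= trmx1 !mulmx1 mulVmx.
rewrite -(dim_lie_act T Gg); split=> [|dS]; first by case: (unit_slice_dim S3 S0).
have TS : tensor_iso T (act g T) by apply: iso_sym; exact: iso_act.
by case: (slices_outer S3 S0 dS n_gt0) => h; [left|right]; exact: iso_trans TS h.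
Qed.

End InvertibleSlice.

Lemma poly_nonroot (K : numDomainType) (p : {poly K}) : p != 0 -> exists t, p.[t] != 0.
Proof.
move=> p0; apply: contrapT => all_root.
have : (size [seq i%:R : K | i <- iota 0 (size p)] < size p)%N.
  apply: max_poly_roots => //.
    by apply/allP => _ /mapP[i _ ->]; apply/rootP; apply: contrapT => /eqP h; apply: all_root; exists i%:R.
  by rewrite map_inj_uniq ?iota_uniq // => i j /eqP; rewrite eqr_nat => /eqP.
by rewrite size_map size_iota ltnn.
Qed.

Lemma poly_zero_off_roots (K : numDomainType) (p q : {poly K}) : q != 0 ->
  (forall t, q.[t] != 0 -> p.[t] = 0) -> p = 0.
Proof.
move=> q0 H; apply/eqP; apply: contrapT => /negP p0.
have [t] := poly_nonroot (mulf_neq0 q0 p0); rewrite hornerM mulf_eq0 negb_or => /andP[qt].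
by rewrite H ?eqxx.
Qed.

Lemma schur_rank (K : fieldType) r s (U : 'M[K]_r) (B : 'M[K]_(r, s)) (C : 'M[K]_(s, r)) (D : 'M[K]_s) :
  U \in unitmx -> (\rank (block_mx U B C D) <= r)%N ->
  D = C *m invmx U *m B.
Proof.
move=> uU; pose S := D - C *m invmx U *m B.
have -> : block_mx U B C D = block_mx 1%:M 0 (C *m invmx U) 1%:M *m block_mx 1%:M 0 0 S *m
     block_mx U B 0 1%:M.
  rewrite !mulmx_block !mul1mx !mul0mx !mulmx0 !mulmx1 !addr0 !add0r.
  by rewrite mulmxKV // /S [C *m _ *m B + _]addrC subrK !mul1mx.
rewrite mxrankMfree; last first.
  by rewrite row_free_unit unitmxE det_ublock det1 mulr1 -unitmxE.
rewrite -mxrank_tr trmx_mul mxrankMfree; last first.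
  by rewrite row_free_unit unitmx_tr unitmxE det_lblock !det1 mulr1 unitr1.
rewrite mxrank_tr rank_diag_block_mx mxrank1 -{2}[r]addn0 leq_add2l leqn0 mxrank_eq0.
by rewrite subr_eq0 => /eqP.
Qed.

(** * Slices of bounded rank *)

Section Schur.
Variables (K : numFieldType) (r s : nat).
Variables (A : 'M[K]_r) (B : 'M[K]_(r, s)) (C : 'M[K]_(s, r)) (D : 'M[K]_s).

Hypothesis rk : forall t, (\rank (block_mx (1%:M + t *: A) (t *: B) (t *: C) (t *: D)) <= r)%N.

Let P (m n : nat) (M : 'M[K]_(m, n)) := map_mx polyC M.
Let Ax := 1%:M + 'X *: P A.
Let Pt t (m n : nat) (M : 'M[K]_(m, n)) : map_mx (horner_eval t) (P M) = M.
Proof. by apply/matrixP => i j; rewrite !mxE /horner_eval hornerC. Qed.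
Let Axt t : map_mx (horner_eval t) Ax = 1%:M + t *: A.
Proof. by rewrite map_mxD map_mx1 map_mxZ Pt /= /horner_eval hornerX. Qed.

Let det_neq0 : \det Ax != 0.
Proof.
apply/eqP => d0; have := congr1 (horner_eval 0) d0.
by rewrite -det_map_mx Axt scale0r addr0 det1 raddf0 => /eqP; rewrite oner_eq0.
Qed.

(** Where t and the determinant are nonzero, the Schur complement of the pencil vanishes; dividing
    by t and clearing the determinant gives an identity of polynomials, which may then be evaluated
    at t = 0. *)
Lemma schur_poly : \det Ax *: P D = 'X *: (P C *m \adj Ax *m P B).
Proof.
apply/matrixP => i j; apply/eqP; rewrite -subr_eq0; apply/eqP.
apply: (@poly_zero_off_roots _ _ ('X * \det Ax)); first by rewrite mulf_neq0 // polyX_eq0.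
move=> t; rewrite hornerM hornerX mulf_eq0 negb_or => /andP[t0 dt].
have dtE : (\det Ax).[t] = \det (1%:M + t *: A) by rewrite -Axt det_map_mx.
have uU : 1%:M + t *: A \in unitmx by rewrite unitmxE -dtE unitfE.
have uE : invmx (1%:M + t *: A) = (\det (1%:M + t *: A))^-1 *: \adj (1%:M + t *: A).
  by rewrite /invmx uU.
have := schur_rank uU (rk t); rewrite uE -!scalemxAl -!scalemxAr -!scalemxAl !scalerA => e.
have : map_mx (horner_eval t) (\det Ax *: P D - 'X *: (P C *m \adj Ax *m P B)) = 0.
  rewrite map_mxB !map_mxZ !map_mxM map_mx_adj !Pt Axt /= /horner_eval hornerX dtE.
  have -> : D = t^-1 *: (t *: D) by rewrite scalerA mulVf // scale1r.
  rewrite e !scalerA -scalerBl; apply/eqP; rewrite scaler_eq0; apply/orP; left; apply/eqP.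
  by rewrite dtE in dt; field; apply/andP.
by move/matrixP/(_ i j); rewrite [LHS]mxE [RHS]mxE /horner_eval /= !mxE.
Qed.

Lemma schur_D : D = 0.
Proof.
have := congr1 (map_mx (horner_eval 0)) schur_poly.
rewrite !map_mxZ Pt -det_map_mx Axt scale0r addr0 det1 scale1r /= /horner_eval hornerX.
by rewrite scale0r.
Qed.

Let X_cancel m n (M : 'M[{poly K}]_(m, n)) : 'X *: M = 0 -> M = 0.
Proof.
move=> /matrixP e; apply/matrixP => i j; have /eqP := e i j; rewrite !mxE mulf_eq0 polyX_eq0.
by move/eqP.
Qed.

Let adj0 : P C *m \adj Ax *m P B = 0.
Proof.
by apply: X_cancel; have := schur_poly; rewrite schur_D /P map_mx0 scaler0.
Qed.

(* The next two lemmas expand at t = 0 the Schur complement D - t C (1 + t A)^-1 B,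
   which vanishes wherever 1 + t A is invertible. *)
Lemma schur_CB : C *m B = 0.
Proof.
have := congr1 (map_mx (horner_eval 0)) adj0.
by rewrite !map_mxM map_mx_adj !Pt Axt scale0r addr0 adj1 mulmx1 map_mx0.
Qed.

Lemma schur_CAB : C *m A *m B = 0.
Proof.
(* Insert [Ax *m \adj Ax], a scalar, into C B = 0. The summand 1 of [Ax] contributes [adj0], and
   what remains is X times the claim. *)
have e : P C *m P A *m \adj Ax *m P B = 0.
  have : P C *m (Ax *m \adj Ax) *m P B = 0.
    by rewrite mul_mx_adj mul_mx_scalar -scalemxAl -map_mxM schur_CB map_mx0 scaler0.
  rewrite mulmxDl mul1mx mulmxDr mulmxDl adj0 add0r -!scalemxAl -scalemxAr -scalemxAl => /X_cancel.
  by rewrite !mulmxA.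
have := congr1 (map_mx (horner_eval 0)) e.
by rewrite !map_mxM map_mx_adj !Pt Axt scale0r addr0 adj1 mulmx1 map_mx0.
Qed.

End Schur.

Section LinePolynomials.
Variable K : numFieldType.

Lemma line_det k (A B : 'M[K]_k) :
  exists p : {poly K}, forall t, p.[t] = \det ((1 - t) *: A + t *: B).
Proof.
exists (\det ((1 - 'X) *: map_mx polyC A + 'X *: map_mx polyC B)) => t.
rewrite -/(horner_eval t _) -det_map_mx; congr (\det _); apply/matrixP => i j.
by rewrite !mxE /= /horner_eval !(hornerD, hornerN, hornerM, hornerX, hornerC).
Qed.

Lemma rank2_minor p q (A : 'M[K]_(p, q)) : (2 <= \rank A)%N ->
  exists (L : 'M[K]_(2, p)) (R : 'M[K]_(q, 2)), \det (L *m A *m R) != 0.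
Proof.
move=> rA; exists (pid_mx 2 *m invmx (col_ebase A)), (invmx (row_ebase A) *m pid_mx 2).
have uc := col_ebase_unit A; have ur := row_ebase_unit A.
rewrite -{2}(mulmx_ebase A) !mulmxA mulmxKV // mulmxK // mul_pid_mx mul_pid_mx.
have rp := rank_leq_row A; have rq := rank_leq_col A.
rewrite (_ : minn _ _ = 2%N); last by lia.
by rewrite pid_mx_1 det1 oner_eq0.
Qed.

Lemma minor_rank2 p q (A : 'M[K]_(p, q)) (L : 'M[K]_(2, p)) (R : 'M[K]_(q, 2)) :
  \det (L *m A *m R) != 0 -> (2 <= \rank A)%N.
Proof.
move=> d; have : L *m A *m R \in unitmx by rewrite unitmxE unitfE.
rewrite -row_free_unit => /eqP rk; rewrite -[in X in (X <= _)%N]rk.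
by apply: leq_trans (mxrankM_maxl _ _) _; apply: mxrankM_maxr.
Qed.

(** A nonzero 2 x 2 minor of each map, restricted to the line through [c] and [d], is a nonzero
    polynomial; some point of the line avoids the roots of both. *)
Lemma common_rank2 m p q p' q' (F : {linear 'rV[K]_m -> 'M[K]_(p, q)})
    (G : {linear 'rV[K]_m -> 'M[K]_(p', q')}) c d :
  (2 <= \rank (F c))%N -> (2 <= \rank (G d))%N ->
  exists e, (2 <= \rank (F e))%N /\ (2 <= \rank (G e))%N.
Proof.
move=> /rank2_minor[L [R dF]] /rank2_minor[L' [R' dG]].
have [f fE] := line_det (L *m F c *m R) (L *m F d *m R).
have [g gE] := line_det (L' *m G c *m R') (L' *m G d *m R').
have f0 : f != 0.
  apply/eqP => f0; have := fE 0; rewrite f0 horner0 subr0 scale1r scale0r addr0 => /esym/eqP.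
  by rewrite (negbTE dF).
have g0 : g != 0.
  apply/eqP => g0; have := gE 1; rewrite g0 horner0 subrr scale1r scale0r add0r => /esym/eqP.
  by rewrite (negbTE dG).
have [t] := poly_nonroot (mulf_neq0 f0 g0); rewrite hornerM mulf_eq0 negb_or => /andP[ft gt].
exists ((1 - t) *: c + t *: d); split.
  apply: (@minor_rank2 _ _ _ L R); rewrite linearP linearZ /=.
  by move: ft; rewrite fE mulmxDr mulmxDl -!scalemxAr -!scalemxAl.
apply: (@minor_rank2 _ _ _ L' R'); rewrite linearP linearZ /=.
by move: gt; rewrite gE mulmxDr mulmxDl -!scalemxAr -!scalemxAl.
Qed.

End LinePolynomials.

(** * Few slices with trivial joint kernels *)

Section Greedy.
Variables (K : fieldType) (m s p q : nat).
Variables (F : {linear 'rV[K]_m -> 'M[K]_(p, s)}) (G : {linear 'rV[K]_m -> 'M[K]_(q, s)}).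

Definition common_ker k (H : {linear 'rV[K]_m -> 'M[K]_(k, s)}) (l : seq 'rV[K]_m) : {vspace 'cV[K]_s} :=
  foldr (fun c V => (lker (linfun (mulmx (H c))) :&: V)%VS) fullv l.

Lemma common_kerP k (H : {linear 'rV[K]_m -> 'M[K]_(k, s)}) l z :
  reflect (forall c, c \in l -> H c *m z = 0) (z \in common_ker H l).
Proof.
elim: l => [|c l IH] /=; first by rewrite memvf; constructor.
rewrite memv_cap memv_ker lfunE /=; apply: (iffP andP) => [[/eqP cz /IH lz] d|h].
  by rewrite inE => /predU1P[->|/lz].
split; first by rewrite h ?mem_head.
by apply/IH => d dl; apply: h; rewrite inE dl orbT.
Qed.

Let cuts k (H : {linear 'rV[K]_m -> 'M[K]_(k, s)}) l c :=
  common_ker H l = 0%VS \/ exists z, z \in common_ker H l /\ H c *m z != 0.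

Let cuts_dim k (H : {linear 'rV[K]_m -> 'M[K]_(k, s)}) l c : cuts H l c ->
  (\dim (common_ker H (c :: l)) <= (\dim (common_ker H l)).-1)%N.
Proof.
case=> [e|[z [zl cz]]] /=; first by rewrite e capv0 dimv0.
set W := (_ :&: _)%VS.
have sub : (W <= common_ker H l)%VS by exact: capvSr.
have : (\dim W < \dim (common_ker H l))%N.
  rewrite ltn_neqAle dimvS // andbT; apply/negP => /eqP d.
  have /eqP e : W == common_ker H l by rewrite eqEdim sub d leqnn.
  by move: zl; rewrite -e memv_cap memv_ker lfunE /= (negbTE cz).
by case: (\dim (common_ker H l)).
Qed.

Let cuts_ex k (H : {linear 'rV[K]_m -> 'M[K]_(k, s)}) l :
  (forall z : 'cV[K]_s, (forall c, H c *m z = 0) -> z = 0) -> exists c, cuts H l c.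
Proof.
move=> Hz; have [e|ne] := eqVneq (common_ker H l) 0%VS; first by exists 0; left.
have zl := memv_pick (common_ker H l).
have [c cz] : exists c, H c *m vpick (common_ker H l) <> 0.
  by apply/existsNP => h; move: ne; rewrite -vpick0 (Hz _ h) eqxx.
by exists c; right; exists (vpick (common_ker H l)); split=> //; apply/eqP.
Qed.

Let cuts_add k (H : {linear 'rV[K]_m -> 'M[K]_(k, s)}) l c d :
  cuts H l c -> ~ cuts H l d -> cuts H l (c + d).
Proof.
move=> [e|[z [zl cz]]] nd; first by left.
right; exists z; split=> //; rewrite linearD mulmxDl.
suff -> : H d *m z = 0 by rewrite addr0.
by apply/eqP; apply: contrapT => /negP dz; apply: nd; right; exists z.
Qed.

Hypothesis Fz : forall z : 'cV[K]_s, (forall c, F c *m z = 0) -> z = 0.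
Hypothesis Gz : forall z : 'cV[K]_s, (forall c, G c *m z = 0) -> z = 0.

(** One vector can shrink both kernels: if c shrinks only the kernel of [F] and d only that of [G],
    then c + d shrinks both. A kernel that is already zero counts as shrunk. *)
Lemma greedy t l : (\dim (common_ker F l) <= t)%N -> (\dim (common_ker G l) <= t)%N ->
  exists l', [/\ size l' = (size l + t)%N,
    forall z : 'cV[K]_s, (forall c, c \in l' -> F c *m z = 0) -> z = 0 &
    forall z : 'cV[K]_s, (forall c, c \in l' -> G c *m z = 0) -> z = 0].
Proof.
elim: t l => [|t IH] l dF dG.
  exists l; rewrite addn0; split=> // z /common_kerP zl; apply/eqP; rewrite -memv0.
    by have /eqP <- : common_ker F l == 0%VS by rewrite -dimv_eq0 -leqn0.
  by have /eqP <- : common_ker G l == 0%VS by rewrite -dimv_eq0 -leqn0.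
have [c [cF cG]] : exists c, cuts F l c /\ cuts G l c.
  have [c cF] := cuts_ex l Fz; have [d dG'] := cuts_ex l Gz.
  have [cG|ncG] := pselect (cuts G l c); first by exists c.
  have [dF'|ndF] := pselect (cuts F l d); first by exists d.
  by exists (c + d); split; [exact: cuts_add | rewrite addrC; exact: cuts_add].
have [||l' [sz F' G']] := IH (c :: l).
- by apply: leq_trans (cuts_dim cF) _; move: dF; case: (\dim _).
- by apply: leq_trans (cuts_dim cG) _; move: dG; case: (\dim _).
by exists l'; split=> //; rewrite sz /= addnS.
Qed.

End Greedy.

(** * Block structure and dimension counts for singular slices *)

Section BoundedRank.
Variables (K : numFieldType) (r s : nat) (T : tensor K (r + s)) (c0 : 'rV[K]_(r + s)).
Hypotheses (T1 : inj1 T) (T2 : inj2 T) (T3 : inj3 T).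
Hypothesis T0 : sl T c0 = block_mx 1%:M 0 0 0.
Hypothesis Tr : forall c, (\rank (sl T c) <= r)%N.

Definition slA c : 'M[K]_r := ulsubmx (sl T c).
Definition slB c : 'M[K]_(r, s) := ursubmx (sl T c).
Definition slC c : 'M[K]_(s, r) := dlsubmx (sl T c).

Lemma slA_linear : linear slA.
Proof. by move=> a c d; rewrite /slA linearP; apply/matrixP => i j; rewrite !mxE. Qed.
Lemma slB_linear : linear slB.
Proof. by move=> a c d; rewrite /slB linearP; apply/matrixP => i j; rewrite !mxE. Qed.
Lemma slC_linear : linear slC.
Proof. by move=> a c d; rewrite /slC linearP; apply/matrixP => i j; rewrite !mxE. Qed.
HB.instance Definition _ := GRing.isLinear.Build K _ _ _ slA slA_linear.
HB.instance Definition _ := GRing.isLinear.Build K _ _ _ slB slB_linear.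
HB.instance Definition _ := GRing.isLinear.Build K _ _ _ slC slC_linear.

Definition slCt c : 'M[K]_(r, s) := (slC c)^T.
Lemma slCt_linear : linear slCt.
Proof. by move=> a c d; rewrite /slCt !linearP. Qed.
HB.instance Definition _ := GRing.isLinear.Build K _ _ _ slCt slCt_linear.

Let perturb c t : (\rank (block_mx (1%:M + t *: slA c) (t *: slB c) (t *: slC c)
   (t *: drsubmx (sl T c))) <= r)%N.
Proof.
have := Tr (c0 + t *: c); rewrite linearD linearZ /= T0 -{1}[sl T c]submxK.
by rewrite scale_block_mx add_block_mx !add0r.
Qed.

Lemma sl_block c : sl T c = block_mx (slA c) (slB c) (slC c) 0.
Proof. by rewrite -(schur_D (perturb c)) submxK. Qed.

Lemma slCB c : slC c *m slB c = 0. Proof. exact: schur_CB (perturb c). Qed.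
Lemma slCAB c : slC c *m slA c *m slB c = 0. Proof. exact: schur_CAB (perturb c). Qed.

Lemma slB_inj (z : 'cV[K]_s) : (forall c, slB c *m z = 0) -> z = 0.
Proof.
move=> Bz; suff : col_mx (0 : 'cV[K]_r) z = 0.
  by move/eqP; rewrite col_mx_eq0 => /andP[_ /eqP].
by apply: T2 => c; rewrite sl_block mul_block_col !mulmx0 mul0mx Bz !add0r col_mx0.
Qed.

Lemma slC_inj (w : 'rV[K]_s) : (forall c, w *m slC c = 0) -> w = 0.
Proof.
move=> Cw; suff : row_mx (0 : 'rV[K]_r) w = 0.
  by move/eqP; rewrite row_mx_eq0 => /andP[_ /eqP].
by apply: T1 => c; rewrite sl_block mul_row_block !mul0mx mulmx0 Cw !add0r row_mx0.
Qed.

Lemma slCt_inj (z : 'cV[K]_s) : (forall c, slCt c *m z = 0) -> z = 0.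
Proof.
move=> Cz; apply: trmx_inj; rewrite trmx0; apply: slC_inj => c.
by apply: trmx_inj; rewrite trmx_mul trmxK trmx0; exact: Cz.
Qed.

Section LieElement.
Variable g : triple K (r + s).
Hypotheses (gl : g \in lie T) (g0 : c0 *m g.2 = 0).
Let X11 : 'M[K]_r := ulsubmx g.1.1.
Let X12 : 'M[K]_(r, s) := ursubmx g.1.1.
Let X22 : 'M[K]_s := drsubmx g.1.1.
Let Y21 : 'M[K]_(s, r) := dlsubmx g.1.2^T.
Let Y22 : 'M[K]_s := drsubmx g.1.2^T.

Lemma lie_blocks0 : g.1.1 = block_mx X11 X12 0 X22 /\ g.1.2^T = block_mx (- X11) 0 Y21 Y22.
Proof.
have := (lieP _ _ gl) c0; rewrite g0 linear0 addr0 T0.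
rewrite -{1 2}[g.1.1]submxK -{1 2}[g.1.2^T]submxK !mulmx_block.
rewrite !(mulmx0, mul0mx, mulmx1, mul1mx, addr0, add0r) add_block_mx !(addr0, add0r).
move=> /eqP; rewrite block_mx_eq0 => /and4P[/eqP e1 /eqP e2 /eqP e3 _].
split; first by rewrite e3.
by rewrite e2; congr (block_mx _ _ _ _); apply/eqP; rewrite -addr_eq0 addrC e1.
Qed.

Lemma lie_blocks c : c *m g.2 = 0 ->
  [/\ X11 *m slA c + X12 *m slC c - slA c *m X11 + slB c *m Y21 = 0,
      X11 *m slB c + slB c *m Y22 = 0 & X22 *m slC c - slC c *m X11 = 0].
Proof.
move=> gc; have := (lieP _ _ gl) c; have [-> ->] := lie_blocks0; rewrite gc linear0 addr0 sl_block.
rewrite !mulmx_block !(mulmx0, mul0mx, addr0, add0r) add_block_mx !mulmxN !(addr0, add0r).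
move=> /eqP; rewrite block_mx_eq0 => /and4P[/eqP e1 /eqP e2 /eqP e3 _].
by split=> //; rewrite -addrA -[RHS]e1 addrA.
Qed.
End LieElement.

Section JointKernel.
Variable l : seq 'rV[K]_(r + s).
Hypothesis lB : forall z : 'cV[K]_s, (forall c, c \in l -> slB c *m z = 0) -> z = 0.
Hypothesis lC : forall z : 'cV[K]_s, (forall c, c \in l -> slCt c *m z = 0) -> z = 0.

Let lBm q (Z : 'M[K]_(s, q)) : (forall c, c \in l -> slB c *m Z = 0) -> Z = 0.
Proof.
move=> H; apply/matrixP => i j; have /colP/(_ i) : col j Z = 0.
  by apply: lB => c cl; rewrite -col_mul H // col0.
by rewrite !mxE.
Qed.

Let lCm q (W : 'M[K]_(q, s)) : (forall c, c \in l -> W *m slC c = 0) -> W = 0.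
Proof.
move=> H; apply/matrixP => i j; have /colP/(_ j) : (row i W)^T = 0.
  by apply: lC => c cl; rewrite -trmx_mul -row_mul H // row0 trmx0.
by rewrite !mxE.
Qed.

(** The blocks X22, Y22 and Y21 enter [lie_blocks] only through products with the B(c) and C(c).
    Over the slices in [l] these have no joint kernel, so the three blocks vanish once X11 and X12
    do. *)
Lemma lie_joint_eq0 g : g \in lie T -> (forall c, c \in c0 :: l -> c *m g.2 = 0) ->
  ulsubmx g.1.1 = 0 -> ursubmx g.1.1 = 0 -> g = 0.
Proof.
move=> gl gc X11 X12; have g0 := gc c0 (mem_head _ _).
have eqs c : c \in l -> _ := fun cl => lie_blocks gl g0 (gc c (mem_behead (s := c0 :: l) cl)).
have [Xb Yb] := lie_blocks0 gl g0.
have Y22 : drsubmx g.1.2^T = 0.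
  by apply: lBm => c /eqs[_ + _]; rewrite X11 mul0mx add0r.
have X22 : drsubmx g.1.1 = 0.
  by apply: lCm => c /eqs[_ _]; rewrite X11 mulmx0 subr0.
have Y21 : dlsubmx g.1.2^T = 0.
  by apply: lBm => c /eqs[+ _ _]; rewrite X11 X12 !mul0mx mulmx0 subr0 !add0r.
have X0 : g.1.1 = 0 by rewrite Xb X11 X12 X22 block_mx0.
have Y0 : g.1.2^T = 0 by rewrite Yb X11 Y22 Y21 oppr0 block_mx0.
have Z0 : g.2 = 0.
  apply/row_matrixP => i; rewrite row0 rowE; apply: T3.
  by have := (lieP _ _ gl) (delta_mx 0 i); rewrite X0 Y0 mul0mx mulmx0 !add0r.
case: g gl gc X11 X12 g0 eqs Xb Yb Y22 X22 Y21 X0 Y0 Z0 => [[X Y] Z] /= *.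
have -> : Y = 0 by apply: trmx_inj; rewrite trmx0.
by subst X Z.
Qed.

Let U : 'M[K]_((size l).+1, r + s) := \matrix_i (c0 :: l)`_i.

Let U_eq0 (Z : 'M[K]_(r + s)) : U *m Z = 0 -> forall c, c \in c0 :: l -> c *m Z = 0.
Proof.
move=> UZ c /(nthP 0) [i lti <-].
have := congr1 (row (Ordinal lti)) UZ; by rewrite row_mul rowK row0.
Qed.

(** The target has dimension at most s (r + s) + r^2 + r s = (r + s)^2: it is the strict inequality
    on [size l] that brings the count down to n^2. *)
Lemma joint_dim_rank2 : (size l < s)%N -> (\dim (lie T) <= (r + s) ^ 2)%N.
Proof.
move=> szl.
pose f (g : triple K (r + s)) := (U *m g.2, ulsubmx g.1.1 : 'M[K]_r, ursubmx g.1.1 : 'M[K]_(r, s)).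
have f_lin : linear f.
  move=> a g h; rewrite /f /= mulmxDr -scalemxAr; congr (_, _, _);
  by apply/matrixP => i j; rewrite !mxE.
pose W : vectType K := ('M[K]_((size l).+1, r + s) * 'M[K]_r * 'M[K]_(r, s))%type.
have dW : \dim (@fullv K W) = ((size l).+1 * (r + s) + r * r + r * s)%N.
  rewrite dimvf; have -> : vector.dim W = (vector.dim 'M[K]_((size l).+1, r + s) +
    vector.dim 'M[K]_r + vector.dim 'M[K]_(r, s))%N by [].
  by rewrite !dim_matrix !natrME.
apply: (@leq_trans ((size l).+1 * (r + s) + r * r + r * s)); last by nia.
rewrite -dW; apply: (@injection_dim _ _ W _ fullv f f_lin) => [? _|g gl [UZ X11 X12]].
  exact: memvf.
by apply: lie_joint_eq0 => //; exact: U_eq0.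
Qed.

(** One vector more in [l] is paid for by [x]. From X11 B + B Y22 = 0 with B = x w nonzero, [x] is
    an eigenvector of X11, so that X11 x costs one parameter; once X11 = 0, the columns of X12 are
    multiples of [x], so that X12 costs s. The total is n^2 + 1 - s (r - 2). *)
Lemma joint_dim_common (x : 'cV[K]_r) : size l = s -> (0 < s)%N -> (3 <= r)%N ->
  (forall c, c \in l -> exists w, slB c = x *m w) -> (\dim (lie T) <= (r + s) ^ 2)%N.
Proof.
move=> szl s_gt0 r3 lx.
have x0 : x != 0.
  apply/eqP => x0; have : (delta_mx (Ordinal s_gt0) 0 : 'cV[K]_s) = 0.
    by apply: lB => c /lx[w ->]; rewrite x0 !mul0mx.
  by move/colP/(_ (Ordinal s_gt0))/eqP; rewrite !mxE !eqxx oner_eq0.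
have [y yx] : exists y : 'rV[K]_r, y *m x = 1%:M.
  have : row_free x^T by rewrite /row_free rank_rV trmx_eq0 x0.
  by move=> /row_freeP[z xz]; exists z^T; apply: trmx_inj; rewrite trmx_mul trmxK xz trmx1.
pose J := (row_base (x^T^C)%MS)^T.
pose f (g : triple K (r + s)) := (U *m g.2, y *m (ulsubmx g.1.1 : 'M[K]_r) *m x,
  (ulsubmx g.1.1 : 'M[K]_r) *m J, y *m (ursubmx g.1.1 : 'M[K]_(r, s))).
have f_lin : linear f.
  move=> a g h; rewrite /f /=.
  have ul : ulsubmx (a *: g.1.1 + h.1.1) = a *: ulsubmx g.1.1 + ulsubmx h.1.1 :> 'M[K]_r.
    by apply/matrixP => i j; rewrite !mxE.
  have ur : ursubmx (a *: g.1.1 + h.1.1) = a *: ursubmx g.1.1 + ursubmx h.1.1 :> 'M[K]_(r, s).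
    by apply/matrixP => i j; rewrite !mxE.
  by rewrite ul ur !mulmxDr !mulmxDl -!scalemxAr -!scalemxAl.
pose W : vectType K := ('M[K]_((size l).+1, r + s) * 'M[K]_1 * 'M[K]_(r, \rank (x^T^C)%MS) *
   'M[K]_(1, s))%type.
have dW : \dim (@fullv K W) = (s.+1 * (r + s) + 1 + r * r.-1 + s)%N.
  rewrite dimvf; have -> : vector.dim W = (vector.dim 'M[K]_((size l).+1, r + s) +
    vector.dim 'M[K]_1 + vector.dim 'M[K]_(r, \rank (x^T^C)%MS) + vector.dim 'M[K]_(1, s))%N by [].
  rewrite !dim_matrix !natrME mxrank_compl rank_rV trmx_eq0 x0 szl subn1.
  by rewrite !mul1n.
apply: (@leq_trans (s.+1 * (r + s) + 1 + r * r.-1 + s)); last by nia.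
rewrite -dW; apply: (@injection_dim _ _ W _ fullv f f_lin) => [? _|g gl [UZ yXx XJ yX12]].
  exact: memvf.
have gc := U_eq0 UZ; have g0 := gc c0 (mem_head _ _).
have eqs c : c \in l -> _ := fun cl => lie_blocks gl g0 (gc c (mem_behead (s := c0 :: l) cl)).
have [c cl [w Bc] [k wk]] : exists2 c, c \in l & exists2 w, slB c = x *m w & exists k, w 0 k != 0.
  apply: contrapT => nc; move/eqP: x0; apply; exfalso.
  have : (delta_mx (Ordinal s_gt0) 0 : 'cV[K]_s) = 0.
    apply: lB => c cl; have [w Bc] := lx c cl; rewrite Bc.
    suff -> : w = 0 by rewrite mulmx0 mul0mx.
    apply/rowP => k; rewrite mxE; apply/eqP; apply: contrapT => /negP wk; apply: nc.
    by exists c => //; exists w => //; exists k.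
  by move/colP/(_ (Ordinal s_gt0))/eqP; rewrite !mxE !eqxx oner_eq0.
have X11x : ulsubmx g.1.1 *m x = 0.
  have [_ + _] := eqs c cl; rewrite Bc -mulmxA => /(congr1 (col k)).
  rewrite linearD /= !col_mul mulmxA col0.
  have -> : col k w = (w 0 k)%:M by apply/colP => i; rewrite !ord1 !mxE eqxx mulr1n.
  rewrite mul_mx_scalar => e.
  have -> : ulsubmx g.1.1 *m x = (w 0 k)^-1 *: (w 0 k *: (ulsubmx g.1.1 *m x)).
    by rewrite scalerA mulVf // scale1r.
  have e2 : w 0 k *: (ulsubmx g.1.1 *m x) = x *m (- (w *m col k (drsubmx g.1.2^T))).
    by apply/eqP; rewrite mulmxN -addr_eq0 e.
  have := congr1 (mulmx y) e2; rewrite -scalemxAr [y *m (_ *m x)]mulmxA yXx scaler0 [y *m (x *m _)]mulmxA yx mul1mx => e3.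
  by rewrite e2 -e3 mulmx0 scaler0.
have X11 : ulsubmx g.1.1 = 0 :> 'M[K]_r.
  apply: trmx_inj; rewrite trmx0; apply: (@compl_zero _ _ _ _ x^T).
    by rewrite -trmx_mul X11x trmx0.
  by apply: trmx_inj; rewrite trmx_mul trmxK XJ trmx0.
apply: lie_joint_eq0 => //.
have : (1%:M - x *m y) *m (ursubmx g.1.1 : 'M[K]_(r, s)) = 0.
  apply: lCm => d dl; have [+ _ _] := eqs d dl; have [v Bd] := lx d dl.
  rewrite X11 !mul0mx mulmx0 add0r subr0 => /eqP; rewrite addr_eq0 => /eqP e.
  rewrite -mulmxA e mulmxN Bd mulmxBl mul1mx !mulmxA.
  by rewrite -(mulmxA x y x) yx mulmx1 subrr oppr0.
by rewrite mulmxBl mul1mx -mulmxA yX12 mulmx0 subr0.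
Qed.

End JointKernel.
End BoundedRank.

Lemma dim_lker_mulmx (K : fieldType) p s (A : 'M[K]_(p, s)) :
  (\dim (lker (linfun (mulmx A : 'cV[K]_s -> 'cV[K]_p))) <= s - \rank A)%N.
Proof.
have <- : \dim (@fullv K 'cV[K]_(\rank A^C%MS)) = (s - \rank A)%N.
  by rewrite dimvf dim_matrix natrME muln1 mxrank_compl.
apply: (@injection_dim _ _ _ _ _ (mulmx (row_base A^C%MS))) => [a u v|? _|z].
- by rewrite linearP.
- exact: memvf.
by rewrite memv_ker lfunE /= => /eqP Az; exact: compl_zero.
Qed.

Lemma orthogonal_row (K : fieldType) n (x : 'cV[K]_n) : (2 <= n)%N ->
  exists2 u : 'rV[K]_n, u != 0 & u *m x = 0.
Proof.
move=> n2; have : kermx x != 0.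
  rewrite -mxrank_eq0 mxrank_ker -lt0n subn_gt0.
  by apply: leq_ltn_trans (rank_leq_col x) n2.
by case/rowV0Pn => u /sub_kermxP ux u0; exists u.
Qed.

Lemma orthogonal_col (K : fieldType) n (y : 'rV[K]_n) : (2 <= n)%N ->
  exists2 v : 'cV[K]_n, v != 0 & y *m v = 0.
Proof.
move=> n2; have [u u0 uy] := orthogonal_row y^T n2; exists u^T; first by rewrite trmx_eq0.
by apply: trmx_inj; rewrite trmx_mul trmxK uy trmx0.
Qed.

Lemma concise_rank2 (K : fieldType) n (T : tensor K n) : (2 <= n)%N -> inj1 T -> inj2 T ->
  exists c, (2 <= \rank (sl T c))%N.
Proof.
move=> n2 T1 T2; apply: contrapT => nc.
have rk c : (\rank (sl T c) <= 1)%N.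
  by rewrite leqNgt; apply/negP => rc; apply: nc; exists c.
have [[x xT]|[y yT]] := @rank1_space _ _ _ _ (sl T) rk.
  have [u u0 ux] := orthogonal_row x n2; move/eqP: u0; apply; apply: T1 => c.
  by have [w ->] := xT c; rewrite mulmxA ux mul0mx.
have [v v0 yv] := orthogonal_col y n2; move/eqP: v0; apply; apply: T2 => c.
by have [w ->] := yT c; rewrite -mulmxA yv mulmx0.
Qed.

Section BoundedRankDim.
Variables (K : numFieldType) (r s : nat).
Hypotheses (s_gt0 : (0 < s)%N) (r_ge3 : (3 <= r)%N).

(** A common row y of the B(c) forces s = 1, since a vector orthogonal to y would be killed by all
    of them. Then [l] has a single member c, and B(c), being one column, plays the role of [x]. *)
Let dim_rank1 (T : tensor K (r + s)) c0 : inj1 T -> inj2 T -> inj3 T ->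
  sl T c0 = block_mx 1%:M 0 0 0 -> (forall c, (\rank (sl T c) <= r)%N) ->
  (forall c, (\rank (slB T c) <= 1)%N) -> (\dim (lie T) <= (r + s) ^ 2)%N.
Proof.
move=> T1 T2 T3 T0 Tr rB.
have Binj := @slB_inj _ _ _ _ _ T2 T0 Tr; have Cinj := @slCt_inj _ _ _ _ _ T1 T0 Tr.
have d0 k (H : {linear 'rV[K]_(r + s) -> 'M[K]_(k, s)}) : (\dim (common_ker H [::]) <= s)%N.
  by rewrite dimvf dim_matrix natrME muln1.
have [l [sz lB lC]] := @greedy _ _ _ _ _ (slB T) (slCt T) Binj Cinj s [::] (d0 _ _) (d0 _ _).
rewrite /= add0n in sz.
have [[x xB]|[y yB]] := @rank1_space _ _ _ _ (slB T) rB.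
  by apply: (joint_dim_common T3 T0 Tr lB lC (x := x)) => // c _; exact: xB.
have [s1|s_neq1] := eqVneq s 1%N; last first.
  have s2 : (2 <= s)%N by lia.
  have [v v0 yv] := orthogonal_col y s2; case/eqP: v0; apply: Binj => c.
  by have [w ->] := yB c; rewrite -mulmxA yv mulmx0.
have sz1 : size l = 1%N by rewrite sz.
case: l lB lC sz1 {sz} => [//|c [|//]] lB lC _.
apply: (joint_dim_common T3 T0 Tr lB lC (x := slB T c *m const_mx 1)) => //.
move=> d; rewrite inE => /eqP->; exists (const_mx 1).
apply/matrixP => i j; rewrite outerE !mxE mulr1.
have uq (k : 'I_s) : k = j by apply: val_inj => /=; have := ltn_ord k; have := ltn_ord j; lia.
rewrite (bigD1 j) //= big1 ?addr0 => [|k kj]; first by rewrite !mxE mulr1.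
by rewrite (uq k) eqxx in kj.
Qed.

Lemma bounded_rank_dim (T : tensor K (r + s)) c0 : inj1 T -> inj2 T -> inj3 T ->
  sl T c0 = block_mx 1%:M 0 0 0 -> (forall c, (\rank (sl T c) <= r)%N) ->
  (\dim (lie T) <= (r + s) ^ 2)%N.
Proof.
move=> T1 T2 T3 T0 Tr.
have [rB|/existsNP[c /negP rB]] := pselect (forall c, (\rank (slB T c) <= 1)%N).
  exact: dim_rank1 T0 Tr rB.
have [rC|/existsNP[d /negP rC]] := pselect (forall c, (\rank (slCt T c) <= 1)%N).
  (* Exchanging the first two factors turns the transposed blocks C into the blocks B. *)
  rewrite -dim_lie_swap12; apply: (@dim_rank1 _ c0).
  - exact: inj1_swap12.
  - exact: inj2_swap12.
  - exact: inj3_swap12.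
  - by rewrite sl_swap12 T0 tr_block_mx trmx1 !trmx0.
  - by move=> c'; rewrite sl_swap12 mxrank_tr.
  - move=> c'; rewrite (_ : slB _ c' = slCt T c') //.
    by apply/matrixP => i j; rewrite /slB sl_swap12 !mxE.
have Binj := @slB_inj _ _ _ _ _ T2 T0 Tr; have Cinj := @slCt_inj _ _ _ _ _ T1 T0 Tr.
rewrite -ltnNge in rB; rewrite -ltnNge in rC.
have [e [eB eC]] := @common_rank2 _ _ _ _ _ _ (slB T) (slCt T) _ _ rB rC.
have ker1 k (H : {linear 'rV[K]_(r + s) -> 'M[K]_(k, s)}) : (2 <= \rank (H e))%N ->
    (\dim (common_ker H [:: e]) <= s - 2)%N.
  move=> rH; rewrite /= capvf; apply: leq_trans (dim_lker_mulmx _) _.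
  exact: leq_sub2l.
(* The slice at [e] lowers both kernels by two at once, so that s - 1 vectors suffice in all. *)
have [l [sz lB lC]] := @greedy _ _ _ _ _ (slB T) (slCt T) Binj Cinj (s - 2) [:: e]
  (ker1 _ (slB T) eB) (ker1 _ (slCt T) eC).
apply: (joint_dim_rank2 T3 T0 Tr lB lC).
have := rank_leq_col (slB T e); rewrite sz /=; move: (\rank _) eB => q; lia.
Qed.

End BoundedRankDim.

(* The last hypothesis says that every slice has the form x *m w + v *m y. *)
Lemma compression_invertible (K : fieldType) n (T : tensor K n) (x : 'cV[K]_n) (y : 'rV[K]_n) :
  inj1 T -> inj3 T -> y != 0 ->
  (forall (u : 'rV[K]_n) (v : 'cV[K]_n) c, u *m x = 0 -> y *m v = 0 -> u *m sl T c *m v = 0) ->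
  exists d, sl (swap23 T) d \in unitmx.
Proof.
move=> T1 T3 y0 CP.
have slv d c : sl (swap23 T) d *m c^T = sl T c *m d^T.
  rewrite [c in RHS]row_sum_delta linear_sum /= mulmx_suml.
  apply/matrixP => i j; rewrite summxE mxE; apply: eq_bigr => k _.
  rewrite linearZ /= -scalemxAl -sl_swap23 !mxE (ord1 j) mulrC; congr (_ * _).
have [v0 yv0] : exists v : 'cV[K]_n, y *m v = 1%:M.
  by have : row_free y; [rewrite /row_free rank_rV y0 | move/row_freeP].
(* For u x = 0 the row u T(c) vanishes on the kernel of [y], so one further vector off that kernel
   decides whether it is zero. *)
have factor (u : 'rV[K]_n) (v : 'cV[K]_n) c : u *m x = 0 -> y *m v = 1%:M -> u *m sl T c *m v = 0 -> u *m sl T c = 0.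
  move=> ux yv uv; apply: trmx_inj; rewrite trmx0; apply/colP => j.
  pose e := delta_mx j 0 : 'cV[K]_n; have yz : y *m (e - v *m (y *m e)) = 0.
    by rewrite mulmxBr [y *m (v *m _)]mulmxA yv mul1mx subrr.
  have := CP u _ c ux yz; rewrite mulmxBr [_ *m (v *m _)]mulmxA uv mul0mx subr0.
  move=> /(congr1 (fun A : 'M_1 => A 0 0)); rewrite -colE => e0.
  by rewrite mxE [RHS]mxE; move: e0; rewrite !mxE.
have [u0|] := boolP (sl (swap23 T) v0^T \in unitmx); first by exists v0^T.
rewrite -unitmx_tr -row_free_unit => nf.
have [c c0 cv0] : exists2 c : 'rV[K]_n, c != 0 & sl T c *m v0 = 0.
  apply: contrapT => nc; move/negP: nf; apply; apply: inj_row_free => c cS.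
  apply/eqP; apply: contrapT => /negP c0; apply: nc; exists c => //.
  by rewrite -[v0]trmxK -slv; apply: trmx_inj; rewrite trmx_mul trmxK cS trmx0.
have [z' z'0] : exists z : 'cV[K]_n, sl T c *m z != 0.
  apply: contrapT => nz; move/eqP: c0; apply; apply: T3; apply/matrixP => i j.
  have : sl T c *m (delta_mx j 0 : 'cV[K]_n) = 0.
    by apply/eqP; apply: contrapT => /negP h; apply: nz; exists (delta_mx j 0).
  by move/colP/(_ i); rewrite -colE !mxE.
pose z := z' - v0 *m (y *m z').
have yz : y *m z = 0 by rewrite mulmxBr [y *m (v0 *m _)]mulmxA yv0 mul1mx subrr.
have cz : sl T c *m z = sl T c *m z' by rewrite mulmxBr [_ *m (v0 *m _)]mulmxA cv0 mul0mx subr0.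
(* The failing choice [v0] is corrected by [z] in the kernel of [y]: T(c) v = T(c) z is a nonzero
   multiple of [x]. A row u killed by the slice at v therefore satisfies u x = 0, and [factor] makes
   it kill all of [T]. *)
pose v := v0 + z; have yv : y *m v = 1%:M by rewrite mulmxDr yv0 yz addr0.
exists v^T; rewrite -row_free_unit; apply: inj_row_free => u uS.
have uv d : u *m sl T d *m v = 0 by rewrite -mulmxA -[v]trmxK -slv mulmxA uS mul0mx.
have ux : u *m x = 0.
  have xz : exists a, sl T c *m z = a *: x.
    have : ((sl T c *m z)^T <= x^T)%MS.
      rewrite submxE; apply/eqP; apply: trmx_inj; rewrite trmx_mul trmxK trmx0.
      apply/row_matrixP => i; rewrite row0 row_mul; have := CP (row i (cokermx x^T)^T) z c _ yz.
      rewrite -mulmxA; apply; rewrite -row_mul.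
      have E : (cokermx x^T)^T *m x = 0 by apply: trmx_inj; rewrite trmx_mul trmxK mulmx_coker trmx0.
      by rewrite E row0.
    by case/sub_rVP => a e; exists a; apply: trmx_inj; rewrite linearZ.
  have [a e] := xz; have a0 : a != 0.
    by apply/eqP => a0; move/eqP: z'0; apply; rewrite -cz e a0 scale0r.
  have := uv c; rewrite -mulmxA mulmxDr cv0 add0r e -scalemxAr => /eqP.
  by rewrite scaler_eq0 (negbTE a0) => /eqP.
by apply: T1 => d; exact: factor ux yv (uv d).
Qed.

Lemma plane_row (K : fieldType) (p q : 'rV[K]_2) (z : 'cV[K]_2) :
  p *m z = 0 -> q *m z = 0 -> q != 0 -> z != 0 -> exists a, p = a *: q.
Proof.
move=> pz qz q0 z0; apply/sub_rVP.
have qk : (q <= kermx z)%MS by apply/sub_kermxP.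
have : \rank q == \rank (kermx z).
  by rewrite mxrank_ker rank_rV q0 -mxrank_tr rank_rV trmx_eq0 z0.
rewrite (mxrank_leqif_eq qk) => /andP[_ kq].
by apply: submx_trans kq; apply/sub_kermxP.
Qed.

Lemma plane_col (K : fieldType) (p q : 'cV[K]_2) (z : 'rV[K]_2) :
  z *m p = 0 -> z *m q = 0 -> q != 0 -> z != 0 -> exists a, p = a *: q.
Proof.
move=> zp zq q0 z0; have [||||a e] := @plane_row _ p^T q^T z^T; rewrite ?trmx_eq0 //.
- by rewrite -trmx_mul zp trmx0.
- by rewrite -trmx_mul zq trmx0.
by exists a; apply: trmx_inj; rewrite linearZ.
Qed.

Lemma mul_outer_eq0 (K : fieldType) p q (x : 'cV[K]_p) (w : 'rV[K]_q) :
  x *m w = 0 -> x != 0 -> w = 0.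
Proof.
move=> xw x0; apply/eqP; apply: contrapT => /negP w0.
have [i xi] : exists i, x i 0 != 0.
  apply: contrapT => h; move/eqP: x0; apply; apply/colP => i; rewrite mxE; apply/eqP.
  by apply: contrapT => /negP xi; apply: h; exists i.
move/eqP: w0; apply; apply/rowP => j; have /matrixP/(_ i j)/eqP := xw.
by rewrite outerE !mxE mulf_eq0 (negbTE xi) => /eqP.
Qed.

Lemma mul_outer_eq0l (K : fieldType) p q (x : 'cV[K]_p) (w : 'rV[K]_q) :
  x *m w = 0 -> w != 0 -> x = 0.
Proof.
move=> xw w0; apply: trmx_inj; rewrite trmx0; apply: (@mul_outer_eq0 _ _ _ w^T).
  by rewrite -trmx_mul xw trmx0.
by rewrite trmx_eq0.
Qed.

(** * Slices of rank at most two *)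

Section RankTwo.
Variables (K : numFieldType) (s : nat) (T : tensor K (2 + s)) (c0 : 'rV[K]_(2 + s)).
Hypotheses (s_gt0 : (0 < s)%N) (T1 : inj1 T) (T2 : inj2 T) (T3 : inj3 T).
Hypothesis T0 : sl T c0 = block_mx 1%:M 0 0 0.
Hypothesis Tr : forall c, (\rank (sl T c) <= 2)%N.

Let CB := slCB T0 Tr.
Let CAB := slCAB T0 Tr.

Let slBD c d : slB T (c + d) = slB T c + slB T d. Proof. exact: linearD. Qed.
Let slCD c d : slC T (c + d) = slC T c + slC T d. Proof. exact: linearD. Qed.

Let polar c d : slC T c *m slB T d = - (slC T d *m slB T c).
Proof.
have := CB (c + d); rewrite slBD slCD mulmxDl !mulmxDr !CB addr0 add0r => /eqP.
by rewrite addr_eq0 => /eqP.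
Qed.

Let ex_slB : exists c, slB T c != 0.
Proof.
apply: contrapT => h; have : (delta_mx (Ordinal s_gt0) 0 : 'cV[K]_s) = 0.
  apply: (slB_inj T2 T0 Tr) => c; suff -> : slB T c = 0 by rewrite mul0mx.
  by apply/eqP; apply: contrapT => /negP Bc; apply: h; exists c.
by move/colP/(_ (Ordinal s_gt0))/eqP; rewrite !mxE !eqxx oner_eq0.
Qed.

Let ex_slC : exists c, slC T c != 0.
Proof.
apply: contrapT => h; have : (delta_mx 0 (Ordinal s_gt0) : 'rV[K]_s) = 0.
  apply: (slC_inj T1 T0 Tr) => c; suff -> : slC T c = 0 by rewrite mulmx0.
  by apply/eqP; apply: contrapT => /negP Bc; apply: h; exists c.
by move/rowP/(_ (Ordinal s_gt0))/eqP; rewrite !mxE !eqxx oner_eq0.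
Qed.

Let ex_slBC : exists c, slB T c != 0 /\ slC T c != 0.
Proof.
have [c Bc] := ex_slB; have [d Cd] := ex_slC.
have [Cc|Cc] := eqVneq (slC T c) 0; last by exists c.
have [Bd|Bd] := eqVneq (slB T d) 0; last by exists d.
by exists (c + d); rewrite slBD slCD Cc Bd addr0 add0r.
Qed.

Lemma rank2_common (x : 'cV[K]_2) : (forall c, exists w, slB T c = x *m w) ->
  exists d, sl (swap23 T) d \in unitmx.
Proof.
move=> xB; have [e [Be Ce]] := ex_slBC; have [w1 Be1] := xB e.
have x0 : x != 0 by apply/eqP => x0; move/eqP: Be; apply; rewrite Be1 x0 mul0mx.
have w10 : w1 != 0 by apply/eqP => w0; move/eqP: Be; apply; rewrite Be1 w0 mulmx0.
have Cx c : slC T c *m x = 0.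
  have Cex : slC T e *m x = 0 by apply: (mul_outer_eq0l _ w10); rewrite -mulmxA -Be1 CB.
  apply: (mul_outer_eq0l _ w10); rewrite -mulmxA -Be1 polar; have [w ->] := xB c.
  by rewrite mulmxA Cex mul0mx oppr0.
have [y y0 yx] := orthogonal_row x (leqnn 2).
(* Here C(c) has a nonzero row orthogonal to [x], which in the plane is proportional to [y]; the
   identity C A B = 0 then yields y A x = 0. *)
have yAx0 c : slB T c != 0 -> slC T c != 0 -> y *m slA T c *m x = 0.
  move=> Bc Cc; have [i Ci] : exists i, row i (slC T c) != 0.
    apply: contrapT => h; move/eqP: Cc; apply; apply/row_matrixP => i; rewrite row0; apply/eqP.
    by apply: contrapT => /negP xi; apply: h; exists i.
  have [w Bw] := xB c.
  have [a ya] : exists a, y = a *: row i (slC T c).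
    by apply: (plane_row (z := x)) => //; rewrite -row_mul Cx row0.
  have w0 : w != 0 by apply/eqP => w0; move/eqP: Bc; apply; rewrite Bw w0 mulmx0.
  have CAx : slC T c *m slA T c *m x = 0.
    by apply: (mul_outer_eq0l _ w0); rewrite -(mulmxA _ x w) -Bw CAB.
  by rewrite ya -!scalemxAl -!row_mul CAx row0 scaler0.
(* Along c + t e each of B and C vanishes for at most one t, so one of t = 0, 1, 2 avoids both; the
   term at [e] drops out by [yAx0]. *)
have yAx c : y *m slA T c *m x = 0.
  pose B' (t : K) := slB T c + t *: slB T e; pose C' (t : K) := slC T c + t *: slC T e.
  have two (V : lmodType K) (a b : V) (t u : K) : b != 0 -> t != u -> a + t *: b = 0 -> a + u *: b <> 0.
    move=> b0 tu at0 au0; move/eqP: b0; apply.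
    have : (t - u) *: b = 0.
      by rewrite scalerBl -[t *: b](addKr a) at0 -[u *: b](addKr a) au0 subrr.
    by move/(congr1 (GRing.scale (t - u)^-1)); rewrite scalerA mulVf ?subr_eq0 // scale1r scaler0.
  have [t [Bt Ct]] : exists t, B' t != 0 /\ C' t != 0.
    have n01 : 0 != 1 :> K by rewrite eq_sym oner_eq0.
    have n02 : 0 != 2%:R :> K by rewrite eq_sym pnatr_eq0.
    have n12 : 1 != 2%:R :> K by rewrite -subr_eq0 opprD addrA subrr add0r oppr_eq0 oner_eq0.
    apply: contrapT => nt.
    have bad t : B' t = 0 \/ C' t = 0.
      have [->|Bt] := eqVneq (B' t) 0; first by left.
      have [->|Ct] := eqVneq (C' t) 0; first by right.
      by case: nt; exists t.
    have tB t u := @two _ (slB T c) _ t u Be.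
    have tC t u := @two _ (slC T c) _ t u Ce.
    case: (bad 0) (bad 1) (bad 2%:R) => b0 [] b1 [] b2;
      first [exact: tB n01 b0 b1 | exact: tB n02 b0 b2 | exact: tB n12 b1 b2 |
             exact: tC n01 b0 b1 | exact: tC n02 b0 b2 | exact: tC n12 b1 b2].
  have yAD : slA T (c + t *: e) = slA T c + t *: slA T e by rewrite linearD linearZ.
  have := yAx0 (c + t *: e); rewrite slBD slCD !linearZ /= => /(_ Bt Ct).
  by rewrite yAD mulmxDr mulmxDl -scalemxAr -scalemxAl (yAx0 e Be Ce) scaler0 addr0.
apply: (@compression_invertible _ _ T (col_mx x (0 : 'cV[K]_s)) (row_mx y (0 : 'rV[K]_s))) => // [|u v c].
  by apply/eqP => /eqP; rewrite row_mx_eq0 (negbTE y0).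
rewrite -[u]hsubmxK -[v]vsubmxK !mul_row_col !(mulmx0, mul0mx, addr0) => ux yv.
rewrite (sl_block T0 Tr) mul_row_block mul_row_col.
have [w ->] := xB c.
have [a ->] := plane_row ux yx y0 x0.
have [b ->] : exists b, usubmx v = b *: x by exact: plane_col yv yx x0 y0.
rewrite mulmx0 addr0 !mulmxDl -!scalemxAl -!scalemxAr yAx.
by rewrite -[rsubmx u *m _ *m x]mulmxA Cx !mulmxA yx mul0mx !mulmx0 mul0mx !scaler0 !addr0.
Qed.

(** No B(c) has rank two: a right inverse would give C(c) = 0 by [slCB], and then C = 0 by
    polarization. So the B(c) share a column, which is the first alternative, or a row, which leaves
    room only for s = 1. *)
Lemma rank2_dichotomy : (exists d, sl (swap23 T) d \in unitmx) \/
  (s = 1%N /\ ~ exists x : 'cV[K]_2, forall c, exists w, slB T c = x *m w).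
Proof.
have [[x xB]|nx] := pselect (exists x : 'cV[K]_2, forall c, exists w, slB T c = x *m w).
  by left; exact: rank2_common xB.
right; split=> //.
have rk c : (\rank (slB T c) <= 1)%N.
  rewrite leqNgt; apply/negP => r2.
  have : row_free (slB T c) by rewrite /row_free eqn_leq rank_leq_row.
  move=> /row_freeP[Z BZ].
  have killC d : slC T d *m slB T c = 0 -> slC T d = 0.
    by move=> h; rewrite -[slC T d]mulmx1 -BZ mulmxA h mul0mx.
  have [d Cd] := ex_slC; move/eqP: Cd; apply; apply: (killC).
  by rewrite polar (killC c (CB c)) mul0mx oppr0.
have [[x xB]|[y yB]] := @rank1_space _ _ _ _ (slB T) rk; first by case: nx; exists x.
apply/eqP; rewrite eqn_leq s_gt0 andbT leqNgt; apply/negP => s2.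
have [v v0 yv] := orthogonal_col y s2; case/eqP: v0; apply: (slB_inj T2 T0 Tr) => c.
by have [w ->] := yB c; rewrite -mulmxA yv mulmx0.
Qed.

End RankTwo.

(** * The skew-symmetric tensor in explicit 3 x 3 matrices *)

Definition mk3 (K : pzRingType) (a b c d e f g h i : K) : 'M[K]_3 :=
  \matrix_(p, q) nth 0 (nth [::] [:: [:: a; b; c]; [:: d; e; f]; [:: g; h; i]] p) q.

Lemma eq_mk3 (K : pzRingType) (M : 'M[K]_3) a b c d e f g h i :
  M (inord 0) (inord 0) = a -> M (inord 0) (inord 1) = b -> M (inord 0) (inord 2) = c ->
  M (inord 1) (inord 0) = d -> M (inord 1) (inord 1) = e -> M (inord 1) (inord 2) = f ->
  M (inord 2) (inord 0) = g -> M (inord 2) (inord 1) = h -> M (inord 2) (inord 2) = i ->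
  M = mk3 a b c d e f g h i.
Proof.
have o (p : 'I_3) : p = inord p by rewrite inord_val.
move=> *; apply/matrixP => p q; rewrite (o p) (o q) mxE.
by case: p q => [[|[|[|//]]] ?] [[|[|[|//]]] ?] /=; rewrite !inordK.
Qed.

Lemma mul_mk3 (K : comPzRingType) (a b c d e f g h i a' b' c' d' e' f' g' h' i' : K) :
  mk3 a b c d e f g h i *m mk3 a' b' c' d' e' f' g' h' i' =
  mk3 (a * a' + b * d' + c * g') (a * b' + b * e' + c * h') (a * c' + b * f' + c * i')
      (d * a' + e * d' + f * g') (d * b' + e * e' + f * h') (d * c' + e * f' + f * i')
      (g * a' + h * d' + i * g') (g * b' + h * e' + i * h') (g * c' + h * f' + i * i').
Proof.
by apply: eq_mk3; rewrite !mxE !big_ord_recl big_ord0 !mxE !inordK //= addr0 addrA.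
Qed.

Lemma mk3_1 (K : pzRingType) : 1%:M = mk3 (1 : K) 0 0 0 1 0 0 0 1.
Proof. by apply: eq_mk3; rewrite !mxE -val_eqE /= !inordK. Qed.

Lemma det3 (K : comPzRingType) (M : 'M[K]_3) (m := fun i j : nat => M (inord i) (inord j)) :
  \det M =
    m 0%N 0%N * (m 1%N 1%N * m 2%N 2%N - m 1%N 2%N * m 2%N 1%N)
  - m 0%N 1%N * (m 1%N 0%N * m 2%N 2%N - m 1%N 2%N * m 2%N 0%N)
  + m 0%N 2%N * (m 1%N 0%N * m 2%N 1%N - m 1%N 1%N * m 2%N 0%N).
Proof.
have E (p q : 'I_3) : M p q = m p q by rewrite /m !inord_val.
rewrite (expand_det_row _ ord0) !big_ord_recl big_ord0 /cofactor.
rewrite !(expand_det_row _ ord0) !big_ord_recl !big_ord0 /cofactor !det_mx11 !mxE !E /= /bump /=.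
by ring.
Qed.

Lemma inord3_0 : inord 0 = ord0 :> 'I_3.
Proof. by apply: val_inj; rewrite /= inordK. Qed.
Lemma inord3_1 : inord 1 = lift ord0 ord0 :> 'I_3.
Proof. by apply: val_inj; rewrite /= inordK. Qed.
Lemma inord3_2 : inord 2 = lift ord0 (lift ord0 ord0) :> 'I_3.
Proof. by apply: val_inj; rewrite /= inordK. Qed.
Definition inord3 := (inord3_0, inord3_1, inord3_2).

Section Skew.
Variable K : numFieldType.

Lemma skew_det n (x : 'I_n * 'I_n * 'I_n) : skew_tensor K n x =
  \det (\matrix_(a < 3, b < 3)
     ((nth 0%N [:: x.1.1 : nat; x.1.2 : nat; x.2 : nat] a == b)%:R : K)).
Proof.
rewrite ffunE /determinant; apply: eq_bigr => s _; congr (_ * _).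
by rewrite ffunE !mxE !big_ord_recl big_ord0 !mxE mulr1 mulrA !inord3.
Qed.

Definition levi_civita (i j k : nat) : K :=
  nth 0 (nth [::] (nth [::]
    [:: [:: [:: 0; 0; 0]; [:: 0; 0; 1]; [:: 0; -1; 0]];
        [:: [:: 0; 0; -1]; [:: 0; 0; 0]; [:: 1; 0; 0]];
        [:: [:: 0; 1; 0]; [:: -1; 0; 0]; [:: 0; 0; 0]]] i) j) k.

Lemma skewE (i j k : 'I_3) : skew_tensor K 3 (i, j, k) = levi_civita i j k.
Proof.
rewrite skew_det det3 !mxE /= !inordK //.
by case: i j k => [[|[|[|//]]] ?] [[|[|[|//]]] ?] [[|[|[|//]]] ?] /=; rewrite /levi_civita /=; ring.
Qed.

Lemma sl_skew (c : 'rV[K]_3) (d := fun i : nat => c 0 (inord i)) : sl (skew_tensor K 3) c =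
  mk3 0 (d 2%N) (- d 1%N) (- d 2%N) 0 (d 0%N) (d 1%N) (- d 0%N) 0.
Proof.
by apply: eq_mk3; rewrite slE !big_ord_recl big_ord0 !skewE !inordK //= /bump /= /d ?inord3_0 ?inord3_1 ?inord3_2; rewrite /levi_civita /=; ring.
Qed.

(** For X = 0 the equations make Y and Z diagonal with y_j + z_k = 0 whenever j and k differ. Only
    the line of (0, 1, -1) is left, detected by one entry of Y: the bound is 9 + 1. *)
Lemma dim_lie_skew : (\dim (lie (skew_tensor K 3)) <= 10)%N.
Proof.
pose f (g : triple K 3) := (g.1.1, (g.1.2 (inord 0) (inord 0))%:M : 'M[K]_1).
have f_lin : linear f.
  move=> a g h; rewrite /f /=; congr (_, _).
  by apply/matrixP => p q; rewrite !mxE !ord1 !mulr1n.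
pose W : vectType K := ('M[K]_3 * 'M[K]_1)%type.
have dW : \dim (@fullv K W) = 10%N.
  rewrite dimvf; have -> : vector.dim W = (vector.dim 'M[K]_3 + vector.dim 'M[K]_1)%N by [].
  by rewrite !dim_matrix !natrME.
rewrite -dW; apply: (@injection_dim _ _ W _ fullv f f_lin) => [? _|]; first exact: memvf.
move=> [[X Y] Z] /lieE /= H [X0 Y00].
have {}Y00 : Y (inord 0) (inord 0) = 0.
  by have /matrixP/(_ 0 0) := Y00; rewrite !mxE eqxx mulr1n.
pose y i j := Y (inord i) (inord j); pose z i j := Z (inord i) (inord j).
have {}H i j k : (i < 3)%N -> (j < 3)%N -> (k < 3)%N ->
    y j 0%N * levi_civita i 0 k + y j 1%N * levi_civita i 1 k + y j 2%N * levi_civita i 2 k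
    + z k 0%N * levi_civita i j 0 + z k 1%N * levi_civita i j 1 + z k 2%N * levi_civita i j 2 = 0.
  move=> lti ltj ltk; have := H (inord i) (inord j) (inord k).
  rewrite big1 => [|a _]; last by rewrite X0 mxE mul0r.
  rewrite add0r !big_ord_recl !big_ord0 !skewE !inordK //= /bump /= => e.
  by rewrite -[RHS]e /y /z !inord3; ring.
have y01 : y 0%N 1%N = 0.
  by apply/eqP; rewrite -(H 0%N 0%N 2%N isT isT isT) /levi_civita /=; apply/eqP; ring.
have y02 : y 0%N 2%N = 0.
  by apply/eqP; rewrite -oppr_eq0 -(H 0%N 0%N 1%N isT isT isT) /levi_civita /=; apply/eqP; ring.
have y10 : y 1%N 0%N = 0.
  by apply/eqP; rewrite -oppr_eq0 -(H 1%N 1%N 2%N isT isT isT) /levi_civita /=; apply/eqP; ring.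
have y12 : y 1%N 2%N = 0.
  by apply/eqP; rewrite -(H 1%N 1%N 0%N isT isT isT) /levi_civita /=; apply/eqP; ring.
have y20 : y 2%N 0%N = 0.
  by apply/eqP; rewrite -(H 2%N 2%N 1%N isT isT isT) /levi_civita /=; apply/eqP; ring.
have y21 : y 2%N 1%N = 0.
  by apply/eqP; rewrite -oppr_eq0 -(H 2%N 2%N 0%N isT isT isT) /levi_civita /=; apply/eqP; ring.
have z01 : z 0%N 1%N = 0.
  by apply/eqP; rewrite -oppr_eq0 -(H 0%N 2%N 0%N isT isT isT) /levi_civita /=; apply/eqP; ring.
have z02 : z 0%N 2%N = 0.
  by apply/eqP; rewrite -(H 0%N 1%N 0%N isT isT isT) /levi_civita /=; apply/eqP; ring.
have z10 : z 1%N 0%N = 0.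
  by apply/eqP; rewrite -(H 1%N 2%N 1%N isT isT isT) /levi_civita /=; apply/eqP; ring.
have z12 : z 1%N 2%N = 0.
  by apply/eqP; rewrite -oppr_eq0 -(H 1%N 0%N 1%N isT isT isT) /levi_civita /=; apply/eqP; ring.
have z20 : z 2%N 0%N = 0.
  by apply/eqP; rewrite -oppr_eq0 -(H 2%N 1%N 2%N isT isT isT) /levi_civita /=; apply/eqP; ring.
have z21 : z 2%N 1%N = 0.
  by apply/eqP; rewrite -(H 2%N 0%N 2%N isT isT isT) /levi_civita /=; apply/eqP; ring.
have z11 : z 1%N 1%N = 0.
  have wh : y 0%N 0%N = 0 by exact: Y00.
  by apply/eqP; rewrite -(H 2%N 0%N 1%N isT isT isT) /levi_civita /= wh; apply/eqP; ring.
have z22 : z 2%N 2%N = 0.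
  have wh : y 0%N 0%N = 0 by exact: Y00.
  by apply/eqP; rewrite -oppr_eq0 -(H 1%N 0%N 2%N isT isT isT) /levi_civita /= wh; apply/eqP; ring.
have y22 : y 2%N 2%N = 0.
  have wh : z 1%N 1%N = 0 by exact: z11.
  by apply/eqP; rewrite -oppr_eq0 -(H 0%N 2%N 1%N isT isT isT) /levi_civita /= wh; apply/eqP; ring.
have y11 : y 1%N 1%N = 0.
  have wh : z 2%N 2%N = 0 by exact: z22.
  by apply/eqP; rewrite -(H 0%N 1%N 2%N isT isT isT) /levi_civita /= wh; apply/eqP; ring.
have z00 : z 0%N 0%N = 0.
  have wh : y 1%N 1%N = 0 by exact: y11.
  by apply/eqP; rewrite -oppr_eq0 -(H 2%N 1%N 0%N isT isT isT) /levi_civita /= wh; apply/eqP; ring.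
have -> : Y = 0.
  apply/matrixP => p q; rewrite -(inord_val p) -(inord_val q) mxE -/(y _ _).
  by case: p q => [[|[|[|//]]] ?] [[|[|[|//]]] ?].
have -> : Z = 0.
  apply/matrixP => p q; rewrite -(inord_val p) -(inord_val q) mxE -/(z _ _).
  by case: p q => [[|[|[|//]]] ?] [[|[|[|//]]] ?].
by rewrite X0.
Qed.

End Skew.

Lemma scale_mk3 (K : pzRingType) (x a b c d e f g h i : K) :
  x *: mk3 a b c d e f g h i =
  mk3 (x * a) (x * b) (x * c) (x * d) (x * e) (x * f) (x * g) (x * h) (x * i).
Proof. by apply: eq_mk3; rewrite !mxE !inordK. Qed.

Lemma add_mk3 (K : pzRingType) (a b c d e f g h i a' b' c' d' e' f' g' h' i' : K) :
  mk3 a b c d e f g h i + mk3 a' b' c' d' e' f' g' h' i' =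
  mk3 (a + a') (b + b') (c + c') (d + d') (e + e') (f + f') (g + g') (h + h') (i + i').
Proof. by apply: eq_mk3; rewrite !mxE !inordK. Qed.

Section SkewNormalForm.
Variables (K : numFieldType) (T : tensor K (2 + 1)) (c0 : 'rV[K]_(2 + 1)).
Hypotheses (T1 : inj1 T) (T3 : inj3 T).
Hypothesis T0 : sl T c0 = block_mx 1%:M 0 0 0.
Hypothesis Tr : forall c, (\rank (sl T c) <= 2)%N.

Let i0 : 'I_2 := ord0.
Let i1 : 'I_2 := lift ord0 ord0.
Let o0 : inord 0 = lshift 1 i0 :> 'I_3. Proof. by apply: val_inj; rewrite /= inordK. Qed.
Let o1 : inord 1 = lshift 1 i1 :> 'I_3. Proof. by apply: val_inj; rewrite /= inordK. Qed.
Let o2 : inord 2 = rshift 2 ord0 :> 'I_3. Proof. by apply: val_inj; rewrite /= inordK. Qed.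

Lemma sl_block3 c : sl T c = mk3
  (slA T c i0 i0) (slA T c i0 i1) (slB T c i0 0)
  (slA T c i1 i0) (slA T c i1 i1) (slB T c i1 0)
  (slC T c 0 i0) (slC T c 0 i1) 0.
Proof.
apply: eq_mk3; rewrite ?o0 ?o1 ?o2.
all: try by rewrite /slA /slB /slC !mxE.
transitivity ((drsubmx (sl T c) : 'M[K]_1) ord0 ord0); first by rewrite !mxE.
by rewrite (sl_block T0 Tr) block_mxKdr mxE.
Qed.

Let CB c : slC T c 0 i0 * slB T c i0 0 + slC T c 0 i1 * slB T c i1 0 = 0.
Proof.
by have /matrixP/(_ 0 0) := slCB T0 Tr c; rewrite mxE [RHS]mxE !big_ord_recl big_ord0 addr0.
Qed.

Let CAB c : slC T c 0 i0 * (slA T c i0 i0 * slB T c i0 0 + slA T c i0 i1 * slB T c i1 0) +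
  slC T c 0 i1 * (slA T c i1 i0 * slB T c i0 0 + slA T c i1 i1 * slB T c i1 0) = 0.
Proof.
have /matrixP/(_ 0 0) := slCAB T0 Tr c; rewrite -mulmxA mxE [RHS]mxE !big_ord_recl big_ord0.
by rewrite ![(_ *m _) _ _]mxE !big_ord_recl !big_ord0 !addr0.
Qed.

Variables c1 c2 : 'rV[K]_(2 + 1).
Hypotheses (B1 : slB T c1 = delta_mx i0 0) (B2 : slB T c2 = delta_mx i1 0).

Let B10 : slB T c1 i0 0 = 1. Proof. by rewrite B1 mxE. Qed.
Let B11 : slB T c1 i1 0 = 0. Proof. by rewrite B1 mxE. Qed.
Let B20 : slB T c2 i0 0 = 0. Proof. by rewrite B2 mxE. Qed.
Let B21 : slB T c2 i1 0 = 1. Proof. by rewrite B2 mxE. Qed.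

Let B0 : slB T c0 = 0.
Proof. by rewrite /slB T0 block_mxKur. Qed.

Let A0 : slA T c0 = 1%:M.
Proof. by rewrite /slA T0 block_mxKul. Qed.

Let C0 : slC T c0 = 0.
Proof. by rewrite /slC T0 block_mxKdl. Qed.

Let basis c : exists a b d, c = a *: c0 + b *: c1 + d *: c2.
Proof.
pose M : 'M[K]_(1 + 1 + 1) := col_mx (col_mx c0 c1) c2.
have fM : row_free M.
  apply: inj_row_free => v; rewrite -[v]hsubmxK -[lsubmx v]hsubmxK !mul_row_col.
  rewrite [lsubmx (lsubmx v)]mx11_scalar [rsubmx (lsubmx v)]mx11_scalar [rsubmx v]mx11_scalar !mul_scalar_mx.
  move: (lsubmx (lsubmx v) 0 0) (rsubmx (lsubmx v) 0 0) (rsubmx v 0 0) => a b d e.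
  have := congr1 (slB T) e; rewrite !linearD !linearZ /= linear0 B0 B1 B2 scaler0 add0r => eB.
  have b0 : b = 0 by have /matrixP/(_ i0 0) := eB; rewrite !mxE mulr1 mulr0 addr0.
  have d0 : d = 0 by have /matrixP/(_ i1 0) := eB; rewrite !mxE mulr1 mulr0 add0r.
  move: e; rewrite b0 d0 !scale0r !addr0 => e.
  have := congr1 (sl T) e; rewrite linearZ /= linear0 sl_block3 => /matrixP/(_ (inord 0 : 'I_3) (inord 0 : 'I_3)).
  rewrite [LHS]mxE [X in _ * X]mxE [RHS]mxE !inordK //= A0 mxE eqxx mulr1 => ->.
  by rewrite !raddf0 !row_mx0.
have cM : (c <= M)%MS by apply: submx_full; rewrite /row_full (eqP fM).
have /submxP[v ->] := cM.
rewrite -[v]hsubmxK -[lsubmx v]hsubmxK !mul_row_col.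
rewrite [lsubmx (lsubmx v)]mx11_scalar [rsubmx (lsubmx v)]mx11_scalar [rsubmx v]mx11_scalar !mul_scalar_mx.
by do 3!eexists.
Qed.

(** The identity C B = 0 leaves a single constant k in the blocks C, nonzero by [T1]. The identity C
    A B = 0 then relates A(c1) to A(c2) so tightly that one column operation removes what is left of
    them. *)
Lemma skew_normal_form : tensor_iso T (skew_tensor K (2 + 1)).
Proof.
pose k := slC T c1 0 i1.
have AD c d : slA T (c + d) = slA T c + slA T d by exact: linearD.
have BD c d : slB T (c + d) = slB T c + slB T d by exact: linearD.
have CD c d : slC T (c + d) = slC T c + slC T d by exact: linearD.
have C1 : slC T c1 0 i0 = 0 by have := CB c1; rewrite B10 B11 mulr1 mulr0 addr0.
have C2 : slC T c2 0 i1 = 0 by have := CB c2; rewrite B20 B21 mulr1 mulr0 add0r.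
have C3 : slC T c2 0 i0 = - k.
  have := CB (c1 + c2); rewrite CD BD [(slC T c1 + _) 0 i0]mxE [(slC T c1 + _) 0 i1]mxE.
  rewrite [(slB T c1 + _) i0 0]mxE [(slB T c1 + _) i1 0]mxE B10 B11 B20 B21 C1 C2.
  rewrite addr0 !add0r addr0 !mulr1 => /eqP; by rewrite addr_eq0 => /eqP.
have k0 : k != 0.
  apply/eqP => k0; have : (1%:M : 'rV[K]_1) = 0.
    apply: (slC_inj T1 T0 Tr) => c; rewrite mul1mx; have [a [b [d ->]]] := basis c.
    rewrite !CD !linearZ /= C0.
    rewrite scaler0 add0r; apply/matrixP => p q.
    rewrite [LHS]mxE ![(_ *: _ : 'M_(_, _)) _ _]mxE [RHS]mxE (ord1 p).
    have [->|->] : q = i0 \/ q = i1.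
      by case: q => [[|[|//]] ?]; [left|right]; apply: val_inj.
    - by rewrite C1 C3 k0 oppr0 !mulr0 addr0.
    - by rewrite C2 -/k k0 !mulr0 addr0.
  by move/matrixP/(_ 0 0)/eqP; rewrite !mxE oner_eq0.
have cancel_k x : k * x = 0 -> x = 0.
  by move/eqP; rewrite mulf_eq0 (negbTE k0) => /eqP.
pose a := slA T c1; pose b := slA T c2.
have a10 : a i1 i0 = 0.
  by apply: cancel_k; have := CAB c1; rewrite B10 B11 C1 !mulr1 !mulr0 mul0r add0r addr0.
have b01 : b i0 i1 = 0.
  apply: cancel_k; have := CAB c2; rewrite B20 B21 C2 C3 !mulr1 !mulr0 mul0r addr0 add0r => /eqP.
  by rewrite mulNr oppr_eq0 => /eqP.
(* C A B = 0 at c1 + c2, and below at c1 - c2; half the sum and half the difference of the two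
   relations give [b11] and [a00]. *)
have r1 : a i1 i1 + b i1 i0 + b i1 i1 - a i0 i0 - a i0 i1 - b i0 i0 = 0.
  apply: cancel_k; rewrite -[RHS](CAB (c1 + c2)) CD BD AD ![(_ + _ : 'M_(_, _)) _ _]mxE.
  by rewrite B10 B11 B20 B21 C1 C2 C3 -/a -/b -/k a10 b01; ring.
have r2 : - a i1 i1 - b i1 i0 + b i1 i1 + a i0 i0 - a i0 i1 - b i0 i0 = 0.
  apply: cancel_k; rewrite -[RHS](CAB (c1 + (-1) *: c2)) CD BD AD !linearZ /= ![(_ + _ : 'M_(_, _)) _ _]mxE.
  by rewrite ![(_ *: _ : 'M_(_, _)) _ _]mxE B10 B11 B20 B21 C1 C2 C3 -/a -/b -/k a10 b01; ring.
have two0 : 2%:R != 0 :> K by rewrite pnatr_eq0.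
have b11 : b i1 i1 = a i0 i1 + b i0 i0.
  apply: (mulfI two0); apply/eqP; rewrite -subr_eq0; apply/eqP.
  by rewrite -[RHS](addr0 0) -{1}r1 -r2; ring.
have a00 : a i0 i0 = a i1 i1 + b i1 i0.
  by apply/eqP; rewrite -subr_eq0 -oppr_eq0 -[X in _ == X]r1 b11; apply/eqP; ring.
(* At x c0 + y c1 + z c2, with s = x + y a11 + z b00, the slice is the matrix with rows (s, 0, y),
   (0, s, z), (-k z, k y, 0) times [Q]. [P] exchanges and rescales rows so that this matrix comes
   from the skew slice at (y, z, -s). *)
pose P := mk3 0 1 0 (-1) 0 0 0 0 (- k).
pose Q := mk3 1 0 0 0 1 0 (b i1 i0) (a i0 i1) 1.
apply: (@iso_slices K 3 T _ P Q) => //.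
- have : P *m mk3 0 (-1) 0 1 0 0 0 0 (- k^-1) = 1%:M.
    by rewrite mul_mk3 mk3_1; congr mk3; try ring; rewrite mulrNN mulfV //; ring.
  by move/mulmx1_unit => [].
- have : Q *m mk3 1 0 0 0 1 0 (- b i1 i0) (- a i0 i1) 1 = 1%:M.
    by rewrite mul_mk3 mk3_1; congr mk3; ring.
  by move/mulmx1_unit => [].
move=> c; have [x [y [z ->]]] := basis c.
have [t tE] : exists t, t = - (x + y * a i1 i1 + z * b i0 i0) by eexists.
exists (\row_(i < 3) nth 0 [:: y; z; t] i).
rewrite !linearD !linearZ /= sl_skew !mxE !inordK //= !mul_mk3 !sl_block3.
rewrite -/a -/b B10 B11 B20 B21 C1 C2 C3 -/k B0 A0 C0 /= !scale_mk3 !add_mk3.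
have one (i j : 'I_2) : (1%:M : 'M[K]_2) i j = (i == j)%:R by rewrite mxE.
have zero m n (i : 'I_m) (j : 'I_n) : (0 : 'M[K]_(m, n)) i j = 0 by rewrite mxE.
by rewrite a10 b01 b11 a00 !one !zero /= tE; congr mk3; ring.
Qed.

End SkewNormalForm.

(** Two independent columns B(c1) and B(c2) exist; conjugating the upper block by the matrix they
    form makes them the basis columns and leaves the slice at [c0] as it is. *)
Lemma skew_of_no_common (K : numFieldType) (T : tensor K (2 + 1)) (c0 : 'rV[K]_(2 + 1)) :
  inj1 T -> inj3 T -> sl T c0 = block_mx 1%:M 0 0 0 ->
  (forall c, (\rank (sl T c) <= 2)%N) ->
  ~ (exists x : 'cV[K]_2, forall c, exists w, slB T c = x *m w) ->
  tensor_iso T (skew_tensor K (2 + 1)).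
Proof.
move=> T1 T3 T0 Tr nx.
have [c1 B1] : exists c, slB T c != 0.
  apply: contrapT => h; apply: nx; exists 0 => c; exists 0; rewrite mulmx0.
  by apply/eqP; apply: contrapT => /negP Bc; apply: h; exists c.
have [c2 B2] : exists c, ~ exists a, slB T c = a *: slB T c1.
  apply: contrapT => h; apply: nx; exists (slB T c1) => c.
  have [[a e]|ne] := pselect (exists a, slB T c = a *: slB T c1).
    by exists a%:M; rewrite mul_mx_scalar.
  by case: h; exists c.
pose P : 'M[K]_2 := row_mx (slB T c1) (slB T c2).
have uP : P \in unitmx.
  rewrite -unitmx_tr -row_free_unit.
  suff : row_free (col_mx (slB T c1)^T (slB T c2)^T) by rewrite -tr_row_mx.
  apply: row_free2P; first by rewrite trmx_eq0.
  by move=> [a e]; apply: B2; exists a; apply: trmx_inj; rewrite e linearZ.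
pose A : 'M[K]_(2 + 1) := block_mx (invmx P) 0 0 1%:M.
pose Q : 'M[K]_(2 + 1) := block_mx P 0 0 1%:M.
have uA : A \in unitmx by rewrite unitmxE det_ublock det1 mulr1 -unitmxE unitmx_inv.
have uQ : Q \in unitmx by rewrite unitmxE det_ublock det1 mulr1 -unitmxE.
pose g : triple K (2 + 1) := (A, Q^T, 1%:M).
have Gg : GL3 g by split; rewrite /= ?unitmx_tr ?unitmx1.
have slg c : sl (act g T) c = A *m sl T c *m Q by rewrite sl_act /= trmxK mulmx1.
have slgB c : slB (act g T) c = invmx P *m slB T c.
  rewrite {1}/slB slg (sl_block T0 Tr) !mulmx_block !(mul0mx, mulmx0, addr0, add0r) mulmx1.
  by rewrite block_mxKur.
apply: iso_trans (_ : tensor_iso T (act g T)) _; first exact/iso_sym/iso_act.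
have PP : row_mx (invmx P *m slB T c1) (invmx P *m slB T c2) = 1%:M.
  by rewrite -mul_mx_row mulVmx.
apply: (@skew_normal_form _ _ c0 _ _ _ _ c1 c2).
- exact: inj1_act.
- exact: inj3_act.
- by rewrite slg T0 !mulmx_block !(mul0mx, mulmx0, addr0, add0r) mulmx1 mulVmx.
- by move=> c; rewrite slg; apply: leq_trans (mxrankM_maxl _ _) (leq_trans (mxrankM_maxr _ _) (Tr c)).
- rewrite slgB -[LHS](row_mxKl _ (invmx P *m slB T c2)) PP; apply/matrixP => i j.
  by rewrite !mxE (ord1 j) eqxx andbT -val_eqE /=.
- rewrite slgB -[LHS](row_mxKr (invmx P *m slB T c1)) PP; apply/matrixP => i j.
  by rewrite !mxE (ord1 j) eqxx andbT -val_eqE /=.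
Qed.

(** * Classification by the dimension of the Lie algebra *)

Section LieDimension.
Variable K : numClosedFieldType.

(** The permuted null algebras are listed as [invertible_slice_case] delivers them: two for [T]
    itself, two for [swap23 T]. *)
Definition maximal n (T : tensor K n) :=
  [\/ tensor_iso T (null_algebra K n), tensor_iso T (swap12 (null_algebra K n)),
      tensor_iso T (swap23 (null_algebra K n)) |
      tensor_iso T (swap23 (swap12 (null_algebra K n)))] \/
  (n = 3%N /\ tensor_iso T (skew_tensor K n)).

Lemma maximal_iso n (T T' : tensor K n) : tensor_iso T T' -> maximal T' -> maximal T.
Proof.
move=> i [[]|[n3]] h; [left; constructor 1|left; constructor 2|left; constructor 3|
  left; constructor 4|right; split=> //]; exact: iso_trans i h.
Qed.

Let singular_case r s (T : tensor K (r + s)) c0 : (0 < s)%N -> inj1 T -> inj2 T -> inj3 T ->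
  sl T c0 = block_mx 1%:M 0 0 0 -> (forall c, (\rank (sl T c) <= r)%N) ->
  (\dim (lie T) <= (r + s) ^ 2 + 1)%N /\ (\dim (lie T) = ((r + s) ^ 2 + 1)%N -> maximal T).
Proof.
move=> s0 T1 T2 T3 T0 Tr.
have [r3|r_le2] := leqP 3 r.
  have le := bounded_rank_dim s0 r3 T1 T2 T3 T0 Tr.
  by split=> [|e]; [apply: leq_trans le (leq_addr _ _) | rewrite e addn1 ltnn in le].
have [r0|r_gt0] := posnP r.
  exfalso; have z : delta_mx 0 (rshift r (Ordinal s0)) = 0 :> 'rV[K]_(r + s).
    by apply: T3; apply/eqP; rewrite -mxrank_eq0 -leqn0 (leq_trans (Tr _)) // r0.
  by move/rowP: z => /(_ (rshift r (Ordinal s0)))/eqP; rewrite !mxE !eqxx oner_eq0.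
have [c rc] : exists c, (2 <= \rank (sl T c))%N by apply: concise_rank2 => //; lia.
have r2 : r = 2%N by apply/eqP; rewrite eqn_leq -ltnS r_le2; apply: leq_trans rc (Tr c).
subst r.
have [[d ud]|[s1 nx]] := rank2_dichotomy s0 T1 T2 T3 T0 Tr.
  have [|le eq] := invertible_slice_case (inj3_swap23 T2) ud; first by rewrite addSn.
  rewrite dim_lie_swap23 in le eq; split=> // /eq[] /iso_swap23; rewrite swap23K => h; left.
    by constructor 3.
  by constructor 4.
subst s; have iT := skew_of_no_common T1 T3 T0 Tr nx; split; last by right.
by rewrite (dim_lie_iso iT); exact: dim_lie_skew.
Qed.

Theorem dim_lie_maximal n (T : tensor K n) : (0 < n)%N -> inj1 T -> inj2 T -> inj3 T ->
  (\dim (lie T) <= n ^ 2 + 1)%N /\ (\dim (lie T) = (n ^ 2 + 1)%N -> maximal T).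
Proof.
move=> n0 T1 T2 T3.
have [r [[c0 r0] Tr]] : exists r, (exists c, \rank (sl T c) = r) /\ forall c, (\rank (sl T c) <= r)%N.
  have ex : exists r, `[< exists c, \rank (sl T c) = r >].
    by exists (\rank (sl T 0)); apply/asboolP; exists 0.
  have ub r : `[< exists c, \rank (sl T c) = r >] -> (r <= n)%N.
    by move=> /asboolP[c <-]; exact: rank_leq_row.
  case: (ex_maxnP ex ub) => r /asboolP er max; exists r; split=> // c.
  by apply: max; apply/asboolP; exists c.
have [rn|rn] := eqVneq r n.
  have uT : sl T c0 \in unitmx by rewrite -row_full_unit /row_full r0 rn.
  have [le eq] := invertible_slice_case T3 uT n0; split=> // /eq[] h; left.
    by constructor 1.
  by constructor 2.
have r_lt : (r < n)%N by rewrite ltn_neqAle rn -r0 rank_leq_row.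
have [s s0 nE] : exists2 s, (0 < s)%N & n = (r + s)%N.
  by exists (n - r)%N; [rewrite subn_gt0 | rewrite subnKC // ltnW].
clear rn r_lt; subst n.
pose g : triple K (r + s) := (invmx (col_ebase (sl T c0)), (invmx (row_ebase (sl T c0)))^T, 1%:M).
have uc := col_ebase_unit (sl T c0); have ur := row_ebase_unit (sl T c0).
have Gg : GL3 g by split; rewrite /= ?unitmx_tr ?unitmx_inv ?unitmx1.
have slg c : sl (act g T) c = invmx (col_ebase (sl T c0)) *m sl T c *m invmx (row_ebase (sl T c0)).
  by rewrite sl_act /= trmxK mulmx1.
have S0 : sl (act g T) c0 = block_mx 1%:M 0 0 0.
  by rewrite slg -[X in _ *m X *m _](mulmx_ebase (sl T c0)) !mulmxA mulVmx // mul1mx mulmxK // r0 pid_mx_block.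
have Sr c : (\rank (sl (act g T) c) <= r)%N.
  by rewrite slg; apply: leq_trans (mxrankM_maxl _ _) (leq_trans (mxrankM_maxr _ _) (Tr c)).
have [le eq] := singular_case s0 (inj1_act Gg T1) (inj2_act Gg T2) (inj3_act Gg T3) S0 Sr.
rewrite (dim_lie_act T Gg) in le eq; split=> // /eq; apply: maximal_iso.
by apply: iso_sym; exact: iso_act.
Qed.

Lemma concise_inj n (T : tensor K n) : concise T -> [/\ inj1 T, inj2 T & inj3 T].
Proof.
move=> [r1 r2 r3]; split.
- move=> u Hu; have fr : row_free (\mxrow_(k < n) slice T k) by rewrite /row_free r1.
  apply: (row_free_inj fr); rewrite mul0mx mul_mxrow -(mxrow0 (q_ := fun=> n)).
  by apply: eq_mxrow => k; rewrite -sl_delta Hu.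
- move=> v Hv; have fr : row_free (\mxcol_(k < n) slice T k)^T by rewrite /row_free mxrank_tr r2.
  apply: trmx_inj; apply: (row_free_inj fr); rewrite -trmx_mul mxcol_mul trmx0 mul0mx.
  apply: trmx_inj; rewrite trmxK trmx0 -(mxcol0 (p_ := fun=> n)).
  by apply: eq_mxcol => k; rewrite -sl_delta Hv.
- move=> c Hc; have fr : free [tuple slice T k | k < n].
    by rewrite /free size_tuple; apply/eqP; rewrite -[RHS]r3.
  apply/rowP => k; rewrite mxE; move/freeP: fr; apply; rewrite -[RHS]Hc sl.unlock.
  by apply: eq_bigr => j _; rewrite -tnth_nth tnth_mktuple.
Qed.

End LieDimension.

(** * Chains from rational parametrizations *)

Section RationalChains.
Variables (K : numFieldType) (N : nat).
Implicit Types (X Z : set 'rV[K]_N).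

Lemma closed_preimage (M : 'M[K]_N) Z : zariski_closed Z ->
  zariski_closed [set x | Z (x *m M)].
Proof.
move=> [S ->].
have sub p : exists q, forall x, q.@[pt x] = p.@[pt (x *m M)].
  elim/mpoly_generated: p => [c|i|p q [p' pE] [q' qE]|p q [p' pE] [q' qE]].
  - by exists c%:MP => x; rewrite !mevalC.
  - exists (\sum_j (M j i)%:MP * 'X_j) => x; rewrite mevalXU raddf_sum /pt mxE.
    by apply: eq_bigr => j _; rewrite /= mevalM mevalC mevalXU mulrC.
  - by exists (p' + q') => x; rewrite !mevalD pE qE.
  - by exists (p' * q') => x; rewrite !mevalM pE qE.
exists [set q | exists2 p, S p & forall x, q.@[pt x] = p.@[pt (x *m M)]].
apply/seteqP; split=> [x /= H q [p Sp qE]|x /= H p Sp].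
  by rewrite -/(pt x) qE; exact: H.
by have [q qE] := sub p; rewrite -/(pt _) -qE; apply: H; exists p.
Qed.

Lemma chain_transport (M : 'M[K]_N) X m F : M \in unitmx -> irreducible_chain X m F ->
  irreducible_chain [set x | X (x *m M)] m (fun i => [set x | F i (x *m M)]).
Proof.
move=> uM [Firr Flt]; split=> [i /Firr[[Z cZ FE] [[y Fy] irr]]|i /Flt[sub nsub]].
  split; first by exists [set x | Z (x *m M)]; [exact: closed_preimage | rewrite FE].
  split; first by exists (y *m invmx M) => /=; rewrite mulmxKV.
  move=> Z1 Z2 c1 c2 cov.
  have [|h|h] := irr _ _ (closed_preimage (invmx M) c1) (closed_preimage (invmx M) c2).
  - by move=> z Fz; apply: cov; rewrite /= mulmxKV.
  - by left=> x /h /=; rewrite mulmxK.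
  - by right=> x /h /=; rewrite mulmxK.
split=> [x /sub//|h]; apply: nsub => y Fy; have := h (y *m invmx M).
by rewrite /= mulmxKV //; apply.
Qed.

(* Rational functions of one variable with poles among the roots of b. *)
Definition rational (b : {poly K}) (g : K -> K) :=
  exists k (a : {poly K}), forall t, b.[t] != 0 -> g t * b.[t] ^+ k = a.[t].

Lemma rational_poly b g (a : {poly K}) : (forall t, b.[t] != 0 -> g t = a.[t]) -> rational b g.
Proof. by move=> H; exists 0%N, a => t bt; rewrite H // expr0 mulr1. Qed.

Lemma rationalD b g h : rational b g -> rational b h -> rational b (fun t => g t + h t).
Proof.
move=> [k [p pE]] [l [q qE]]; exists (k + l)%N, (p * b ^+ l + q * b ^+ k) => t bt.
by rewrite hornerD !hornerM !horner_exp -pE // -qE // exprD; ring.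
Qed.

Lemma rationalM b g h : rational b g -> rational b h -> rational b (fun t => g t * h t).
Proof.
move=> [k [p pE]] [l [q qE]]; exists (k + l)%N, (p * q) => t bt.
by rewrite hornerM -pE // -qE // exprD; ring.
Qed.

Lemma rational_cst b c : rational b (fun=> c).
Proof. by apply: (rational_poly (a := c%:P)) => t _; rewrite hornerC. Qed.

Lemma rational_sum b I (r : seq I) (G : I -> K -> K) : (forall i, rational b (G i)) ->
  rational b (fun t => \sum_(i <- r) G i t).
Proof.
move=> H; elim: r => [|i r IH].
  by apply: (rational_poly (a := 0)) => t _; rewrite big_nil horner0.
have [k [a aE]] := rationalD (H i) IH; exists k, a => t bt.
by rewrite big_cons; exact: aE.
Qed.

Lemma rational_meval b (g : K -> 'rV[K]_N) (p : {mpoly K[N]}) :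
  (forall i, rational b (fun t => g t 0 i)) -> rational b (fun t => p.@[pt (g t)]).
Proof.
move=> H; elim/mpoly_generated: p => [c|i|p q rp rq|p q rp rq].
- by have [k [a aE]] := rational_cst b c; exists k, a => t /aE; rewrite mevalC.
- by have [k [a aE]] := H i; exists k, a => t /aE; rewrite mevalXU.
- by have [k [a aE]] := rationalD rp rq; exists k, a => t /aE; rewrite mevalD.
- by have [k [a aE]] := rationalM rp rq; exists k, a => t /aE; rewrite mevalM.
Qed.

Lemma vanishing_closed Y : zariski_closed (zero_locus (vanishing Y) : set 'rV[K]_N).
Proof. by exists (vanishing Y). Qed.

(* A flag of affine subspaces through x0 is mapped to a chain; its members are
   irreducible because any two of their points lie on a rational curve. *)
Lemma chain_param X m (phi : 'rV[K]_m -> 'rV[K]_N) (f : 'rV[K]_m -> K)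
    (psi : 'I_m -> {mpoly K[N]}) (x0 : 'rV[K]_m) :
  f x0 != 0 -> (forall x, f x != 0 -> X (phi x)) ->
  (forall x i, f x != 0 -> (psi i).@[pt (phi x)] = x 0 i) ->
  (forall x y, exists2 b : {poly K}, forall t, b.[t] = f (x + t *: (y - x)) &
     forall j, rational b (fun t => phi (x + t *: (y - x)) 0 j)) ->
  exists F, irreducible_chain X m F.
Proof.
move=> fx0 phiX psiE line.
(* The coordinates from i on are frozen at those of [x0]; [F i] is the closure in X of the image of
   [L i]. *)
pose L i := [set x : 'rV[K]_m | f x != 0 /\ forall j : 'I_m, (i <= j)%N -> x 0 j = x0 0 j].
pose F i := X `&` zero_locus (vanishing (phi @` L i)).
have F_phi i x : L i x -> F i (phi x).
  by move=> Lx; split=> [|p]; [apply: phiX; case: Lx | apply; exists x].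
exists F; split=> [i lei|i lti].
  split; first by exists (zero_locus (vanishing (phi @` L i))) => //; exact: vanishing_closed.
  split; first by exists (phi x0); exact: F_phi.
  move=> Z1 Z2 [S1 E1] [S2 E2] cov.
  have witness Z S : Z = zero_locus S -> ~ (F i `<=` Z) ->
      exists p x, [/\ S p, L i x & p.@[pt (phi x)] != 0].
    move=> ZE nF; apply: contrapT => nw; apply: nF => y [_ Fy]; rewrite ZE => p Sp.
    apply: Fy => _ [x Lx <-]; apply/eqP; apply: contrapT => /negP px.
    by apply: nw; exists p, x.
  apply: contrapT => /not_orP[/(witness _ _ E1)[p1 [x1 [S1p L1 p1x]]]].
  move=> /(witness _ _ E2)[p2 [x2 [S2p L2 p2x]]].
  have [b bE phib] := line x1 x2.
  have [k1 [a1 a1E]] := rational_meval p1 phib.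
  have [k2 [a2 a2E]] := rational_meval p2 phib.
  have b0 : b.[0] != 0 by rewrite bE scale0r addr0; case: L1.
  have b1 : b.[1] != 0 by rewrite bE scale1r addrC subrK; case: L2.
  have a10 : a1.[0] != 0 by rewrite -a1E // scale0r addr0 mulf_neq0 // expf_neq0.
  have a21 : a2.[1] != 0 by rewrite -a2E // scale1r addrC subrK mulf_neq0 // expf_neq0.
  have nz (q : {poly K}) t : q.[t] != 0 -> q != 0 by apply: contraNneq => ->; rewrite horner0.
  (* On the curve through the images of [x1] and [x2], a point where both equations [p1] and [p2]
     are nonzero lies in neither closed set. *)
  have [t] := poly_nonroot (mulf_neq0 (nz _ _ b0) (mulf_neq0 (nz _ _ a10) (nz _ _ a21))).
  rewrite !hornerM !mulf_eq0 !negb_or => /and3P[bt a1t a2t].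
  have Lt : L i (x1 + t *: (x2 - x1)).
    split; first by rewrite -bE.
    move=> j leij; case: L1 => _ /(_ j leij) e1; case: L2 => _ /(_ j leij) e2.
    by rewrite !mxE e1 e2 subrr mulr0 addr0.
  case: (cov _ (F_phi _ _ Lt)); rewrite ?E1 ?E2 => h.
    by move: a1t; rewrite -a1E // (h _ S1p) mul0r eqxx.
  by move: a2t; rewrite -a2E // (h _ S2p) mul0r eqxx.
have Lsub : L i `<=` L i.+1 by move=> x [fx Lx]; split=> // j /ltnW/Lx.
split=> [y [Xy Fy]|h].
  split=> // p pL; apply: Fy => _ [x Lx <-]; apply: pL; exists x => //; exact: Lsub.
(* Strictness: [psi o] reads off the coordinate i, which is constant on the image of [L i] and
   varies on that of [L i.+1]. *)
pose o := Ordinal lti; pose y := x0 + delta_mx 0 o.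
have [b bE _] := line x0 y.
have b0 : b != 0.
  by apply/eqP => b0; move/eqP: fx0; apply; have := bE 0; rewrite b0 horner0 scale0r addr0 => <-.
have X0 : 'X != 0 :> {poly K} by rewrite polyX_eq0.
have [t] := poly_nonroot (mulf_neq0 b0 X0).
rewrite hornerM hornerX mulf_eq0 negb_or => /andP[bt t0].
have lineE : x0 + t *: (y - x0) = x0 + t *: delta_mx 0 o by rewrite /y [x0 + _ - x0]addrAC subrr add0r.
have fx : f (x0 + t *: delta_mx 0 o) != 0 by rewrite -lineE -bE.
have Lx : L i.+1 (x0 + t *: delta_mx 0 o).
  split=> // j ltij; rewrite !mxE eqxx /=.
  have -> : (j == o) = false by apply/eqP => jo; rewrite jo /= ltnn in ltij.
  by rewrite mulr0 addr0.
have [_ Fx] := h _ (F_phi _ _ Lx).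
have : (psi o - (x0 0 o)%:MP).@[pt (phi (x0 + t *: delta_mx 0 o))] = 0.
  apply: Fx => _ [z [fz Lz] <-].
  by rewrite mevalB mevalC psiE // (Lz o (leqnn _)) subrr.
rewrite mevalB mevalC psiE // !mxE !eqxx mulr1 addrAC subrr add0r => /eqP.
by rewrite (negbTE t0).
Qed.

End RationalChains.

(** * Stabilizers parametrized by a matrix and a scalar *)

Section MatrixParametrization.
Variables (K : numFieldType) (n : nat) (T : tensor K n).

Definition has_max_chain := exists F,
  irreducible_chain (@coords K n @` stabilizer T) (n ^ 2 + 1) F.

Variable z : rel 'I_n.

(** Positions marked by [z] are zero in the matrix that acts; the entries of [Q] there can carry
    other parameters of the stabilizer, which keeps their number at n^2. *)
Definition masked (Q : 'M[K]_n) : 'M[K]_n := \matrix_(i, j) if z i j then 0 else Q i j.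

Variables (Phi : 'M[K]_n -> K -> triple K n) (psiQ : 'I_n -> 'I_n -> {mpoly K[n * n + n * n + n * n]})
  (psib : {mpoly K[n * n + n * n + n * n]}).
Hypothesis z_diag : forall i, ~~ z i i.
Hypothesis Phi_stab : forall Q b, \det (masked Q) != 0 -> b != 0 -> stabilizer T (Phi Q b).
Hypothesis psiQE : forall Q b i j, \det (masked Q) != 0 -> b != 0 ->
  (psiQ i j).@[pt (coords (Phi Q b))] = Q i j.
Hypothesis psibE : forall Q b, \det (masked Q) != 0 -> b != 0 ->
  psib.@[pt (coords (Phi Q b))] = b.
Hypothesis Phi_rational : forall (p : {poly K}) (Q : K -> 'M[K]_n) (b : K -> K),
  (forall i j, rational p (fun t => Q t i j)) -> rational p b ->
  (forall i j, rational p (fun t => (\adj (masked (Q t))) i j)) ->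
  rational p (fun t => (\det (masked (Q t)))^-1) -> rational p (fun t => (b t)^-1) ->
  forall l, rational p (fun t => coords (Phi (Q t) (b t)) 0 l).

(** The parameters are the n^2 entries of [Q] and the scalar b, on the open set where
    [\det (masked Q) * b] is nonzero; it contains Q = 1, b = 1 since [z] avoids the diagonal. On a
    line this product is a polynomial and serves as the denominator. *)
Lemma matrix_param_chain : has_max_chain.
Proof.
pose matQ (x : 'rV[K]_(n * n + 1)) : 'M[K]_n := vec_mx (lsubmx x).
pose scab (x : 'rV[K]_(n * n + 1)) := rsubmx x 0 0.
pose f x := \det (masked (matQ x)) * scab x.
pose psi (i : 'I_(n * n + 1)) := match split i with
  | inl k => let: (p, q) := enum_val (cast_ord (esym (mxvec_cast n n)) k) in psiQ p q
  | inr _ => psib end.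
have fP x : f x != 0 -> \det (masked (matQ x)) != 0 /\ scab x != 0.
  by rewrite mulf_eq0 negb_or => /andP.
rewrite /has_max_chain (_ : (n ^ 2 + 1 = n * n + 1)%N) //.
apply: (@chain_param _ _ _ _ (fun x => coords (Phi (matQ x) (scab x))) f psi
  (row_mx (mxvec 1%:M) (const_mx 1))).
- rewrite /f /matQ /scab row_mxKl row_mxKr mxvecK mxE mulr1.
  suff -> : masked 1%:M = 1%:M by rewrite det1 oner_neq0.
  by apply/matrixP => i j; rewrite !mxE; case: eqP => [->|//]; rewrite ?(negbTE (z_diag _)) ?if_same.
- by move=> x /fP[d0 b0]; exists (Phi (matQ x) (scab x)) => //; exact: Phi_stab.
- move=> x i /fP[d0 b0]; rewrite -[x in RHS]hsubmxK /psi.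
  case: split_ordP => k ->; last by rewrite psibE // row_mxEr (ord1 k).
  rewrite row_mxEl; case/mxvec_indexP: k => p q.
  rewrite /mxvec_index cast_ordK enum_rankK psiQE //.
  by rewrite -(mxvecE (matQ x)) /matQ vec_mxK.
- move=> x y; pose Q t := matQ (x + t *: (y - x)); pose b t := scab (x + t *: (y - x)).
  pose Ap : 'M[{poly K}]_n := \matrix_(i, j)
    if z i j then 0 else (matQ x i j)%:P + 'X * (matQ y i j - matQ x i j)%:P.
  pose bp : {poly K} := (scab x)%:P + 'X * (scab y - scab x)%:P.
  have QE t i j : Q t i j = (((matQ x i j)%:P + 'X * (matQ y i j - matQ x i j)%:P) : {poly K}).[t].
    by rewrite !hornerE /Q /matQ !mxE.
  have bE t : b t = bp.[t] by rewrite !hornerE /b /scab !mxE.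
  have AE t : masked (Q t) = map_mx (horner_eval t) Ap.
    apply/matrixP => i j; rewrite [LHS]mxE [RHS]mxE [Ap i j]mxE; case: ifP => _; last exact: QE.
    by rewrite /= /horner_eval horner0.
  have dE t : \det (masked (Q t)) = (\det Ap).[t] by rewrite AE det_map_mx.
  exists (\det Ap * bp) => [t|l]; first by rewrite hornerM -dE -bE.
  apply: (@Phi_rational _ Q b).
  + by move=> i j; apply: rational_poly => t _; exact: QE.
  + by apply: rational_poly => t _; exact: bE.
  + move=> i j; apply: (rational_poly (a := (\adj Ap) i j)) => t _.
    by rewrite AE -map_mx_adj mxE.
  + exists 1%N, bp => t; rewrite expr1 hornerM mulf_eq0 negb_or => /andP[d0 b0].
    by rewrite dE mulKf.
  + exists 1%N, (\det Ap) => t; rewrite expr1 hornerM mulf_eq0 negb_or => /andP[d0 b0].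
    by rewrite bE mulrC mulfK.
Qed.

End MatrixParametrization.

Section Skew.
Variable K : numFieldType.

(** The action of [A] on the third exterior power, which is multiplication by the determinant. *)
Lemma skew_det_act (A : 'M[K]_3) c :
  A *m sl (skew_tensor K 3) (c *m A) *m A^T = \det A *: sl (skew_tensor K 3) c.
Proof.
pose m i j := A (inord i) (inord j).
have AE : A = mk3 (m 0%N 0%N) (m 0%N 1%N) (m 0%N 2%N) (m 1%N 0%N) (m 1%N 1%N) (m 1%N 2%N)
    (m 2%N 0%N) (m 2%N 1%N) (m 2%N 2%N) by exact: eq_mk3.
have ATE : A^T = mk3 (m 0%N 0%N) (m 1%N 0%N) (m 2%N 0%N) (m 0%N 1%N) (m 1%N 1%N) (m 2%N 1%N)
    (m 0%N 2%N) (m 1%N 2%N) (m 2%N 2%N) by apply: eq_mk3; rewrite mxE.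
have cA j : (c *m A) 0 (inord j) = c 0 (inord 0) * m 0%N j + c 0 (inord 1) * m 1%N j + c 0 (inord 2) * m 2%N j.
  by rewrite mxE !big_ord_recl big_ord0 addr0 addrA /m !inord3.
rewrite det3 -!/(m _ _) !sl_skew !cA ATE {1}AE !mul_mk3 scale_mk3.
by congr mk3; ring.
Qed.

Lemma skew_max_chain : has_max_chain (skew_tensor K 3).
Proof.
(* The two scalars multiply to the inverse of [\det Q] and cancel the determinant. *)
pose Phi (Q : 'M[K]_3) (b : K) : triple K 3 := (Q, (b * (\det Q)^-1) *: Q, b^-1 *: Q).
have maskE Q : masked (fun _ _ => false) Q = Q by apply/matrixP => i j; rewrite mxE.
(* The first matrix of the group element with variables as entries: the second matrix times the
   adjugate of the first is the scalar b, which recovers b without division. *)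
pose gA : 'M[{mpoly K[3 * 3 + 3 * 3 + 3 * 3]}]_3 := \matrix_(i, j) 'X_(posA i j).
apply: (@matrix_param_chain _ _ _ (fun _ _ => false) Phi (fun i j => 'X_(posA i j))
  (\sum_j 'X_(posB (inord 0) j) * (\adj gA) j (inord 0))) => //.
- move=> Q b; rewrite maskE => d0 b0.
  have uQ : Q \in unitmx by rewrite unitmxE unitfE.
  split; first by split; rewrite //= unitmxZ // unitfE ?mulf_neq0 ?invr_neq0.
  apply: eq_sl => c; rewrite sl_act /=.
  have -> : ((b * (\det Q)^-1) *: Q)^T = (b * (\det Q)^-1) *: Q^T by rewrite linearZ.
  have -> : c *m (b^-1 *: Q) = b^-1 *: (c *m Q) by rewrite -scalemxAr.
  have -> : sl (skew_tensor K 3) (b^-1 *: (c *m Q)) = b^-1 *: sl (skew_tensor K 3) (c *m Q).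
    by rewrite linearZ.
  rewrite -!scalemxAr -!scalemxAl skew_det_act !scalerA.
  by rewrite (_ : _ * \det Q = 1) ?scale1r //; field; apply/andP.
- by move=> Q b i j _ _; rewrite mevalXU /pt coordsA.
- move=> Q b; rewrite maskE => d0 b0.
  have gE v : map_mx (meval (pt (coords (Phi v b)))) gA = v.
    by apply/matrixP => i j; rewrite !mxE /= mevalXU /pt coordsA.
  rewrite raddf_sum /=.
  transitivity ((((b * (\det Q)^-1) *: Q) *m \adj Q) (inord 0) (inord 0)).
    rewrite [RHS]mxE; apply: eq_bigr => j _; rewrite mevalM mevalXU /pt coordsB.
    have adjE : map_mx (meval (pt (coords (Phi Q b)))) (\adj gA) = \adj Q.
      by rewrite map_mx_adj gE.
    congr (_ * _); by rewrite -adjE [RHS]mxE.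
  by rewrite -scalemxAl mul_mx_adj !mxE eqxx mulr1n divfK.
- move=> p Q b rQ rb radj rd rbV l; elim/pos_cases: l => i j.
  + have [k [a aE]] := rQ i j; exists k, a => t /aE; by rewrite coordsA.
  + have [k [a aE]] := rationalM (rationalM rb rd) (rQ i j); exists k, a => t /aE <-.
    by rewrite coordsB /= mxE maskE.
  + have [k [a aE]] := rationalM rbV (rQ i j); exists k, a => t /aE.
    by rewrite coordsC /= mxE.
Qed.
End Skew.

(** * A long chain in the stabilizer of the null algebra *)

Section Null.
Variables (K : numFieldType) (n : nat).
Implicit Types (Q : 'M[K]_n.+1) (c : 'rV[K]_n.+1).
Let NT := null_algebra K n.+1.

(* For (A, B, C) in the stabilizer, e0 *m A is a multiple of e0: the entries of A masked
   by z vanish, and these entries of Q hold hvec Q, a parameter of B, instead. *)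
Let z (i j : 'I_n.+1) := (i == 0) && (j != 0).
Let e0 : 'rV[K]_n.+1 := delta_mx 0 0.
Let D : 'M[K]_n.+1 := delta_mx 0 0.
Let hvec Q : 'cV[K]_n.+1 := \col_i if i == 0 then 0 else Q 0 i.

Let e0D : e0 *m D = e0. Proof. by rewrite mul_delta_mx. Qed.
Let D_e0 : D = e0^T *m e0. Proof. by rewrite trmx_delta mul_delta_mx. Qed.
Let e0h Q : e0 *m hvec Q = 0.
Proof. by apply/matrixP => i j; rewrite -rowE !mxE. Qed.
Lemma sl_nullE c : sl NT c = (c 0 0)%:M + (1%:M - D) *m c^T *m e0.
Proof.
rewrite sl_null; congr (_ + _ *m _); apply/colP => i.
rewrite mulmxBl mul1mx D_e0 -mulmxA -[e0 *m _]rowE mxE [RHS]mxE [X in _ + X]mxE outerE !mxE /=.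
by case: eqP => [->|_]; rewrite ?mul1r ?subrr // mul0r subr0.
Qed.

Lemma null_inj3 : inj3 NT.
Proof.
move=> c; rewrite sl_null => /matrixP e; apply/rowP => i; have := e i 0.
rewrite mxE outerE !mxE eqxx mulr1; case: eqP => [->|_]; first by rewrite mulr1n addr0.
by rewrite mulr0n add0r.
Qed.

(** With X inverse to A, the transposed second matrix is [X *m Hm h b]. The third is then forced:
    [Ct] sends the column of c to the coordinates of X T(c) (Hm h b)^-1 A, which is again a slice
    because e0 A = a e0 and e0 h = 0. *)
Let Hm (h : 'cV[K]_n.+1) (b : K) := b%:M + h *m e0.
Let Ct (X : 'M[K]_n.+1) (h : 'cV[K]_n.+1) (a b : K) := b^-1 *: D + (a * b^-1) *: (X *m (1%:M - D))
   - (a * b^-1 * b^-1) *: (X *m (h *m e0)).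

Let e0D' : e0 *m (1%:M - D) = 0.
Proof. by rewrite mulmxBr mulmx1 e0D subrr. Qed.

Section Action.
Variables (A X : 'M[K]_n.+1) (h : 'cV[K]_n.+1) (a b : K).
Hypotheses (AX : A *m X = 1%:M) (e0X : e0 *m X = a^-1 *: e0) (e0h' : e0 *m h = 0).
Hypotheses (a0 : a != 0) (b0 : b != 0).

Let D'X (v : 'cV[K]_n.+1) : e0 *m v = 0 -> (1%:M - D) *m (X *m v) = X *m v.
Proof.
move=> v0; have z0 : e0 *m (X *m v) = 0 by rewrite mulmxA e0X -scalemxAl v0 scaler0.
by rewrite mulmxBl mul1mx D_e0 -[e0^T *m e0 *m _]mulmxA z0 mulmx0 subr0.
Qed.

Lemma null_act c : A *m sl NT (c *m (Ct X h a b)^T) *m (X *m Hm h b) = sl NT c.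
Proof.
pose v := c^T; pose u := (1%:M - D) *m v.
have v0 : e0 *m v = (c 0 0)%:M.
  by rewrite -rowE; apply/matrixP => i j; rewrite !ord1 !mxE eqxx mulr1n.
have e0u : e0 *m u = 0 by rewrite mulmxA e0D' mul0mx.
pose w := (a * b^-1) *: (X *m u) - (a * b^-1 * b^-1 * c 0 0) *: (X *m h).
have CtE : Ct X h a b *m v = (b^-1 * c 0 0) *: e0^T + w.
  rewrite /Ct /w mulmxBl mulmxDl -!scalemxAl D_e0 -[e0^T *m e0 *m v]mulmxA v0 mul_mx_scalar.
  rewrite -[X *m (_ - _) *m v]mulmxA -D_e0 -/u -[X *m _ *m v]mulmxA -[h *m e0 *m v]mulmxA v0.
  by rewrite mul_mx_scalar -scalemxAr !scalerA addrA.
have cE : (c *m (Ct X h a b)^T)^T = Ct X h a b *m v by rewrite trmx_mul trmxK.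
have e0w : e0 *m w = 0.
  rewrite mulmxBr -!scalemxAr ![e0 *m (X *m _)]mulmxA e0X -!scalemxAl e0u e0h'.
  by rewrite !scaler0 subrr.
have e0e0 : e0 *m e0^T = 1%:M.
  by rewrite trmx_delta mul_delta_mx; apply/matrixP => i j; rewrite !ord1 !mxE.
have c'0 : (c *m (Ct X h a b)^T) 0 0 = b^-1 * c 0 0.
  have -> : (c *m (Ct X h a b)^T) 0 0 = (e0 *m (c *m (Ct X h a b)^T)^T) 0 0.
    by rewrite -rowE [RHS]mxE [RHS]mxE.
  by rewrite cE CtE mulmxDr e0w addr0 -scalemxAr e0e0 !mxE eqxx mulr1.
have D'w : (1%:M - D) *m w = w.
  by rewrite mulmxBr -!scalemxAr (D'X e0u) (D'X e0h').
have D'e : (1%:M - D) *m e0^T = 0.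
  by rewrite mulmxBl mul1mx D_e0 -mulmxA e0e0 mulmx1 subrr.
rewrite sl_nullE c'0 cE CtE [(1%:M - D) *m (_ + _)]mulmxDr D'w -scalemxAr D'e scaler0 add0r.
have key (w' : 'cV[K]_n.+1) (H0 : 'M[K]_n.+1) s : A *m (s%:M + w' *m e0) *m (X *m H0) =
    (s%:M + a^-1 *: (A *m w' *m e0)) *m H0.
  rewrite mulmxA mulmxDr mulmxDl mul_mx_scalar -scalemxAl AX scalemx1.
  congr ((_ + _) *m _).
  by rewrite -!mulmxA e0X -!scalemxAr.
rewrite key; have -> : a^-1 *: (A *m w *m e0) = b^-1 *: (u *m e0) - (b^-1 * b^-1 * c 0 0) *: (h *m e0).
  rewrite /w mulmxBr -!scalemxAr ![A *m (X *m _)]mulmxA AX !mul1mx mulmxBl -!scalemxAl.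
  by rewrite scalerBr !scalerA; congr (_ *: _ - _ *: _); field; rewrite ?a0 ?b0.
rewrite sl_nullE /Hm -/v -/u mulmxDl mulmxDr mul_scalar_mx mul_scalar_mx.
rewrite mulmxBl -!scalemxAl !mulmxDr !mul_mx_scalar.
have ee (y y' : 'cV[K]_n.+1) : e0 *m y' = 0 -> y *m e0 *m (y' *m e0) = 0.
  by move=> y0; rewrite mulmxA -[y *m e0 *m y']mulmxA y0 mulmx0 mul0mx.
rewrite !(ee _ _ e0h') !addr0 scale_scalar_mx !scalerA.
rewrite [X in _ = _ + X](_ : _ = 1 *: (u *m e0)); last by rewrite scale1r.
have -> : b^-1 * c 0 0 * b = c 0 0 by field.
have -> : b^-1 * b = 1 by field.
have -> : b^-1 * b^-1 * c 0 0 * b = b^-1 * c 0 0 by field.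
by rewrite -addrA; congr (_ + _); rewrite addrC subrK.
Qed.

End Action.

Let E Q := (\det (masked z Q))^-1 *: \adj (masked z Q).
Let Phi Q (b : K) : triple K n.+1 :=
  (masked z Q, (E Q *m Hm (hvec Q) b)^T, (Ct (E Q) (hvec Q) (Q 0 0) b)^T).

Section Point.
Variables (Q : 'M[K]_n.+1) (b : K).
Hypotheses (d0 : \det (masked z Q) != 0) (b0 : b != 0).
Let A := masked z Q.

Let AE : A *m E Q = 1%:M.
Proof. by rewrite -scalemxAr mul_mx_adj scale_scalar_mx mulVf. Qed.

Let e0A : e0 *m A = Q 0 0 *: e0.
Proof.
apply/rowP => j; rewrite -rowE !mxE eqxx /z /=.
by case: eqP => [->|_]; rewrite ?mulr1 ?mulr0.
Qed.

Let a0 : Q 0 0 != 0.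
Proof.
apply/eqP => a0; have := congr1 (mulmx^~ (E Q)) e0A; rewrite a0 scale0r mul0mx -mulmxA AE mulmx1.
by move/rowP/(_ 0)/eqP; rewrite !mxE !eqxx oner_eq0.
Qed.

Let e0E : e0 *m E Q = (Q 0 0)^-1 *: e0.
Proof.
have := congr1 (mulmx^~ (E Q)) e0A; rewrite -mulmxA AE mulmx1 -scalemxAl => e.
by rewrite {2}e scalerA mulVf // scale1r.
Qed.

Lemma null_stab : stabilizer NT (Phi Q b).
Proof.
have act_fix : act (Phi Q b) NT = NT.
  by apply: eq_sl => c; rewrite sl_act trmxK; exact: (null_act AE e0E (e0h Q) a0 b0).
have uA : A \in unitmx by rewrite unitmxE unitfE.
split=> //; split=> /=; first exact: uA.
- rewrite unitmx_tr unitmx_mul; have [-> _] := mulmx1_unit (etrans (mulmx1C AE) erefl).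
  have : Hm (hvec Q) b *m (b^-1%:M - (b^-1 * b^-1) *: (hvec Q *m e0)) = 1%:M.
    rewrite /Hm mulmxDl !mulmxBr -scalar_mxM mulfV // !mul_scalar_mx !mul_mx_scalar -!scalemxAr.
    rewrite mulmxA -[hvec Q *m e0 *m hvec Q]mulmxA e0h mulmx0 mul0mx scaler0 subr0 scalerA.
    by rewrite mulrA mulfV // mul1r subrK.
  by move/mulmx1_unit => [].
(* Invertibility of the third matrix follows from the invariance just shown: a row c that it kills
   has slice zero. *)
- rewrite -row_free_unit; apply: inj_row_free => c cC; apply: null_inj3.
  by rewrite -act_fix sl_act /= cC linear0 mulmx0 mul0mx.
Qed.

Lemma null_hvec : A *m (E Q *m Hm (hvec Q) b) = Hm (hvec Q) b.
Proof. by rewrite mulmxA AE mul1mx. Qed.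

End Point.

Lemma null_max_chain : has_max_chain NT.
Proof.
pose NN := (n.+1 * n.+1 + n.+1 * n.+1 + n.+1 * n.+1)%N.
(* The first matrix times the transpose of the second is [Hm]; its first column holds b at index 0
   and h elsewhere, so both are polynomials in the coordinates. *)
pose first_col (j : 'I_n.+1) : {mpoly K[NN]} := \sum_l 'X_(posA j l) * 'X_(posB 0 l).
have first_colE Q b j : \det (masked z Q) != 0 ->
    (first_col j).@[pt (coords (Phi Q b))] = Hm (hvec Q) b j 0.
  move=> d0; rewrite -null_hvec // raddf_sum [RHS]mxE; apply: eq_bigr => l _ /=.
  rewrite mevalM !mevalXU /pt coordsA coordsB /=; congr (_ * _).
  by rewrite mxE.
have HmE Q b j : Hm (hvec Q) b j 0 = b *+ (j == 0) + hvec Q j 0.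
  by rewrite /Hm mxE outerE !mxE eqxx mulr1.
apply: (@matrix_param_chain _ _ _ z Phi
  (fun i j => if z i j then first_col j else 'X_(posA i j)) (first_col 0)).
- by move=> i; rewrite /z; case: eqP.
- exact: null_stab.
- move=> Q b i j d0 b0; case: ifP => [zij|zij].
    rewrite first_colE // HmE mxE; case/andP: zij => /eqP-> /negbTE ->.
    by rewrite mulr0n add0r.
  by rewrite mevalXU /pt coordsA mxE zij.
- by move=> Q b d0 b0; rewrite first_colE // HmE mxE !eqxx addr0.
move=> p Q b rQ rb radj rd rbV l.
have cst := rational_cst p.
have rE i j : rational p (fun t => E (Q t) i j).
  by have [k [a aE]] := rationalM rd (radj i j); exists k, a => t /aE; rewrite [E _ _ _]mxE.
have rh j : rational p (fun t => hvec (Q t) j 0).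
  have [j0|j0] := eqVneq j 0.
    by have [k [a aE]] := cst 0; exists k, a => t /aE; rewrite mxE j0.
  by have [k [a aE]] := rQ 0 j; exists k, a => t /aE; rewrite mxE (negbTE j0).
have rmul (F G : K -> 'M[K]_n.+1) : (forall i j, rational p (fun t => F t i j)) ->
    (forall i j, rational p (fun t => G t i j)) ->
    forall i j, rational p (fun t => (F t *m G t) i j).
  move=> rF rG i j; have [k [a aE]] := rational_sum (index_enum _) (fun l => rationalM (rF i l) (rG l j)).
  by exists k, a => t /aE; rewrite [(_ *m _) _ _]mxE.
have rhe i j : rational p (fun t => (hvec (Q t) *m e0) i j).
  by have [k [a aE]] := rationalM (rh i) (cst (e0 0 j)); exists k, a => t /aE; rewrite outerE.
elim/pos_cases: l => i j.
- have [zij|zij] := boolP (z i j).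
    by have [k [a aE]] := cst 0; exists k, a => t /aE; rewrite coordsA mxE zij.
  by have [k [a aE]] := rQ i j; exists k, a => t /aE; rewrite coordsA mxE (negbTE zij).
- have rH i' j' : rational p (fun t => Hm (hvec (Q t)) (b t) i' j').
    have [k [a aE]] := rationalD (rationalM rb (cst (i' == j')%:R)) (rhe i' j').
    by exists k, a => t /aE; rewrite [Hm _ _ _ _]mxE [(_%:M) _ _]mxE mulr_natr.
  have [k [a aE]] := rmul _ _ rE rH j i; exists k, a => t /aE.
  by rewrite coordsB [(_^T) _ _]mxE.
- have rX1 := rmul _ _ rE (fun i j => cst ((1%:M - D) i j)) j i.
  have rX2 := rmul _ _ rE rhe j i.
  have ra := rQ 0 0.
  have [k [a aE]] := rationalD (rationalD (rationalM rbV (cst (D j i)))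
     (rationalM (rationalM ra rbV) rX1))
     (rationalM (cst (-1)) (rationalM (rationalM (rationalM ra rbV) rbV) rX2)).
  exists k, a => t /aE; rewrite coordsC [(_^T) _ _]mxE /Ct.
  by rewrite ![(_ + _ : 'M_(_, _)) _ _]mxE [(- _ : 'M_(_, _)) _ _]mxE ![(_ *: _ : 'M_(_, _)) _ _]mxE mulN1r.
Qed.

End Null.

(** * Transport of chains by isomorphisms and permutations of factors *)

Section ChainInvariance.
Variables (K : numFieldType) (n : nat).
Implicit Types (S T : tensor K n) (h : triple K n).
Let N := (n * n + n * n + n * n)%N.

Let decode (x : 'rV[K]_N) : triple K n :=
  (vec_mx (lsubmx (lsubmx x)), vec_mx (rsubmx (lsubmx x)), vec_mx (rsubmx x)).

Let decodeK : cancel decode (@coords K n).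
Proof. by move=> x; rewrite /coords /= !vec_mxK !hsubmxK. Qed.

Let coordsK : cancel (@coords K n) decode.
Proof.
by move=> [[A B] C]; rewrite /decode /coords /= !(row_mxKl, row_mxKr) !mxvecK.
Qed.

Let conj_lin (L : triple K n -> triple K n) : linear L -> linear (fun x => coords (L (decode x))).
Proof.
move=> Ll a x y; have -> : decode (a *: x + y) = a *: decode x + decode y.
  by congr (_, _, _); rewrite !linearP.
rewrite Ll /coords; case: (L (decode x)) (L (decode y)) => [[A1 B1] C1] [[A2 B2] C2] /=.
by rewrite !linearP /= !scale_row_mx !add_row_mx.
Qed.

(** Covers two uses at once: conjugation by a group element, for isomorphic tensors, and exchange of
    two components of the triple, for exchanged factors. Both extend to linear automorphisms of the
    ambient space. *)
Lemma max_chain_linear S T (L L' : triple K n -> triple K n) : linear L -> linear L' ->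
  cancel L L' -> cancel L' L -> (forall h, stabilizer T h <-> stabilizer S (L h)) ->
  has_max_chain S -> has_max_chain T.
Proof.
move=> Ll Ll' LK L'K ST [F FS].
pose f : {linear 'rV[K]_N -> 'rV[K]_N} :=
  HB.pack (fun x => coords (L (decode x))) (GRing.isLinear.Build K _ _ _ _ (conj_lin Ll)).
pose f' : {linear 'rV[K]_N -> 'rV[K]_N} :=
  HB.pack (fun x => coords (L' (decode x))) (GRing.isLinear.Build K _ _ _ _ (conj_lin Ll')).
have fE x : x *m lin1_mx f = coords (L (decode x)) by rewrite mul_rV_lin1.
have f'E x : x *m lin1_mx f' = coords (L' (decode x)) by rewrite mul_rV_lin1.
have uM : lin1_mx f \in unitmx.
  suff : lin1_mx f *m lin1_mx f' = 1%:M by move/mulmx1_unit => [].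
  apply/row_matrixP => i; by rewrite !rowE mulmxA fE f'E coordsK LK decodeK mulmx1.
exists (fun i => [set x | F i (x *m lin1_mx f)]).
have -> : @coords K n @` stabilizer T =
    [set x | (@coords K n @` stabilizer S) (x *m lin1_mx f)].
  apply/seteqP; split=> [_ [h /ST Sh <-]|x] /=; rewrite fE.
    by exists (L h) => //; rewrite coordsK.
  move=> [h Sh e]; exists (decode x); last exact: decodeK.
  by apply/ST; rewrite -(coordsK (L _)) -e coordsK.
exact: chain_transport.
Qed.

Lemma max_chain_iso S T : tensor_iso T S -> has_max_chain S -> has_max_chain T.
Proof.
move=> [g Gg ->]; have [gA gB gC] := Gg; have G'g := GL3_inv Gg.
apply: (@max_chain_linear _ _ (fun h => gmul (ginv g) (gmul h g)) (fun h => gmul g (gmul h (ginv g)))).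
- by move=> a x y; rewrite /gmul /=; congr (_, _, _); rewrite mulmxDl mulmxDr -scalemxAl -scalemxAr.
- by move=> a x y; rewrite /gmul /=; congr (_, _, _); rewrite mulmxDl mulmxDr -scalemxAl -scalemxAr.
- by move=> [[A B] C]; rewrite /gmul /=; congr (_, _, _); rewrite -[X in _ *m X = _]mulmxA !mulmxA mulmxK // mulmxV // mul1mx.
- by move=> [[A B] C]; rewrite /gmul /=; congr (_, _, _); rewrite !mulmxA mulmxKV // mulVmx // mul1mx.
move=> h; split=> [[Gh hT]|[Gh hS]].
  split; first by apply: GL3_mul => //; exact: GL3_mul.
  by rewrite -!act_mul hT act_inv.
have hE : h = gmul g (gmul (gmul (ginv g) (gmul h g)) (ginv g)).
  case: h {Gh hS} => [[A B] C]; rewrite /gmul /=; congr (_, _, _);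
  by rewrite !mulmxA mulmxK // mulmxV // mul1mx.
split; first by rewrite hE; apply: GL3_mul => //; exact: GL3_mul.
by rewrite {1}hE -act_mul -act_mul act_inv // hS.
Qed.

Lemma max_chain_swap12 T : has_max_chain T -> has_max_chain (swap12 T).
Proof.
pose L h : triple K n := (h.1.2, h.1.1, h.2).
have LK : cancel L L by move=> [[A B] C].
have L_lin : linear L by [].
have G h : GL3 h -> GL3 (L h) by move=> [gA gB gC].
apply: (max_chain_linear L_lin L_lin LK LK) => h; split=> -[Gh hT].
  split; first exact: G.
  by have := act_swap12 h (swap12 T); rewrite swap12K hT swap12K.
split; first by rewrite -(LK h); exact: G.
by have := act_swap12 (L h) T; rewrite hT; case: h {Gh hT} => [[A B] C].
Qed.

Lemma max_chain_swap23 T : has_max_chain T -> has_max_chain (swap23 T).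
Proof.
pose L h : triple K n := (h.1.1, h.2, h.1.2).
have LK : cancel L L by move=> [[A B] C].
have L_lin : linear L by [].
have G h : GL3 h -> GL3 (L h) by move=> [gA gB gC].
apply: (max_chain_linear L_lin L_lin LK LK) => h; split=> -[Gh hT].
  split; first exact: G.
  by have := act_swap23 h (swap23 T); rewrite swap23K hT swap23K.
split; first by rewrite -(LK h); exact: G.
by have := act_swap23 (L h) T; rewrite hT; case: h {Gh hT} => [[A B] C].
Qed.

(** Two adjacent transpositions generate the symmetric group; each of the six permutations is
    written as a word in them. *)
Lemma permute_factors_swaps (P : tensor K n -> Prop) : (forall T, P T -> P (swap12 T)) ->
  (forall T, P T -> P (swap23 T)) -> forall (s : 'S_3) T, P T -> P (permute_factors s T).
Proof.
move=> P12 P23 s T PT.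
have o (p : 'I_3) : [\/ p = inord 0, p = inord 1 | p = inord 2].
  by rewrite -(inord_val p); case: p => [[|[|[|//]]] ?] /=; [constructor 1|constructor 2|constructor 3].
have ne i j : (i < 3)%N -> (j < 3)%N -> i != j -> inord i <> inord j :> 'I_3.
  by move=> li lj ij /(congr1 val) /=; rewrite !inordK // => /eqP; rewrite (negbTE ij).
have inj i j : (i < 3)%N -> (j < 3)%N -> i != j -> s (inord i) <> s (inord j).
  by move=> li lj ij /perm_inj; exact: ne.
have s01 := inj 0%N 1%N isT isT isT; have s02 := inj 0%N 2%N isT isT isT.
have s12 := inj 1%N 2%N isT isT isT.
have t (i j k : 'I_n) : (tnth [tuple i; j; k] (inord 0) = i) * (tnth [tuple i; j; k] (inord 1) = j) *
    (tnth [tuple i; j; k] (inord 2) = k).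
  by rewrite !(tnth_nth i) !inordK.
case: (o (s (inord 0))) (o (s (inord 1))) (o (s (inord 2))) => e0 [] e1 [] e2;
  try by (exfalso; (apply: s01; congruence) || (apply: s02; congruence) || (apply: s12; congruence)).
- suff -> : permute_factors s T = T by [].
  by apply/ffunP => -[[i j] k]; rewrite !ffunE /= e0 e1 e2 !t.
- suff -> : permute_factors s T = swap23 T by exact: P23.
  by apply/ffunP => -[[i j] k]; rewrite !ffunE /= e0 e1 e2 !t.
- suff -> : permute_factors s T = swap12 T by exact: P12.
  by apply/ffunP => -[[i j] k]; rewrite !ffunE /= e0 e1 e2 !t.
- suff -> : permute_factors s T = swap12 (swap23 T) by exact: (P12 _ (P23 _ PT)).
  by apply/ffunP => -[[i j] k]; rewrite !ffunE /= e0 e1 e2 !t.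
- suff -> : permute_factors s T = swap23 (swap12 T) by exact: (P23 _ (P12 _ PT)).
  by apply/ffunP => -[[i j] k]; rewrite !ffunE /= e0 e1 e2 !t.
- suff -> : permute_factors s T = swap12 (swap23 (swap12 T)) by exact: (P12 _ (P23 _ (P12 _ PT))).
  by apply/ffunP => -[[i j] k]; rewrite !ffunE /= e0 e1 e2 !t.
Qed.

Lemma swap12_permute T : swap12 T = permute_factors (tperm (inord 0) (inord 1)) T.
Proof.
apply/ffunP => -[[i j] k]; rewrite !ffunE /= tpermL tpermR tpermD; last 2 first.
- by rewrite -val_eqE /= !inordK.
- by rewrite -val_eqE /= !inordK.
by rewrite !(tnth_nth i) !inordK.
Qed.

Lemma swap23_permute T : swap23 T = permute_factors (tperm (inord 1) (inord 2)) T.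
Proof.
apply/ffunP => -[[i j] k]; rewrite !ffunE /= tpermL tpermR tpermD; last 2 first.
- by rewrite -val_eqE /= !inordK.
- by rewrite -val_eqE /= !inordK.
by rewrite !(tnth_nth i) !inordK.
Qed.

Lemma permute_permute (s t : 'S_3) T :
  permute_factors s (permute_factors t T) = permute_factors (t * s)%g T.
Proof.
apply/ffunP => x; rewrite !ffunE /= !permM.
set y := tnth [tuple x.1.1; x.1.2; x.2].
have tE (p : 'I_3) : tnth [tuple y (s (inord 0)); y (s (inord 1)); y (s (inord 2))] p = y (s p).
  rewrite -(inord_val p) (tnth_nth (y p)) inordK //.
  by case: p => [[|[|[|//]]] ?].
by rewrite ffunE /= !tE.
Qed.

End ChainInvariance.

(** * Existence of the dimension and conclusion *)

Section KrullDimension.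
Variables (K : numFieldType) (N : nat).

Lemma closed_point (x : 'rV[K]_N) : zariski_closed [set x].
Proof.
exists [set p | exists i, p = 'X_i - (x 0 i)%:MP]; apply/seteqP; split=> [_ -> _ [i ->]|y /= H].
  by rewrite mevalB mevalXU mevalC subrr.
apply/rowP => i; apply/eqP; rewrite -subr_eq0; apply/eqP.
by have := H _ (ex_intro _ i erefl); rewrite mevalB mevalXU mevalC.
Qed.

(** A single point is a chain of length 0, so the set of chain lengths is nonempty; being bounded by
    [D], it has a maximum. *)
Lemma krull_dim_exists (X : set 'rV[K]_N) D : X !=set0 ->
  (forall m F, irreducible_chain X m F -> (m <= D)%N) ->
  exists2 d, is_krull_dim X d & (d <= D)%N.
Proof.
move=> [x Xx] XD.
have ub m : `[< exists F, irreducible_chain X m F >] -> (m <= D)%N.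
  by move=> /asboolP[F /XD].
have ex : exists m, `[< exists F, irreducible_chain X m F >].
  exists 0%N; apply/asboolP; exists (fun=> [set x]); split=> // i _; split.
    by exists [set x]; [exact: closed_point|rewrite setIC; apply/esym/setIidl => _ ->].
  split; first by exists x.
  by move=> Z1 Z2 _ _ /(_ x erefl)[] Zx; [left|right] => _ ->.
case: (ex_maxnP ex ub) => d /asboolP Xd max; exists d; last exact/ub/asboolP.
by split=> // m F XF; apply: max; apply/asboolP; exists F.
Qed.

End KrullDimension.

Local Close Scope ring_scope.
Local Close Scope classical_set_scope.

Theorem theorem1p10 (R : realType) (n : nat) (n_ge1 : (1 <= n)%N)
    (T : tensor (complex R) n) (T_concise : concise T) :
  exists d : nat,
    [/\ is_stab_dim T d,
        (d <= n ^ 2 + 1)%N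
      & d = (n ^ 2 + 1)%N <->
        (tensor_iso T (null_algebra (complex R) n) \/
         exists s : {perm 'I_3},
           tensor_iso T (permute_factors s (null_algebra (complex R) n))) \/
        (n = 3 /\ tensor_iso T (skew_tensor (complex R) n))].
Proof.
have [T1 T2 T3] := concise_inj T_concise.
have [lie_le lie_eq] := dim_lie_maximal n_ge1 T1 T2 T3.
have stab1 : nonempty (image (stabilizer T) (@coords (complex R) n)).
  by exists (coords (1%:M, 1%:M, 1%:M))%R; eexists; last reflexivity; split; [exact: GL3_1|exact: act1].
have [d Td d_le] := krull_dim_exists stab1 (@stab_dim_le _ _ T).
exists d; split=> //; first exact: leq_trans d_le lie_le.
split=> [dE|TE].
  (* [d] lies below the dimension of the Lie algebra, which lies below n^2 + 1: equality for [d]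
     forces it for the Lie algebra. *)
  have /lie_eq[[]|[n3 Tskew]] : \dim (lie T) = (n ^ 2 + 1)%N.
  - by apply/eqP; rewrite eqn_leq lie_le -dE d_le.
  - by left; left.
  - by rewrite swap12_permute; left; right; eexists; eassumption.
  - by rewrite swap23_permute; left; right; eexists; eassumption.
  - by rewrite swap23_permute swap12_permute permute_permute; left; right; eexists; eassumption.
  by right.
apply/eqP; rewrite eqn_leq (leq_trans d_le lie_le) /=.
(* The dimension bounds the length of every chain, so one chain of length n^2 + 1 gives the missing
   inequality; it is carried over from the model. *)
suff [F TF] : has_max_chain T by case: Td => _ /(_ _ _ TF).
have null_chain : has_max_chain (null_algebra (complex R) n).
  by case: (n) n_ge1 => // m _; exact: null_max_chain.
case: TE => [[|[s]]|[n3]] iT; first exact: max_chain_iso iT null_chain.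
  apply: max_chain_iso iT (permute_factors_swaps _ _ _ null_chain).
    exact: max_chain_swap12.
  exact: max_chain_swap23.
by subst n; exact: max_chain_iso iT (skew_max_chain _).
Qed.
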